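(* Let $A$ be a $C^*$-algebra, and let $m,M\in\mathbb{N}$. Assume that $A$ has $m$-comparison and that, for every $N\geq 1$ and every pair of elements $x',x\in\mathrm{Cu}(A)$ such that $x'\ll x$, there exists $y\in\mathrm{Cu}(A)$ satisfying $$x'\ll Ny\ll Mx.$$ Then the following are equivalent: (i) $A$ has the Global Glimm Property; (ii) there exists $L\in\mathbb{N}$ such that, for every pair $x',x\in\mathrm{Cu}(A)$ with $x'\ll x$, there exist $y_0,y_1\in\mathrm{Cu}(A)$ satisfying $y_0+y_1\leq x$, $x'\ll Ly_0$ and $x'\ll Ly_1$; (iii) $A$ is pure.
   Context: Cuntz semigroup: for a $C^*$-algebra $A$ and $a,b\in A_+$, $a\precsim b$ means there is a sequence $(v_n)$ in $A$ with $v_n b v_n^*\to a$; $a\sim b$ means $a\precsim b$ and $b\precsim a$. With $\mathcal{K}$ the compact operators on a separable infinite-dimensional Hilbert space, $\mathrm{Cu}(A)=(A\otimes\mathcal{K})_+/\!\sim$, with classes $[a]$, order $[a]\le[b]$ iff $a\precsim b$, and addition $[a]+[b]=[a\oplus b]$. For $a\in A_+$ and $\varepsilon>0$, $(a-\varepsilon)_+$ is the functional calculus of $a$ with $\lambda\mapsto\max\{\lambda-\varepsilon,0\}$. For $x,y\in\mathrm{Cu}(A)$, $x\ll y$ means $x=[a]$, $y=[b]$ and $a\precsim(b-\varepsilon)_+$ for some $\varepsilon>0$. For $x,y\in\mathrm{Cu}(A)$ write $x\leq_s y$ if $(k+1)x\le ky$ for some $k\in\mathbb{N}$. For $n\in\mathbb{N}$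 ($n=0$ allowed), $A$ has $n$-comparison if $x\leq_s y_j$ for $j=0,\ldots,n$ (with $x,y_j\in\mathrm{Cu}(A)$) implies $x\le\sum_{j=0}^n y_j$; $\mathrm{Cu}(A)$ is almost unperforated if it has $0$-comparison. $A$ is almost divisible if for every $x'\ll x$ in $\mathrm{Cu}(A)$ and every $N\in\mathbb{N}$ there is $y\in\mathrm{Cu}(A)$ with $Ny\le x$ and $x'\le(N+1)y$. $A$ is pure if $\mathrm{Cu}(A)$ is almost unperforated and almost divisible. $A$ has the Global Glimm Property if for every $a\in A_+$ and $\varepsilon>0$ there exists $r\in\overline{aAa}$ with $r^2=0$ such that $(a-\varepsilon)_+\in\overline{ArA}$, where $\overline{ArA}$ is the closed two-sided ideal generated by $r$. *)

(* Defs.v *)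
From HB Require Import structures.
From mathcomp Require Import all_boot all_order all_algebra.
From mathcomp Require Import all_classical all_reals all_analysis.
From mathcomp Require Import complex.

Set Implicit Arguments.
Unset Strict Implicit.
Unset Printing Implicit Defensive.

Import Order.TTheory GRing.Theory Num.Theory.
Import numFieldNormedType.Exports.

Local Open Scope classical_set_scope.
Local Open Scope complex_scope.
Local Open Scope ring_scope.

(* C*-algebras are not assumed unital, so they cannot be based on
   [pzRingType]; the norm takes its values in [R[i]]. *)
HB.mixin Record isCStarAlgebra (R : realType) A
    of CompleteNormedModule R[i] A := {
  cmul : A -> A -> A;
  cstar : A -> A;
  cmulA : associative cmul;
  cmulDl : left_distributive cmul +%R;
  cmulDr : right_distributive cmul +%R;
  cmulZl : forall (z : R[i]) (x y : A), cmul (z *: x) y = z *: cmul x y;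
  cmulZr : forall (z : R[i]) (x y : A), cmul x (z *: y) = z *: cmul x y;
  cstarK : involutive cstar;
  cstarD : {morph cstar : x y / x + y};
  cstarZ : forall (z : R[i]) (x : A), cstar (z *: x) = z^* *: cstar x;
  cstarM : forall x y : A, cstar (cmul x y) = cmul (cstar y) (cstar x);
  cnormM : forall x y : A, `|cmul x y| <= `|x| * `|y|;
  cnorm_star : forall x : A, `|cmul (cstar x) x| = `|x| ^+ 2
}.

#[short(type="cstarAlgType")]
HB.structure Definition CStarAlgebra (R : realType) :=
  { A of CompleteNormedModule R[i] A & isCStarAlgebra R A }.

Notation "x ** y" := (cmul x y) (at level 40, left associativity) : ring_scope.

Section CStar.
Context {R : realType} {A : cstarAlgType R}.
Implicit Types (a b c r x y : A) (e : R) (f : R -> R).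

Definition positive a := exists x, a = cstar x ** x.

(* [cpowS a n] is [a ^ (n + 1)] *)
Definition cpowS a n : A := iter n (cmul a) a.

(* Continuous functional calculus of a positive element [a], whose spectrum
   lies in [0, |a|], at a continuous [f] with [f 0 = 0]: [f(a)] is the limit of
   [p_k(a)] for polynomials [p_k = 'X * q_k] without constant term that
   converge to [f] uniformly on [0, |a|]. *)
Definition is_fcalc f a c :=
  exists q : nat -> {poly R},
    (forall d : R, 0 < d -> \forall k \near \oo, forall t : R,
       0 <= t -> t%:C <= `|a| -> `|t * (q k).[t] - f t| < d) /\
    (fun k => \sum_(i < size (q k)) ((q k)`_i)%:C *: cpowS a i) @ \oo --> c.

Definition fcalc f a : A := get (is_fcalc f a).

(* (a - e)_+ *)
Definition cutdown a e : A := fcalc (fun t => Num.max (t - e) 0) a.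

Definition cuntz_le a b :=
  exists v : nat -> A, (fun n => v n ** b ** cstar (v n)) @ \oo --> a.

Definition cuntz_eq a b := cuntz_le a b /\ cuntz_le b a.

(* Cuntz comparison in the C*-algebra M_n(A), whose norm topology is the
   topology of entrywise convergence. *)
Definition mx_cuntz_le n (a b : 'M[A]_n) :=
  exists v : nat -> 'M[A]_n, forall i j : 'I_n,
    (fun k => \sum_(l < n) \sum_(p < n) v k i l ** b l p ** cstar (v k j p))
      @ \oo --> a i j.

Definition mx_cuntz_eq n (a b : 'M[A]_n) := mx_cuntz_le a b /\ mx_cuntz_le b a.

Definition diag2 a b : 'M[A]_2 :=
  \matrix_(i, j) if i == j then (if i == 0 then a else b) else 0.

Definition hereditary a : set A :=
  closure [set y | exists x, y = a ** x ** a].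

Definition closed_ideal (I : set A) :=
  [/\ closed I, I 0,
      forall x y, I x -> I y -> I (x + y),
      forall (z : R[i]) x, I x -> I (z *: x) &
      forall x y, I x -> I (x ** y) /\ I (y ** x)].

Definition ideal_gen r : set A :=
  \bigcap_(I in [set I | closed_ideal I /\ I r]) I.

End CStar.

Definition global_glimm (R : realType) (A : cstarAlgType R) :=
  forall (a : A) (e : R), positive a -> 0 < e ->
    exists r : A, [/\ hereditary a r, r ** r = 0 &
      ideal_gen r (cutdown a e)].

Record hilbertSpace (R : realType) := HilbertSpace {
  hilb_sort :> completeNormedModType R[i];
  hdot : {dot hilb_sort for Num.conj};
  hdot_norm : forall h : hilb_sort, hdot h h = `|h| ^+ 2
}.

Section Hilbert.
Context {R : realType} (H : hilbertSpace R).

Definition hilb_separable :=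
  exists D : set H, countable D /\ dense D.

Definition hilb_infinite_dim :=
  forall (n : nat) (v : 'I_n -> H),
    exists h : H, forall c : 'I_n -> R[i], h <> \sum_(i < n) c i *: v i.

Definition compact_op (k : H -> H) :=
  linear k /\ compact (closure (k @` [set h | `|h| <= 1])).

Definition adjoint_op (k l : H -> H) :=
  forall g h : H, hdot H (k g) h = hdot H g (l h).

Definition lin_indep_ops n (k : 'I_n -> H -> H) :=
  forall c : 'I_n -> R[i],
    (forall h, \sum_(i < n) c i *: k i h = 0) -> forall i, c i = 0.

End Hilbert.

(* A realization of the C*-tensor product of [A] with the algebra K(H) of
   compact operators on [H]: a C*-algebra containing the algebraic tensor
   product as a dense *-subalgebra, through [(a, k) |-> a (x) k]. Since K(H) is
   nuclear, the algebraic tensor product has only one C*-norm, so that this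
   determines the C*-algebra up to isomorphism. [tens a k] is only constrained
   for compact [k]; [tens_inj] is the injectivity of the map induced on the
   algebraic tensor product. *)
Record stabilization (R : realType) (A : cstarAlgType R) (H : hilbertSpace R) :=
    Stabilization {
  stab_sort :> cstarAlgType R;
  tens : A -> (H -> H) -> stab_sort;
  tens_linl : forall k, compact_op k -> linear (tens^~ k);
  tens_linr : forall a (z : R[i]) k l, compact_op k -> compact_op l ->
    tens a (fun h => z *: k h + l h) = z *: tens a k + tens a l;
  tensM : forall a b k l, compact_op k -> compact_op l ->
    tens a k ** tens b l = tens (a ** b) (k \o l);
  tens_star : forall a k l, compact_op k -> compact_op l -> adjoint_op k l ->
    cstar (tens a k) = tens (cstar a) l;
  tens_inj : forall n (a : 'I_n -> A) (k : 'I_n -> H -> H),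
    (forall i, compact_op (k i)) -> lin_indep_ops k ->
    \sum_(i < n) tens (a i) (k i) = 0 -> forall i, a i = 0;
  tens_dense : dense [set b : stab_sort |
    exists n (a : 'I_n -> A) (k : 'I_n -> H -> H),
      (forall i, compact_op (k i)) /\ b = \sum_(i < n) tens (a i) (k i)]
}.

(* [Cu B] is the set of Cuntz classes of positive elements of [B]; the Cuntz
   semigroup of [A] is [Cu B] for [B] the stabilization of [A]. *)
Section Cu.
Context {R : realType} (B : cstarAlgType R).

Definition cuntz_class (a : B) : set B :=
  [set b | positive b /\ cuntz_eq b a].

Record Cu := MkCu {
  cu_set : set B;
  cu_setP : exists a, positive a /\ cu_set = cuntz_class a
}.

HB.instance Definition _ := gen_eqMixin Cu.
HB.instance Definition _ := gen_choiceMixin Cu.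

(* x = [a] *)
Definition cu_is (x : Cu) (a : B) := positive a /\ cu_set x = cuntz_class a.

Lemma positive0 : positive (0 : B).
Proof.
exists 0; rewrite -(scale0r 0) cmulZr.
by rewrite !scale0r.
Qed.

Definition cu0 : Cu :=
  MkCu (ex_intro _ (0 : B) (conj positive0 erefl)).

HB.instance Definition _ := isPointed.Build Cu cu0.

Definition cu_le (x y : Cu) :=
  exists a b, [/\ cu_is x a, cu_is y b & cuntz_le a b].

Definition cu_wb (x y : Cu) :=
  exists a b, [/\ cu_is x a, cu_is y b &
    exists2 e : R, 0 < e & cuntz_le a (cutdown b e)].

(* [a] + [b] = [a (+) b], where a (+) b = diag(a, b) lives in M_2(B). For B
   stable, [c |-> diag(c, 0)] induces a bijection between the Cuntz classes of
   B and those of M_2(B), which is also the one induced by the isomorphism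
   M_2(A (x) K) = A (x) M_2(K) = A (x) K. *)
Definition cu_add (x y : Cu) : Cu :=
  get [set z | exists a b c, [/\ cu_is x a, cu_is y b, cu_is z c &
    mx_cuntz_eq (diag2 c 0) (diag2 a b)]].

Definition cu_muln (n : nat) (x : Cu) : Cu := iter n (cu_add x) cu0.

Definition cu_sum n (y : 'I_n -> Cu) : Cu := \big[cu_add/cu0]_(j < n) y j.

Definition cu_les (x y : Cu) :=
  exists k : nat, cu_le (cu_muln k.+1 x) (cu_muln k y).

End Cu.

Section Properties.
Context {R : realType} {A : cstarAlgType R} {H : hilbertSpace R}.

(* Properties of [A], expressed through Cu(A) = [Cu AK]. *)
Variable AK : stabilization A H.

Definition has_comparison (n : nat) :=
  forall (x : Cu AK) (y : 'I_n.+1 -> Cu AK),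
    (forall j, cu_les x (y j)) -> cu_le x (cu_sum y).

Definition almost_unperforated := has_comparison 0.

Definition almost_divisible :=
  forall x' x : Cu AK, cu_wb x' x -> forall N : nat,
    exists y : Cu AK,
      cu_le (cu_muln N y) x /\ cu_le x' (cu_muln N.+1 y).

Definition pure := almost_unperforated /\ almost_divisible.

End Properties.

(* Main.v *)
(* For stable algebras the Cuntz semigroup is an ordered monoid with an
   auxiliary relation that satisfies (O5), (O6) and (O7). The argument has an
   order-theoretic and an operator-theoretic half.

   In the semigroup, the hypotheses say that there is a fixed loss [M] in
   divisibility and a fixed loss [m + 1] in comparison. If [x] moreover
   contains, up to a constant [L], two orthogonal large parts, then it contains
   any number of them, and errors that are small compared to [x] can be hidden
   in such a part. So one divides [x], up to an error, divides the error again,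
   and absorbs the last one in a spare part; this removes both losses.

   In the algebra, the Global Glimm Property is equivalent to: if [x' << x] then
   [2 w <= x] and [x' <= k w] for some [w] and [k]. From [r] in the hereditary
   subalgebra of [a] with [r^2 = 0] one gets orthogonal equivalent elements
   [r^* r] and [r r^*]; conversely two orthogonal equivalent elements
   [u_1 u_1^*] and [u_2 u_2^*], cut down into the hereditary subalgebra of [a],
   give the square-zero element [u_1 u_2^*]. The property on the elements of
   [A] extends to sums of their classes, hence to all of Cu(A) by density of
   the matrices over [A] in the stabilization. That density requires that
   [a (x) k] depends continuously on the compact operator [k]: if [r_n] bounds
   the norm of [(1 - P_n) k], then [k^* (1 - P_n) k <= r_n q^* q] for one
   compact [q], and tensoring with [a^* a] preserves this inequality. *)
From HB Require Import structures.
Require Import Defs.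
From mathcomp Require Import all_boot all_order all_algebra.
From mathcomp Require Import all_classical all_reals all_analysis.
From mathcomp Require Import complex zify ring lra.

Set Implicit Arguments.
Unset Strict Implicit.
Unset Printing Implicit Defensive.

Import Order.TTheory GRing.Theory Num.Theory.
Import Normc.
Import numFieldNormedType.Exports.

Local Open Scope complex_scope.
Local Open Scope ring_scope.

(** * Abstract Cuntz semigroups *)

(** The order-theoretic half is shaped by the absence of cancellation. A complement from (O5) is
    exact only up to elements way below, and a common summand can be removed only at the price of a
    fixed multiple of some reserve [w]; repeating the inequality often enough makes that price
    negligible. Inequalities are therefore carried as [x *+ (q * a) ≼ y *+ (q * b)] with an
    uncontrolled common factor [q], where only the ratio of [a] to [b] matters. Errors of division
    shrink by a fixed factor [C / (C + 1)] in each round, so finitely many rounds make them as small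
    as desired.

    The operator-theoretic half avoids spectra: positivity is the norm condition [cpos], and
    functional calculus is polynomial approximation in the unitization, where constants are
    available. Isometries of the multiplier algebra are replaced by two maps on the stabilization
    that move the rows of matrices to the even and to the odd positions; with them every sum of
    classes is the class of a sum of orthogonal elements. *)

(* [cu_O5], [cu_O6] and [cu_O7] are the axioms of these names in the theory of
   abstract Cuntz semigroups, restated without suprema of increasing sequences. *)
Record cu_axioms (S : nmodType) (le wb : S -> S -> Prop) : Prop := CuAxioms {
  cu_refl : forall x, le x x;
  cu_trans : forall x y z, le x y -> le y z -> le x z;
  cu_ge0 : forall x, le 0 x;
  cu_leD : forall x y z t, le x y -> le z t -> le (x + z) (y + t);
  cu_wbW : forall x y, wb x y -> le x y;
  cu_le_wb : forall x y z, le x y -> wb y z -> wb x z;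
  cu_wb_le : forall x y z, wb x y -> le y z -> wb x z;
  cu_wb0 : forall x, wb 0 x;
  cu_interp : forall x y, wb x y -> exists2 z, wb x z & wb z y;
  cu_dir : forall x y z, wb x z -> wb y z -> exists w, [/\ wb w z, le x w & le y w];
  cu_wbD : forall x y z t, wb x y -> wb z t -> wb (x + z) (y + t);
  cu_split : forall x y z, wb x (y + z) ->
    exists y' z', [/\ wb y' y, wb z' z & le x (y' + z')];
  cu_sup : forall x y, (forall x', wb x' x -> le x' y) -> le x y;
  cu_O5 : forall x' x z' z y, wb x' x -> wb z' z -> le (x + z) y ->
    exists c, [/\ le (x' + c) y, le y (x + c) & le z' c];
  cu_O6 : forall x' x y z, wb x' x -> le x (y + z) ->
    exists e f, [/\ le e x, le e y, le f x, le f z & le x' (e + f)];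
  cu_O7 : forall x1' x1 x2' x2 c, wb x1' x1 -> wb x2' x2 -> le x1 c -> le x2 c ->
    exists v, [/\ le x1' v, le x2' v, le v c & le v (x1 + x2)]
}.

Section AbstractCu.
Variables (S : nmodType) (le wb : S -> S -> Prop) (ax : cu_axioms le wb).
Local Notation "x ≼ y" := (le x y) (at level 70).
Local Notation "x ≪ y" := (wb x y) (at level 70).
Implicit Types x y z : S.

Let refl := cu_refl ax.
Let trans := cu_trans ax.
Let ge0 := cu_ge0 ax.
Let leD := cu_leD ax.
Let wbW := cu_wbW ax.
Let le_wb := cu_le_wb ax.
Let wb_le := cu_wb_le ax.

Hint Resolve refl ge0 : core.

Lemma cu_leDl x y z : x ≼ y -> x ≼ y + z.
Proof. by move=> h; rewrite -[x]addr0; exact: leD. Qed.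

Lemma cu_leDr x y z : x ≼ y -> x ≼ z + y.
Proof. by move=> h; rewrite -[x]add0r; exact: leD. Qed.

Lemma cu_leMn n x y : x ≼ y -> x *+ n ≼ y *+ n.
Proof. by move=> h; elim: n => [|n ih]; rewrite ?mulr0n// !mulrS; exact: leD. Qed.

Lemma cu_leMnl m n x : (m <= n)%N -> x *+ m ≼ x *+ n.
Proof. by move=> h; rewrite -(subnK h) mulrnDr; exact: cu_leDr. Qed.

Lemma cu_leMn2 m n x y : (m <= n)%N -> x ≼ y -> x *+ m ≼ y *+ n.
Proof. by move=> mn /(cu_leMn m) h; exact: trans h (cu_leMnl _ mn). Qed.

Lemma cu_scale n a b k l x y : (k <= a * n)%N -> (b * n <= l)%N ->
  x *+ a ≼ y *+ b -> x *+ k ≼ y *+ l.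
Proof.
move=> kan bnl h; apply: trans (cu_leMnl x kan) _; apply: trans (cu_leMnl y bnl).
by rewrite !mulrnA; exact: cu_leMn.
Qed.

Lemma cu_scale1 n b k l x y : (k <= n)%N -> (b * n <= l)%N ->
  x ≼ y *+ b -> x *+ k ≼ y *+ l.
Proof. by move=> kn bnl h; apply: (@cu_scale n 1 b); rewrite ?mul1n. Qed.

Lemma cu_wbMn n x y : x ≪ y -> x *+ n ≪ y *+ n.
Proof.
by move=> h; elim: n => [|n ih]; rewrite ?mulr0n ?mulrS;
  [exact: (cu_wb0 ax) | exact: (cu_wbD ax)].
Qed.

Lemma cu_wb_trans x y z : x ≪ y -> y ≪ z -> x ≪ z.
Proof. by move=> /wbW; exact: le_wb. Qed.

(** One [y'] serves all [n] summands because the elements way below [y] are directed. *)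
Lemma cu_splitMn n x y : x ≪ y *+ n -> exists2 y', y' ≪ y & x ≼ y' *+ n.
Proof.
elim: n x => [|n ih] x.
  by rewrite mulr0n => h; exists 0; [exact: (cu_wb0 ax)|rewrite mulr0n; exact: wbW].
rewrite mulrS => /(cu_split ax)[y1 [z1 [h1 hz h]]].
have [y2 h2 h2'] := ih _ hz.
have [w [wy yw1 yw2]] := cu_dir ax h1 h2.
exists w => //; rewrite mulrS; apply: trans h _; apply: leD => //.
by apply: trans h2' _; exact: cu_leMn.
Qed.

Lemma cu_wb_splitMn n x y : x ≪ y *+ n -> exists2 y', y' ≪ y & x ≪ y' *+ n.
Proof.
move=> /(cu_interp ax)[z xz /cu_splitMn[y' y'y h]].
by exists y' => //; exact: wb_le xz h.
Qed.

Lemma cu_wb_split x y z : x ≪ y + z ->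
  exists y' z', [/\ y' ≪ y, z' ≪ z & x ≪ y' + z'].
Proof.
move=> /(cu_interp ax)[w xw /(cu_split ax)[y' [z' [hy hz h]]]].
by exists y', z'; split => //; exact: wb_le xw h.
Qed.

Lemma cu_comp x' x y : x' ≪ x -> x ≼ y -> exists c, x' + c ≼ y /\ y ≼ x + c.
Proof.
move=> h xy; have := @cu_O5 _ _ _ ax x' x 0 0 y h (cu_wb0 ax _).
by rewrite addr0 => /(_ xy)[c [? ? _]]; exists c.
Qed.

(* A version of cancellation: the summand [U] can only be removed at the price
   of an arbitrarily small part of a multiple of [U]. *)
Lemma cu_cancel x U D w kappa : x + U ≼ U + D -> U ≼ w *+ kappa ->
  forall s, x *+ s ≼ w *+ kappa + D *+ s.
Proof.
move=> h Uw s; apply: (@trans _ (U + D *+ s)); last exact: leD.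
suff: x *+ s + U ≼ U + D *+ s by apply: trans; exact: cu_leDl.
elim: s => [|s ih]; first by rewrite !mulr0n add0r addr0.
rewrite !mulrS -addrA; apply: trans (leD (refl x) ih) _.
by rewrite addrA (addrA U); exact: leD.
Qed.

Definition cu_ls x y := exists k, x *+ k.+1 ≼ y *+ k.

Lemma cu_ls_mul q a b x y : (b < a)%N -> (0 < q)%N ->
  x *+ (q * a) ≼ y *+ (q * b) -> cu_ls x y.
Proof.
move=> ba q0 h; exists (q * b)%N; apply: trans h; apply: cu_leMnl.
by rewrite -(ltn_pmul2l q0) in ba.
Qed.

Definition cu_unperf := forall x y, cu_ls x y -> x ≼ y.

Definition cu_divisible := forall x' x, x' ≪ x -> forall N, exists y,
  y *+ N ≼ x /\ x' ≼ y *+ N.+1.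

(** The form that the Global Glimm Property takes in the semigroup. Here [k] may depend on [x'] and
    [x], whereas the [L] of [cu_2parts] is uniform. *)
Definition cu_2div := forall x' x, x' ≪ x ->
  exists w k, w *+ 2 ≼ x /\ x' ≼ w *+ k.

Definition cu_2parts L := forall x' x, x' ≪ x ->
  exists y0 y1, [/\ y0 + y1 ≼ x, x' ≪ y0 *+ L & x' ≪ y1 *+ L].

Lemma cu_divisible_2div : cu_divisible -> cu_2div.
Proof. by move=> h x' x /h/(_ 2)[y [h1 h2]]; exists y, 3. Qed.

Definition cu_scomp m := forall x (y : 'I_m.+1 -> S),
  (forall j, cu_ls x (y j)) -> x ≼ \sum_j y j.

(** * From 2-divisibility to two uniformly large parts *)

Section Comparison.
Variables (m M : nat).
Hypothesis comp : cu_scomp m.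
Hypothesis div : forall N, (1 <= N)%N -> forall x' x, x' ≪ x ->
  exists y, x' ≪ y *+ N /\ y *+ N ≪ x *+ M.

Lemma cu_scomp1 x y : cu_ls x y -> x ≼ y *+ m.+1.
Proof.
move=> h; have := comp (x := x) (y := fun=> y) (fun=> h).
by rewrite sumr_const card_ord.
Qed.

(** By (O6) a piece [e] of [z] lies below [c] and the rest [f] below [c *+ n]; the induction finds
    [v1] for [f], and (O7) joins [e] and [v1] inside [c] without exceeding their sum. The bound
    [v ≼ z *+ n] is the point: [v] is a part of [c] that is large for [z] but takes away little from
    [c]. *)
Lemma cu_cover n z' z c : z' ≪ z -> z ≼ c *+ n ->
  exists v, [/\ v ≼ c, v ≼ z *+ n & z' ≼ v *+ n].
Proof.
elim: n z' z => [|n ih] z' z z'z zc.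
  exists 0; split => //; apply: trans (wbW z'z) _.
  by apply: trans zc _; rewrite !mulr0n.
have [z1 z'z1 z1z] := cu_interp ax z'z.
rewrite mulrS in zc.
have [e [f [ez ec fz fc z1ef]]] := cu_O6 ax z1z zc.
have [e' [f' [e'e f'f z'ef]]] := cu_wb_split (wb_le z'z1 z1ef).
have [v1 [v1c v1f f'v1]] := ih _ _ f'f fc.
have [e2 [f2 [e2e f2f z'ef2]]] := cu_wb_split z'ef.
have [v2 v2v1 f2v2] := cu_splitMn (wb_le f2f f'v1).
have [v [e2v v2v vc ve]] := cu_O7 ax (cu_wb_trans e2e e'e) v2v1 ec v1c.
exists v; split => //.
  apply: trans ve _; rewrite mulrS; apply: leD => //.
  by apply: trans v1f _; exact: cu_leMn.
rewrite mulrS; apply: trans (wbW z'ef2) _; apply: leD => //.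
by apply: trans f2v2 _; exact: cu_leMn.
Qed.

(** The obstacle is that the [k] of [cu_2div] is unbounded while [L] must be uniform. Half of [x] is
    set aside as [w1], with complement [c0]; one part is a piece [v'] of [c0], uniformly large yet
    small against [x], and the other is [w1 + c] with [c] the complement of [v'] in [c0]. The number
    [k] enters only through the cancellation of [x2 *+ Q] against [w1], and repeating that
    inequality [s > k * Q] times makes the resulting bound independent of [k]. *)
Lemma cu_2div_2parts : cu_2div -> exists L, cu_2parts L.
Proof.
move=> div2.
(* The [2 * N] copies of [v] lie below [z *+ (N * (2 * m.+1))], hence below [x2 *+ Q]. As [N > Q],
   one of the [N] copies of [x2] is left for [c]; as [N > 2 * M], [z] is strictly smaller than [c0]
   in the sense of [cu_ls]. *)
set Q := (2 * m.+1 * M)%N; set N := (Q + 2 * M + 1)%N.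
exists (4 * N * m.+1)%N => x' x /(cu_interp ax)[x1 x'x1 /(cu_interp ax)[x2 x1x2]].
move=> /(cu_interp ax)[x3 x2x3 x3x].
have [w [k [wx x3w]]] := div2 _ _ x3x.
have [w1 w1w x2w1] := cu_splitMn (wb_le x2x3 x3w).
have [w2 w12 /(cu_interp ax)[w3 w23 w3w]] := cu_interp ax w1w.
have w23x : w2 + w3 ≼ x.
  apply: trans wx; rewrite mulr2n; apply: leD; last exact: wbW.
  by apply: wbW; exact: cu_wb_trans w23 w3w.
have [c0 [w1c0 xc0 w2c0]] := cu_O5 ax w12 w23 w23x.
have {}xc0 : x ≼ c0 *+ 2 by rewrite mulr2n; apply: trans xc0 _; exact: leD.
have N0 : (0 < N)%N by lia.
have [z [x1z zx2]] := div N0 x1x2.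
have x2x : x2 ≼ x by apply: wbW; exact: cu_wb_trans x2x3 x3x.
have zc0 : z ≼ c0 *+ m.+1.
  apply: cu_scomp1; apply: (@cu_ls_mul 1 (2 * M + 1) (2 * M)) => //; first lia.
  rewrite !mul1n; apply: (@trans _ (z *+ N)); first by apply: cu_leMnl; lia.
  apply: trans (wbW zx2) _; rewrite mulrnA; apply: cu_leMn.
  exact: trans x2x _.
have [z' z'z x1z'] := cu_splitMn x1z.
have [v [vc0 vz z'v]] := cu_cover z'z zc0.
have x1v : x1 ≼ v *+ (N * m.+1).
  apply: trans x1z' _; rewrite mulnC mulrnA; exact: cu_leMn.
have [v' v'v x'v'] := cu_wb_splitMn (wb_le x'x1 x1v).
have [c [v'c c0v]] := cu_comp v'v vc0.
exists v', (w1 + c); split.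
- rewrite addrCA; apply: trans w1c0; exact: leD.
- by apply: wb_le x'v' _; apply: cu_leMnl; lia.
apply: (cu_le_wb ax (wbW x'x1)); apply: wb_le x1x2 _.
rewrite mulrnA; apply: cu_scomp1.
have h1 : x2 *+ Q + x2 ≼ x2 *+ Q + c *+ (2 * N).
  rewrite -mulrSr; apply: (@trans _ (x2 *+ N)); first by apply: cu_leMnl; lia.
  apply: (@trans _ ((v + c) *+ (2 * N))).
    rewrite mulrnA; apply: cu_leMn; apply: trans x2x _; apply: trans xc0 _.
    exact: cu_leMn.
  rewrite mulrnDl; apply: leD => //.
  apply: (@trans _ (z *+ (N * (2 * m.+1)))).
    rewrite (_ : (N * (2 * m.+1) = m.+1 * (2 * N))%N); last lia.
    by rewrite [X in _ ≼ X]mulrnA; exact: cu_leMn.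
  rewrite mulrnA; apply: trans (cu_leMn _ (wbW zx2)) _; rewrite -mulrnA.
  by apply: cu_leMnl; lia.
rewrite [X in X ≼ _]addrC in h1.
have h2 : x2 *+ Q ≼ w1 *+ (k * Q) by rewrite mulrnA; exact: cu_leMn.
have {h1 h2} := cu_cancel h1 h2 (k * Q).+1.
set s := (k * Q).+1 => h.
apply: (@cu_ls_mul s 2 1) => //.
rewrite muln1 -[X in _ ≼ X]mulrnA (_ : (4 * N * s = 2 * N * s * 2)%N); last lia.
rewrite [X in X ≼ _]mulrnA [X in _ ≼ X]mulrnA; apply: cu_leMn; apply: trans h _.
rewrite mulrnDl; apply: leD; first by apply: cu_leMnl; lia.
by rewrite -mulrnA.
Qed.

(** * Absorption, tiling and embedding when two large parts exist *)

Section Parts.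
Variable L : nat.
Hypothesis parts2 : cu_2parts L.

Lemma cu_parts n : exists2 T, (0 < T)%N & forall x' x, x' ≪ x ->
  exists y : nat -> S, \sum_(i < n) y i ≼ x /\ forall i, (i < n)%N -> x' ≼ y i *+ T.
Proof.
elim: n => [|n [T T0 ih]].
  by exists 1 => // x' x _; exists (fun=> 0); rewrite big_ord0.
exists (L.+1 * T)%N => [|x' x]; first by rewrite muln_gt0.
move=> /parts2[y0 [y1 [y01 h0 /cu_splitMn[y1' h1' h1]]]].
have [y [yy1 hy]] := ih _ _ h1'.
exists (fun i => if i is i'.+1 then y i' else y0); split.
  by rewrite big_ord_recl /=; apply: trans y01; exact: leD.
move=> [_|i]; first by apply: trans (wbW h0) _; apply: cu_leMnl; nia.
rewrite ltnS => /hy h; apply: trans h1 _; rewrite mulnC mulrnA.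
exact: cu_leMn2.
Qed.

(** This removes the loss [m + 1] of comparison: an element way below [D] splits [D] into [m + 1]
    parts, each of which dominates it up to the factor [T]. Then [p'] is strictly smaller than every
    part, and the parts together still fit into one copy of [D]. *)
Lemma cu_absorb : exists T, forall p D q a b, (0 < q)%N -> (b * T < a)%N ->
  p *+ (q * a) ≼ D *+ (q * b) -> p ≼ D.
Proof.
have [T T0 h] := cu_parts m.+1.
exists T => p D q a b q0 ba pD; apply: (cu_sup ax) => p' p'p.
have /cu_splitMn[D' D'D p'D'] := wb_le (cu_wbMn (q * a) p'p) pD.
have [y [yD hy]] := h _ _ D'D; apply: trans yD; apply: comp => j.
apply: (@cu_ls_mul q a (b * T)) => //; apply: trans p'D' _.
by apply: (cu_scale1 (n := q * b)) (hy _ (ltn_ord j)) => //; nia.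
Qed.

(** Division of [x *+ M] becomes division inside [x]: absorption removes the factor [M] from the
    upper bound and charges it to the lower one, whose constant is linear in [G]. *)
Lemma cu_small : exists T, forall G x' x, x' ≪ x ->
  exists z, z *+ G ≼ x /\ x' ≪ z *+ (G * M * T + 1).
Proof.
have [T abs] := cu_absorb.
exists T => G x' x /(cu_interp ax)[x1 x'x1 x1x].
have [|z [x'z zx1]] := @div (G * M * T + 1) _ _ _ x'x1; first lia.
exists z; split => //; apply: (abs _ _ 1 (G * M * T + 1)%N (G * M)%N) => //.
  by lia.
rewrite !mul1n -mulrnA; apply: (@cu_scale G (G * M * T + 1)%N M).
- by rewrite mulnC.
- by rewrite mulnC.
by apply: trans (wbW zx1) _; apply: cu_leMn; exact: wbW.
Qed.

(* [y] and [y1] add up [K] interpolants between [z0] and [z]; they differ by one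
   summand only, so that replacing [y1] by [y] costs little. *)
Lemma cu_levels K z0 z : z0 ≪ z -> exists y y1 s,
  [/\ z0 ≼ s, s ≪ z & y ≪ y1] /\ [/\ y1 ≼ y + s, y1 ≼ z *+ K & z0 *+ K ≼ y].
Proof.
move=> z0z; elim: K => [|K [y [y1 [s [[h1 h2 h3] [h4 h5 h6]]]]]].
  have [s z0s sz] := cu_interp ax z0z.
  exists 0, 0, s; split; split; rewrite ?mulr0n //.
  - exact: wbW.
  - exact: (cu_wb0 ax).
have [t st tz] := cu_interp ax h2.
exists (y + s), (y1 + t), t; split; split => //.
- by apply: trans h1 (wbW st).
- exact: (cu_wbD ax).
- exact: leD.
- by rewrite mulrSr; apply: leD => //; exact: wbW.
- by rewrite mulrSr; exact: leD.
Qed.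

(** Division by [N] with remainder [d]. The complement supplied by (O5) only satisfies
    [x ≼ y1 *+ N + d] for an element [y1] above [y]; the pair from [cu_levels] makes the discrepancy
    at most [t = s *+ N], of relative size [1 / K]. The constant [C] depends neither on [N] nor on
    [K]. *)
Lemma cu_step : exists2 C, (0 < C)%N & forall N K x' x, (0 < N)%N -> (0 < K)%N ->
  x' ≪ x -> exists y d t,
  [/\ y *+ N + d ≼ x, x ≼ y *+ N + t + d, x' ≼ y *+ (N * C) & t *+ K ≼ x].
Proof.
have [T small] := cu_small.
exists (M * T).+1 => // N K x' x N0 K0 /(small (N * K)%N)[z [zx /cu_splitMn[z0 z0z x'z0]]].
have [y [y1 [s [[z0s sz yy1] [y1s y1z z0y]]]]] := cu_levels K z0z.
have [|d [yd xd]] := cu_comp (cu_wbMn N yy1) (y := x).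
  by apply: trans zx; apply: (cu_scale1 (n := N)) y1z; last rewrite mulnC.
exists y, d, (s *+ N); split => //.
- by rewrite -mulrnDl; apply: trans xd _; apply: leD => //; exact: cu_leMn.
- apply: trans x'z0 _; apply: (@cu_scale (N * (M * T).+1) K 1).
  + by rewrite -[(M * T).+1]addn1 !mulnDr !muln1 !mulnA (mulnC N) leq_add2l muln_gt0 K0.
  + by rewrite mul1n.
  + by rewrite mulr1n.
- by rewrite -mulrnA; apply: trans zx; apply: cu_leMn; exact: wbW.
Qed.

(** (O6) places the new error [e] below [x1] as well as below [d]. One copy of [e] therefore fits
    into [y *+ (N * C)] beside the [C] copies that fit into [d *+ C], which is the contraction by
    [C / (C + 1)]. *)
Lemma cu_shrink : exists2 C, (0 < C)%N & forall N K x' x, (0 < N)%N -> (0 < K)%N ->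
  x' ≪ x -> exists y t e,
  [/\ y *+ N + e ≼ x, x' ≼ y *+ N + t + e, e *+ C.+1 ≼ x *+ C & t *+ K ≼ x].
Proof.
have [C C0 step] := cu_step.
exists C => // N K x' x N0 K0 /(cu_interp ax)[x1 x'x1 x1x].
have [y [d [t [ydx xyd x1y tx]]]] := step N K _ _ N0 K0 x1x.
have [a [e [ax1 ay ex1 ed x'ae]]] := cu_O6 ax x'x1 (trans (wbW x1x) xyd).
exists y, t, e; split => //.
- by apply: trans ydx; exact: leD.
- by apply: trans x'ae _; exact: leD.
- rewrite mulrS; apply: trans (cu_leMn C ydx); rewrite mulrnDl -mulrnA.
  by apply: leD; [exact: trans x1y|exact: cu_leMn].
Qed.

(** Applying [cu_shrink] to its own error [j] times leaves an error of relative size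
    [C ^ j / C.+1 ^ j], while the small terms [t] add up to at most [j / K]. Both are made at most
    [1 / (2 * kappa)]. *)
Lemma cu_tiling N kappa x' x : (0 < N)%N -> x' ≪ x -> exists y r q,
  [/\ (0 < q)%N, y *+ N ≼ x, x' ≼ y *+ N + r & r *+ (q * kappa) ≼ x *+ q].
Proof.
move=> N0; have [C C0 shrink] := cu_shrink.
have iterate K j x1' x1 : (0 < K)%N -> x1' ≪ x1 -> exists y r e,
    [/\ y *+ N + e ≼ x1, x1' ≼ y *+ N + r + e,
        e *+ (C.+1 ^ j) ≼ x1 *+ (C ^ j) & r *+ K ≼ x1 *+ j].
  move=> K0; elim: j x1' x1 => [|j ih] x1' x1 x1'x1.
    by exists 0, 0, x1; rewrite !mul0rn !add0r; split => //; exact: wbW.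
  have [x2 x12 x21] := cu_interp ax x1'x1.
  have [y [r [e [h1 h2 h3 h4]]]] := ih _ _ x21.
  have [a [e' [aa e'e x1'ae]]] := cu_split ax (wb_le x12 h2).
  have [y2 [t [e2 [g1 g2 g3 g4]]]] := shrink N K _ _ N0 K0 e'e.
  exists (y + y2), (r + t), e2; split.
  - by rewrite mulrnDl -addrA; apply: trans h1; exact: leD.
  - apply: trans x1'ae _; rewrite mulrnDl [X in _ ≼ X + _]addrACA -addrA.
    by apply: leD => //; exact: wbW.
  - apply: (@trans _ (e *+ (C * C.+1 ^ j))).
      by apply: (cu_scale (n := C.+1 ^ j)) g3; rewrite ?expnS.
    by apply: (cu_scale (n := C)) h3; rewrite ?expnS // mulnC.
  - rewrite mulrnDl mulrSr; apply: leD => //; apply: trans g4 _.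
    by apply: trans h1; exact: cu_leDr.
move=> x'x; set j := (2 * kappa * C).+1.
have [//|y [r [e [h1 h2 h3 h4]]]] := iterate (2 * kappa * j).+1 j _ _ _ x'x.
(* Bernoulli's inequality for [1 + 1 / C], with denominators cleared. *)
have bern i : (C ^ i * (C + i) <= C * C.+1 ^ i)%N.
  elim: i => [|i ihi]; first by rewrite !expn0; lia.
  rewrite !expnS (mulnCA C C.+1); apply: leq_trans (leq_mul (leqnn _) ihi).
  by rewrite -mulnA (mulnCA C.+1) (mulnCA C (C ^ i)%N); apply: leq_mul => //; nia.
have hj : (2 * kappa * C ^ j <= C.+1 ^ j)%N.
  rewrite -(leq_pmul2l C0); apply: leq_trans (bern j).
  by rewrite mulnA mulnC; apply: leq_mul => //; rewrite /j; lia.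
exists y, (r + e), (2 * j * C.+1 ^ j)%N; split => //.
- by rewrite !muln_gt0 expn_gt0.
- by apply: trans h1; exact: cu_leDl.
- by rewrite addrA.
rewrite mulrnDl (_ : (2 * j * _ = j * C.+1 ^ j + j * C.+1 ^ j)%N); last lia.
rewrite mulrnDr; apply: leD.
  by apply: (cu_scale (n := C.+1 ^ j)) h4 => //; nia.
apply: (cu_scale (n := 2 * kappa * j)) h3; first nia.
by rewrite mulnA (mulnC (C ^ j)%N) mulnC leq_mul2l hj orbT.
Qed.

(* The pieces [p i] are placed into the room one by one; before each step the
   room is enlarged by a reserve [w] in which the whole of [x] is dominated. *)
Lemma cu_embed : exists T, forall P q x c w kappa (p p' : nat -> S) R,
  (0 < P)%N -> (0 < q)%N -> x *+ P ≼ c *+ P.-1 -> x ≼ w *+ kappa ->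
  (forall i, (i < R)%N -> p' i ≪ p i /\ p i *+ (q * (P * P * T).+1) ≼ x *+ q) ->
  (\sum_(i < R) p i) *+ (q * P) ≼ x *+ (q * P.+1) ->
  \sum_(i < R) p' i ≼ c + w *+ R.
Proof.
have [T abs] := cu_absorb.
exists T => P q x c w kappa p p' R P0 q0 xc xw hp hV.
suff H i : (i <= R)%N -> exists d,
    \sum_(j < i) p' j + d ≼ c + w *+ i /\ c ≼ \sum_(j < i) p j + d.
  by have [d [h _]] := H _ (leqnn _); apply: trans h; exact: cu_leDl.
elim: i => [|i ih] iR; first by exists c; rewrite !big_ord0 !add0r mulr0n addr0.
have [d [h1 h2]] := ih (ltnW iR).
have [p'p px] := hp _ iR.
set V := \sum_(j < i) p j in h2.
have hVi : V *+ (q * P) ≼ x *+ (q * P.+1).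
  apply: trans hV; apply: cu_leMn; rewrite -(subnKC (ltnW iR)) big_split_ord /=.
  exact: cu_leDl.
(* Since [P.+1 * P.-1 = (P * P).-1], the pieces already placed fill at most [U] out of [P * P]
   copies of [x] (each taken [q] times), and exactly one copy is left over to be dominated by
   multiples of [d]. *)
set U := x *+ (q * (P * P).-1).
have hU : U ≼ w *+ (kappa * (q * (P * P).-1)) by rewrite mulrnA; exact: cu_leMn.
have hxU : x *+ q + U ≼ U + d *+ (q * (P * P)).
  rewrite -mulrnDr (_ : (q + _ = P * (q * P))%N); last by nia.
  apply: trans (cu_scale (leqnn _) (leqnn _) xc) _.
  apply: trans (cu_leMn _ h2) _; rewrite mulrnDl; apply: leD.
    by apply: (cu_scale (n := P.-1)) hVi; nia.
  by apply: cu_leMnl; nia.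
have hs := cu_cancel hxU hU.
set s := (kappa * (q * (P * P).-1)).+1.
have xD : x *+ (q * s) ≼ (d + w) *+ (q * s * (P * P)).
  rewrite mulrnA; apply: trans (hs s) _; rewrite addrC mulrnDl -mulrnA.
  apply: leD; apply: cu_leMnl; first by rewrite mulnAC.
  apply: leq_trans (leqnSn _) _; rewrite -/s mulnAC mulnC.
  by apply: leq_pmulr; rewrite !muln_gt0 q0 P0.
have pD : p i ≼ d + w.
  apply: (abs _ _ (q * (q * s))%N (P * P * T).+1 (P * P)%N) => //.
    by rewrite !muln_gt0 q0.
  apply: trans (cu_scale (n := q * s) _ (leqnn _) px) _.
    by rewrite mulnAC.
  by apply: (cu_scale (n := q)) xD; [rewrite mulnC | rewrite mulnC mulnA].
have [d' [g1 g2]] := cu_comp p'p pD.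
exists d'; split; rewrite big_ord_recr /=.
  rewrite -addrA mulrSr [X in _ ≼ X]addrA; apply: (@trans _ (\sum_(j < i) p' j + (d + w))).
    exact: leD.
  by rewrite addrA; exact: leD.
apply: trans h2 _; rewrite -addrA; apply: leD => //.
by apply: trans g2; exact: cu_leDl.
Qed.

(** [Y] is divided into a room [c], still strictly larger than [x1], and a reserve [z1 *+ N.+1]. The
    element [x1] is cut into [N] equal tiles and an error; all are small enough for [cu_embed],
    which spends one copy of [z1] on each of the [N.+1] pieces. *)
Lemma cu_parts_unperf : cu_unperf.
Proof.
move=> x Y [k xY]; apply: (cu_sup ax) => x' x'x.
have [x1 x'x1 x1x] := cu_interp ax x'x.
have [x0 x'x0 x0x1] := cu_interp ax x'x1.
have [Y1 Y1Y x1Y1] := cu_splitMn (wb_le (cu_wbMn k.+1 x1x) xY).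
have [T emb] := cu_embed; have [T2 small] := cu_small.
(* [x1 *+ k.+1 ≼ Y *+ k] and [Y *+ k.+1 ≼ c *+ k.+2] combine to [x1 *+ P ≼ c *+ P.-1], because
   [k * k.+2 = P.-1]. The tiling error has relative size [1 / (N + P)]: the bound by [1 / N] makes
   it an admissible piece, the bound by [1 / P] controls its share of the total. *)
set P := (k.+1 * k.+1)%N; set N := (P * P * T).+1.
have [//|y [r [q [q0 yx x0y rx]]]] := @cu_tiling N (N + P) _ _ _ x0x1.
have [a [r' [ay r'r x'ar]]] := cu_split ax (wb_le x'x0 x0y).
have [y' y'y ay'] := cu_splitMn ay.
have [z [zY /cu_splitMn[z1 z1z Y1z1]]] := small (N.+1 * k.+2)%N _ _ Y1Y.
have [z2 z12 /(cu_interp ax)[z3 z23 z3z]] := cu_interp ax z1z.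
have z23Y : z2 *+ N.+1 + z3 *+ (N.+1 * k.+1) ≼ Y.
  apply: trans zY; rewrite [in X in _ ≼ X]mulnS mulrnDr.
  by apply: leD; apply: cu_leMn; apply: wbW => //; exact: cu_wb_trans z23 z3z.
have [c [cY Yc z2c]] := cu_O5 ax (cu_wbMn N.+1 z12) (cu_wbMn (N.+1 * k.+1) z23) z23Y.
have {}Yc : Y *+ k.+1 ≼ c *+ k.+2.
  rewrite [X in _ ≼ X]mulrS; apply: trans (cu_leMn _ Yc) _; rewrite mulrnDl.
  by apply: leD => //; rewrite -mulrnA.
apply: (@trans _ (y' *+ N + r')); first by apply: trans x'ar _; exact: leD.
pose p i := if (i < N)%N then y else r; pose p' i := if (i < N)%N then y' else r'.
have sump : \sum_(i < N.+1) p i = y *+ N + r.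
  rewrite big_ord_recr /= {2}/p ltnn; congr (_ + _).
  rewrite -[N in RHS]card_ord -sumr_const.
  by apply: eq_bigr => i _; rewrite /p ltn_ord.
have sump' : \sum_(i < N.+1) p' i = y' *+ N + r'.
  rewrite big_ord_recr /= {2}/p' ltnn; congr (_ + _).
  rewrite -[N in RHS]card_ord -sumr_const.
  by apply: eq_bigr => i _; rewrite /p' ltn_ord.
rewrite -sump'; apply: trans cY; rewrite addrC.
apply: (emb P q x1 c z1 ((N.+1 * k.+2 * M * T2 + 1) * k)%N p) => //.
- apply: (@trans _ (Y *+ (k.+1 * k))).
    apply: (cu_scale (n := k.+1)) (trans x1Y1 (cu_leMn _ (wbW Y1Y))) => //.
    by rewrite mulnC.
  by apply: (cu_scale (n := k)) Yc => //; rewrite /P; lia.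
- apply: (@trans _ (x1 *+ k.+1)); first by rewrite mulrSr; exact: cu_leDr.
  by apply: trans x1Y1 _; apply: (cu_scale1 (n := k)) Y1z1.
- move=> i _; rewrite /p /p' -/N; case: ifP => _; split => //.
    by apply: (cu_scale (n := q) (a := N) (b := 1)); rewrite ?mul1n ?mulr1n // mulnC.
  by apply: trans (cu_leMnl _ _) rx; rewrite leq_mul2l leq_addr orbT.
- rewrite sump mulrnDl mulnS addnC mulrnDr; apply: leD; first exact: cu_leMn.
  by apply: trans (cu_leMnl _ _) rx; rewrite leq_mul2l leq_addl orbT.
Qed.

Lemma cu_parts_divisible : cu_divisible.
Proof.
have au := cu_parts_unperf; move=> x' x /(cu_interp ax)[x1 x'x1 x1x] N.
(* The piece [u] swallows the tiling error [r]. It must be so small that [N] copies of [y + u] still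
   fit into [x]: since [G > N * N.+1], one has [N / N.+1 + N / G < 1], and almost unperforation
   applies. *)
have [T small] := cu_small; set G := (N.+1 * N).+1.
have [u [ux /wbW]] := small G _ _ x1x; set Pu := (G * M * T + 1)%N => x1u.
have [//|y [r [q [q0 yx x'y rx]]]] := @cu_tiling N.+1 Pu.+1 _ _ _ x'x1.
have ru : r ≼ u.
  apply: au; apply: (cu_ls_mul (ltnSn Pu) q0); apply: trans rx _.
  by apply: (cu_scale1 (n := q)) x1u => //; rewrite mulnC.
exists (y + u); split; last first.
  apply: trans x'y _; rewrite mulrnDl; apply: leD => //.
  by rewrite mulrS; exact: cu_leDl.
apply: au; apply: (@cu_ls_mul 1 (G * N.+1) (G * N + N.+1 * N)) => //.
  by rewrite /G; nia.
rewrite !mul1n -mulrnA mulrnDl mulrnDr; apply: leD.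
  apply: (@cu_scale (G * N) N.+1 1); rewrite ?mul1n //; first by nia.
  by apply: trans yx _; exact: wbW.
by apply: (@cu_scale (N * N.+1) G 1); rewrite ?mul1n //; nia.
Qed.
End Parts.
End Comparison.

(* [cu_2her] isolates the part of 2-divisibility that passes to sums. *)
Definition cu_2her x := forall y y', y ≼ x -> y' ≪ y ->
  exists f k, f *+ 2 ≼ y /\ y' ≼ f *+ k.

Lemma cu_2her4 x y y' : cu_2her x -> y ≼ x -> y' ≪ y ->
  exists f k, f *+ 4 ≼ y /\ y' ≪ f *+ k.
Proof.
move=> Dx yx /(cu_interp ax)[z y'z /(cu_interp ax)[z1 zz1 z1y]].
have [f [k [fy z1f]]] := Dx _ _ yx z1y.
have [f' f'f zf'] := cu_splitMn (wb_le zz1 z1f).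
have fx : f ≼ x by apply: trans yx; apply: trans fy; exact: cu_leDl.
have [g [l [gf f'g]]] := Dx _ _ fx f'f.
exists g, (l * k)%N; split.
  by apply: trans fy; apply: (@cu_scale 2 2 1); rewrite ?mulr1n.
by apply: wb_le y'z _; apply: trans zf' _; rewrite mulrnA; exact: cu_leMn.
Qed.

(** (O6) only covers [y] by two pieces that may overlap inside [y]. Two copies of a part [g1] of the
    first piece are removed from [y], and a third one is kept in the complement [c] so that
    [y ≼ c *+ 3]. Now [cu_cover] finds inside [c] a substitute [v] for the second piece with
    [v ≼ f2 *+ 3]; this is still below [x2] because [f2 *+ 4] is, so [v] can be divided in turn.
    Each piece is used three times, which two halvings provide. *)
Lemma cu_2herD x1 x2 : cu_2her x1 -> cu_2her x2 -> cu_2her (x1 + x2).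
Proof.
move=> D1 D2 y y' yx /(cu_interp ax)[ya y'ya yay].
have [e1 [e2 [e1y e1x e2y e2x yae]]] := cu_O6 ax yay yx.
have [e1' [e2' [e1e e2e y'e]]] := cu_split ax (wb_le y'ya yae).
have [f1 [k1 [f1e /cu_splitMn[g1 g1f e1g]]]] := cu_2her4 D1 e1x e1e.
have [f2 [k2 [f2e /cu_splitMn[h0 h0f e2h]]]] := cu_2her4 D2 e2x e2e.
have [g2 g12 /(cu_interp ax)[g3 g23 g3f]] := cu_interp ax g1f.
have gy : g2 *+ 2 + g3 ≼ y.
  apply: trans e1y; apply: trans f1e; apply: (@trans _ (f1 *+ 2 + f1)).
    by apply: leD; rewrite ?cu_leMn //; do ?[apply: cu_leMn]; apply: wbW => //;
      exact: cu_wb_trans g23 g3f.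
  by rewrite -mulrSr; exact: cu_leMnl.
have [c [gcy yc g2c]] := cu_O5 ax (cu_wbMn 2 g12) g23 gy.
have {}yc : y ≼ c *+ 3.
  by rewrite mulrSr; apply: trans yc _; apply: leD => //; exact: cu_leMn.
have [h1 h01 h1f] := cu_interp ax h0f.
have f24 : f2 ≼ f2 *+ 4 by exact: cu_leDl.
have [v [vc vf h1v]] := cu_cover h1f (trans f24 (trans f2e (trans e2y yc))).
have [v' v'v h0v] := cu_splitMn (wb_le h01 h1v).
have vx : v ≼ x2.
  by apply: trans e2x; apply: trans f2e; apply: trans vf _; exact: cu_leMnl.
have [h [k3 [hv v'h]]] := D2 _ _ vx v'v.
exists (g1 + h), (k1 + k3 * 3 * k2)%N; split.
  by rewrite mulrnDl; apply: trans gcy; apply: leD => //; exact: trans vc.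
apply: trans y'e _; rewrite mulrnDr; apply: leD.
  by apply: trans e1g _; apply: cu_leMn; exact: cu_leDl.
apply: trans e2h _; rewrite mulrnA; apply: cu_leMn; apply: trans h0v _.
rewrite mulrnA; apply: cu_leMn; apply: trans v'h _; apply: cu_leMn.
exact: cu_leDr.
Qed.

Lemma cu_2her_2div :
  (forall x' x, x' ≪ x -> exists2 z, x' ≼ z & cu_2her z) -> cu_2div.
Proof.
move=> h x' x /(cu_interp ax)[y x'y yx]; have [z yz Dz] := h _ _ yx.
have [f [k [fy x'f]]] := Dz _ _ yz x'y; exists f, k; split => //.
by apply: trans fy _; exact: wbW.
Qed.
End AbstractCu.

(** * Positive elements of unital C*-algebras *)

(** The calculus takes place in unital algebras, where constants and resolvents are available;
    [unitz] supplies the instance for an arbitrary C*-algebra. *)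
HB.mixin Record isUnitalCStar (R : realType) U of GRing.Algebra R[i] U := {
  ust : U -> U;
  unm : U -> R;
  ustK : involutive ust;
  ustD : {morph ust : x y / x + y};
  ustZ : forall (z : R[i]) x, ust (z *: x) = conjc z *: ust x;
  ustM : forall x y, ust (x * y) = ust y * ust x;
  unm0_eq0 : forall x, unm x = 0 -> x = 0;
  unmD : forall x y, unm (x + y) <= unm x + unm y;
  unmZ : forall (z : R[i]) x, unm (z *: x) = normc z * unm x;
  unmM : forall x y, unm (x * y) <= unm x * unm y;
  unm_star : forall x, unm (ust x * x) = unm x ^+ 2;
  unm_complete : forall u : nat -> U,
    (forall e : R, 0 < e -> exists N, forall m n, (N <= m)%N -> (N <= n)%N ->
      unm (u m - u n) <= e) ->
    exists l, forall e : R, 0 < e -> exists N, forall n, (N <= n)%N ->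
      unm (u n - l) <= e
}.

#[short(type="ucstarType")]
HB.structure Definition UnitalCStar (R : realType) :=
  { U of GRing.Algebra R[i] U & isUnitalCStar R U }.

Lemma normc_ge0 (R : realType) (z : R[i]) : 0 <= normc z.
Proof. by case: z => a b; exact: sqrtr_ge0. Qed.

Lemma normc_real (R : realType) (t : R) : normc t%:C = `|t|.
Proof. by rewrite /= expr0n/= addr0 sqrtr_sqr. Qed.

Lemma normc_i (R : realType) : normc ('i : R[i])%C = 1.
Proof. by rewrite /= expr0n/= add0r expr1n sqrtr1. Qed.

Lemma invS_small (R : realType) (e : R) : 0 < e ->
  exists N, forall n, (N <= n)%N -> n.+1%:R^-1 <= e.
Proof.
move=> e0; exists (Num.truncn e^-1) => n Nn.
rewrite -[leRHS]invrK lef_pV2 ?posrE ?invr_gt0//; apply: ltW.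
by apply: lt_le_trans (truncnS_gt _) _; rewrite ler_nat.
Qed.

(** * Norm, convergence and the square root iteration *)

Section UnitalCStarTheory.
Variables (R : realType) (U : ucstarType R).
Implicit Types (x y z a b g : U) (s t e : R).
Local Notation nm := (@unm R U).
Local Notation st := (@ust R U).

Definition sc t : U := t%:C *: 1.
Definition ucvg (u : nat -> U) l :=
  forall e, 0 < e -> exists N, forall n, (N <= n)%N -> nm (u n - l) <= e.
Definition sa x := st x = x.
(* The second condition says that the spectrum of [a] lies in [0, 2t]. *)
Definition cpos a := sa a /\ exists t, nm (sc t - a) <= t.

Lemma sc0 : sc 0 = 0. Proof. by rewrite /sc scale0r. Qed.
Lemma sc1 : sc 1 = 1. Proof. by rewrite /sc scale1r. Qed.
Lemma scD s t : sc (s + t) = sc s + sc t.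
Proof. by rewrite /sc rmorphD scalerDl. Qed.
Lemma scN t : sc (- t) = - sc t.
Proof. by rewrite /sc rmorphN scaleNr. Qed.
Lemma scB s t : sc (s - t) = sc s - sc t.
Proof. by rewrite scD scN. Qed.
Lemma scM s t : sc (s * t) = sc s * sc t.
Proof. by rewrite /sc rmorphM -scalerAl mul1r scalerA. Qed.
Lemma scE t x : sc t * x = t%:C *: x.
Proof. by rewrite /sc -scalerAl mul1r. Qed.
Lemma sc_comm t x : x * sc t = sc t * x.
Proof. by rewrite /sc -scalerAl -scalerAr mul1r mulr1. Qed.

Lemma unm0 : nm 0 = 0.
Proof. by rewrite -(scale0r 0) unmZ normc0 mul0r. Qed.
Lemma unmN x : nm (- x) = nm x.
Proof. by rewrite -scaleN1r unmZ normcN normc1 mul1r. Qed.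
Lemma unm_ge0 x : 0 <= nm x.
Proof.
have := unmD x (- x); rewrite subrr unm0 unmN -mulr2n.
by rewrite pmulrn_lge0.
Qed.
Lemma unm_le0 x : nm x <= 0 -> x = 0.
Proof. by move=> h; apply: unm0_eq0; apply/le_anti; rewrite h unm_ge0. Qed.
Lemma ust0 : st 0 = 0.
Proof. by have /eqP := @ustD _ _ 0 0 : st (0 + 0) = _; rewrite addr0 -subr_eq0 opprD addNKr oppr_eq0 => /eqP. Qed.
Lemma ustN x : st (- x) = - st x.
Proof. by apply/eqP; rewrite -subr_eq0 opprK -ustD addNr ust0. Qed.
Lemma ustB x y : st (x - y) = st x - st y.
Proof. by rewrite ustD ustN. Qed.
Lemma ust1 : st 1 = 1.
Proof. by rewrite -[RHS]ustK -[st 1 in RHS]mulr1 ustM ustK mulr1. Qed.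
Lemma ust_sc t : st (sc t) = sc t.
Proof. by rewrite /sc ustZ conjc_real ust1. Qed.
Lemma unm1 : nm 1 = 1.
Proof.
have := unm_star (1 : U); rewrite ust1 mul1r => /eqP.
rewrite expr2 -subr_eq0 -{1}[nm 1]mulr1 -mulrBr mulf_eq0 => /orP[/eqP/unm0_eq0|].
  by move=> /eqP; rewrite oner_eq0.
by rewrite subr_eq0 => /eqP.
Qed.
Lemma unm_sc t : nm (sc t) = `|t|.
Proof. by rewrite /sc unmZ unm1 mulr1 normc_real. Qed.
Lemma unm_scM t x : nm (sc t * x) = `|t| * nm x.
Proof. by rewrite scE unmZ normc_real. Qed.
Lemma unm_ust x : nm (st x) = nm x.
Proof.
suff h y : nm y <= nm (st y) by apply/le_anti; rewrite h -{2}[x]ustK h.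
have [->|y0] := eqVneq (nm y) 0; first exact: unm_ge0.
rewrite -(ler_pM2r (_ : 0 < nm y)); last by rewrite lt_def y0 unm_ge0.
by rewrite -expr2 -unm_star; exact: unmM.
Qed.
Lemma unmB x y : nm (x - y) <= nm x + nm y.
Proof. by rewrite -(unmN y); exact: unmD. Qed.
Lemma unm_distC x y : nm (x - y) = nm (y - x).
Proof. by rewrite -unmN opprB. Qed.
Lemma unm_tri z x y : nm (x - y) <= nm (x - z) + nm (z - y).
Proof. by apply: le_trans (unmD _ _); rewrite addrA subrK. Qed.
Lemma unm_sa x : sa x -> nm (x * x) = nm x ^+ 2.
Proof. by move=> h; rewrite -unm_star h. Qed.
Lemma unm_le_eps x y : (forall e, 0 < e -> nm (x - y) <= e) -> x = y.
Proof.
move=> h; apply/eqP; rewrite -subr_eq0; apply/eqP/unm_le0.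
by apply/ler_addgt0Pl => e /h; rewrite addr0.
Qed.
Lemma unmM3 x y z : nm (x * y * z) <= nm x * nm y * nm z.
Proof. by apply: le_trans (unmM _ _) _; apply: ler_wpM2r (unmM _ _); exact: unm_ge0. Qed.

Lemma ucvg_uniq u k l : ucvg u k -> ucvg u l -> k = l.
Proof.
move=> hk hl; apply: unm_le_eps => e e0; have e2 : 0 < e / 2 by rewrite divr_gt0.
have [m hm] := hk _ e2; have [n hn] := hl _ e2.
apply: le_trans (unm_tri (u (maxn m n)) _ _) _; rewrite [leRHS]splitr.
by apply: lerD; [rewrite unm_distC; apply: hm; exact: leq_maxl|apply: hn; exact: leq_maxr].
Qed.

Lemma ucvg_le u l x t : ucvg u l -> (forall n, nm (u n - x) <= t) -> nm (l - x) <= t.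
Proof.
move=> h ut; apply/ler_addgt0Pl => e e0; have [N /(_ N (leqnn _)) hN] := h _ e0.
by apply: le_trans (unm_tri (u N) _ _) _; apply: lerD => //; rewrite unm_distC.
Qed.

Lemma ucvgS u l : ucvg u l -> ucvg (fun n => u n.+1) l.
Proof. by move=> h e /h[N hN]; exists N => n Nn; apply: hN; exact: leqW. Qed.

Lemma ucvgMl u l x : ucvg u l -> ucvg (fun n => x * u n) (x * l).
Proof.
move=> h e e0; have x1 : 0 < nm x + 1 by rewrite ltr_wpDl ?unm_ge0.
have [|N hN] := h (e / (nm x + 1)); first exact: divr_gt0.
exists N => n /hN{}hN; rewrite -mulrBr; apply: le_trans (unmM _ _) _.
rewrite ler_pdivlMr// in hN; apply: le_trans hN; rewrite mulrC.
by apply: ler_wpM2l; rewrite ?unm_ge0// lerDl.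
Qed.

Lemma ucvg_ust u l : ucvg u l -> ucvg (fun n => st (u n)) (st l).
Proof. by move=> h e /h[N hN]; exists N => n /hN; rewrite -ustB unm_ust. Qed.

Lemma ucvgMr u l x : ucvg u l -> ucvg (fun n => u n * x) (l * x).
Proof.
move=> /ucvg_ust/(ucvgMl (st x))/ucvg_ust h.
rewrite -[l * x]ustK ustM => e /h[N hN]; exists N => n /hN.
by rewrite !ustM !ustK.
Qed.

Lemma ucvg_comm u l x : (forall n, x * u n = u n * x) -> ucvg u l -> x * l = l * x.
Proof.
move=> h ul; apply: (ucvg_uniq (ucvgMl x ul)).
by move=> e /(ucvgMr x ul)[N hN]; exists N => n /hN; rewrite h.
Qed.

Lemma ucvg_sa u l : (forall n, sa (u n)) -> ucvg u l -> sa l.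
Proof.
move=> h ul; apply: (ucvg_uniq (ucvg_ust ul)).
by move=> e /ul[N hN]; exists N => n /hN; rewrite h.
Qed.

Lemma saD x y : sa x -> sa y -> sa (x + y).
Proof. by rewrite /sa ustD => -> ->. Qed.
Lemma saB x y : sa x -> sa y -> sa (x - y).
Proof. by rewrite /sa ustB => -> ->. Qed.
Lemma sa_sc t : sa (sc t). Proof. exact: ust_sc. Qed.
Lemma sa1 : sa 1. Proof. exact: ust1. Qed.
Lemma saM x y : sa x -> sa y -> x * y = y * x -> sa (x * y).
Proof. by rewrite /sa ustM => -> -> ->. Qed.
Lemma saXX x : sa x -> sa (x * x). Proof. by move=> h; exact: saM. Qed.
Lemma sa_star x : sa (st x * x). Proof. by rewrite /sa ustM ustK. Qed.
Lemma saZ t x : sa x -> sa (sc t * x).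
Proof. by move=> h; apply: saM; rewrite ?sc_comm//; exact: sa_sc. Qed.

Lemma comm_sqrB x y : x * y = y * x -> x * x - y * y = (x + y) * (x - y).
Proof. by move=> h; rewrite mulrBr !mulrDl h opprD addrA addrK. Qed.

(* For [|g| <= 1] the iterates [s |-> (g + s^2)/2] started at 0 are dominated
   in norm, increments included, by the scalar ones for [g = 1]; their limit [s]
   solves [(1 - s)^2 = 1 - g]. *)
Fixpoint sq_iter g n : U :=
  if n is n'.+1 then sc 2^-1 * (g + sq_iter g n' * sq_iter g n') else 0.

Fixpoint sq_iterR n : R :=
  if n is n'.+1 then 2^-1 * (1 + sq_iterR n' ^+ 2) else 0.

Lemma sq_iterR_bnd n : 0 <= sq_iterR n <= 1.
Proof. by elim: n => [|n /andP[h1 h2]] /=; first lra; nra. Qed.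

Lemma sq_iterR_incr n : sq_iterR n <= sq_iterR n.+1.
Proof.
elim: n => [|n ih] /=; first lra.
have /andP[h1 h2] := sq_iterR_bnd n; have /andP[h3 h4] := sq_iterR_bnd n.+1.
rewrite -/(sq_iterR n.+1); nra.
Qed.

Lemma sq_iter_comm g x n : x * g = g * x -> x * sq_iter g n = sq_iter g n * x.
Proof.
move=> h; elim: n => [|n ih] /=; first by rewrite mulr0 mul0r.
rewrite mulrA sc_comm -!mulrA; congr (_ * _).
by rewrite mulrDr mulrDl h mulrA ih -!mulrA ih.
Qed.

Lemma sq_iter_sa g n : sa g -> sa (sq_iter g n).
Proof.
by move=> h; elim: n => [|n ih] /=; [exact: ust0|apply: saZ; apply: saD => //; exact: saXX].
Qed.

Lemma unm_half x : nm (sc 2^-1 * x) = 2^-1 * nm x.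
Proof. by rewrite unm_scM ger0_norm. Qed.

Lemma sq_iter_le g n : nm g <= 1 -> nm (sq_iter g n) <= sq_iterR n.
Proof.
move=> g1; elim: n => [|n ih] /=; first by rewrite unm0.
rewrite unm_half ler_pM2l//; apply: le_trans (unmD _ _) _; apply: lerD => //.
by apply: le_trans (unmM _ _) _; rewrite expr2; apply: ler_pM; rewrite ?unm_ge0.
Qed.

Lemma sq_iter_incr g n : nm g <= 1 ->
  nm (sq_iter g n.+1 - sq_iter g n) <= sq_iterR n.+1 - sq_iterR n.
Proof.
move=> g1; elim: n => [|n ih].
  rewrite [sq_iter g 0]/= [sq_iterR 0]/= !subr0; exact: sq_iter_le.
have -> : sq_iter g n.+2 - sq_iter g n.+1 = sc 2^-1 *
    ((sq_iter g n.+1 + sq_iter g n) * (sq_iter g n.+1 - sq_iter g n)).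
  have E k : sq_iter g k.+1 = sc 2^-1 * (g + sq_iter g k * sq_iter g k) by [].
  rewrite (E n.+1) {2}(E n) -mulrBr opprD addrACA subrr add0r comm_sqrB//.
  by rewrite sq_iter_comm// sq_iter_comm.
have -> : sq_iterR n.+2 - sq_iterR n.+1 =
    2^-1 * ((sq_iterR n.+1 + sq_iterR n) * (sq_iterR n.+1 - sq_iterR n)).
  by rewrite [sq_iterR n.+2]/= -/(sq_iterR n.+1) {2}[sq_iterR n.+1]/=; field.
rewrite unm_half ler_pM2l//; apply: le_trans (unmM _ _) _.
apply: ler_pM; rewrite ?unm_ge0//; apply: le_trans (unmD _ _) _.
by apply: lerD; exact: sq_iter_le.
Qed.

Lemma sq_iter_dist g m n : nm g <= 1 -> (m <= n)%N ->
  nm (sq_iter g n - sq_iter g m) <= sq_iterR n - sq_iterR m.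
Proof.
move=> g1 /subnK <-; elim: (n - m)%N => [|k ih].
  by rewrite add0n !subrr unm0.
rewrite addSn; apply: le_trans (unm_tri (sq_iter g (k + m)) _ _) _.
rewrite -[leRHS](subrKA (sq_iterR (k + m))); apply: lerD => //; exact: sq_iter_incr.
Qed.

Lemma sq_iterR_cvg : cvgn sq_iterR.
Proof.
apply: nondecreasing_is_cvgn.
  by apply/nondecreasing_seqP => n; exact: sq_iterR_incr.
by exists 1 => _ [n _ <-]; have /andP[] := sq_iterR_bnd n.
Qed.
End UnitalCStarTheory.

(** * Square roots and positivity of [ust x * x] *)

Section Positivity.
Variables (R : realType) (U : ucstarType R).
Implicit Types (x y z a b g p q : U) (s t e : R).
Local Notation nm := (@unm R U).
Local Notation st := (@ust R U).
Local Notation sc := (@sc R U).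

Lemma sq_root g : sa g -> nm g <= 1 -> exists s : U,
  [/\ sa s, nm s <= 1, (1 - s) * (1 - s) = 1 - g &
      forall x, x * g = g * x -> x * s = s * x].
Proof.
move=> gsa g1; have := @sq_iterR_cvg R.
move=> /cvgrPdist_le hc.
have /unm_complete[s hs] : forall e, 0 < e -> exists N, forall m n, (N <= m)%N ->
    (N <= n)%N -> nm (sq_iter g m - sq_iter g n) <= e.
  move=> e e0; have [N _ hN] := hc _ (divr_gt0 e0 (ltr0n _ 2)).
  exists N.
  suff H m n : (N <= m)%N -> (m <= n)%N -> nm (sq_iter g n - sq_iter g m) <= e.
    move=> m n Nm Nn; case: (leqP m n) => mn; first by rewrite unm_distC; exact: H.
    exact: H (ltnW mn).
  move=> Nm mn; apply: le_trans (sq_iter_dist g1 mn) _.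
  have h1 := hN _ Nm; have h2 := hN _ (leq_trans Nm mn).
  move: h1 h2; rewrite /= !ler_norml; lra.
have comm x : x * g = g * x -> x * s = s * x.
  by move=> h; apply: ucvg_comm hs => n; exact: sq_iter_comm.
exists s; split => //.
- by apply: ucvg_sa hs => n; exact: sq_iter_sa.
- rewrite -[s]subr0; apply: ucvg_le hs _ => n; rewrite subr0.
  by apply: le_trans (sq_iter_le _ g1) _; have /andP[] := @sq_iterR_bnd R n.
have hs2 : ucvg (fun n => sq_iter g n * sq_iter g n) (s * s).
  move=> e e0; have e2 : 0 < e / 2 by rewrite divr_gt0.
  have [N hN] := hs _ e2; exists N => n /hN h.
  rewrite comm_sqrB; last by apply: comm; rewrite (@sq_iter_comm _ _ g g).
  apply: le_trans (unmM _ _) _; rewrite [leRHS](_ : _ = 2 * (e / 2)); last by field.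
  apply: ler_pM; rewrite ?unm_ge0//; apply: le_trans (unmD _ _) _.
  have /andP[_ h1] := @sq_iterR_bnd R n; have h2 := sq_iter_le n g1.
  apply: (@le_trans _ _ (1 + 1)); last lra; apply: lerD; first exact: le_trans h2 h1.
  rewrite -[s]subr0; apply: ucvg_le hs _ => k; rewrite subr0.
  by apply: le_trans (sq_iter_le _ g1) _; have /andP[] := @sq_iterR_bnd R k.
have E : sc 2 * s = g + s * s.
  have : ucvg (fun n => sq_iter g n.+1) (sc 2^-1 * (g + s * s)).
    apply: ucvgMl => e /hs2[N hN]; exists N => n /hN.
    by rewrite opprD addrACA subrr add0r.
  move=> /(ucvg_uniq (ucvgS hs)) h; rewrite {1}h.
  by rewrite mulrA -scM divff ?pnatr_eq0// sc1 mul1r.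
rewrite mulrBr mulr1 mulrBl mul1r opprB.
rewrite scE (_ : 2%:C = 2%:R) in E; last by rewrite rmorphMn rmorph1.
rewrite scaler_nat mulr2n in E.
have -> : s * s = s + s - g by rewrite E addrC addKr.
by rewrite (addrAC (s + s)) addrK addrA subrK.
Qed.

(** The norm condition in [cpos] makes [g = (t - a) / t] a contraction, so [sq_root] applies to
    [a = t (1 - g)]. The last clause expresses that the root is a limit of polynomials in [a]. *)
Lemma cposP a : cpos a -> exists y,
  [/\ sa y, y * y = a, cpos y & forall x, x * a = a * x -> x * y = y * x].
Proof.
move=> [asa [t ta]].
have [t0|t0] := leP t 0.
  have -> : a = 0.
    apply/eqP; rewrite -oppr_eq0; apply/eqP/unm_le0.
    have /unm_le0 h : nm (sc t - a) <= 0 by exact: le_trans ta t0.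
    have t00 : t = 0.
      by apply/le_anti; rewrite t0 /=; apply: le_trans ta; exact: unm_ge0.
    by move: h; rewrite t00 sc0 add0r => ->; rewrite unm0.
  exists 0; split.
  - exact: ust0.
  - by rewrite mulr0.
  - by split; [exact: ust0|exists 0; rewrite sc0 subrr unm0].
  - by move=> x _; rewrite mulr0 mul0r.
have [r r0 rt] : exists2 r, 0 < r & r * r = t.
  by exists (Num.sqrt t); rewrite ?sqrtr_gt0// -expr2 sqr_sqrtr// ltW.
set g := sc t^-1 * (sc t - a).
have ag : a = sc t * (1 - g).
  rewrite mulrBr mulr1 /g mulrA -scM divff ?gt_eqF// sc1 mul1r opprB addrC subrK//.
have gsa : sa g by apply: saZ; apply: saB => //; exact: sa_sc.
have [|s [ssa s1 sE scom]] := sq_root gsa.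
  by rewrite unm_scM ger0_norm ?invr_ge0 ?(ltW t0)// ler_pdivrMl// mulr1.
exists (sc r * (1 - s)); split.
- by apply: saZ; apply: saB => //; exact: sa1.
- by rewrite -mulrA [X in _ * X]mulrA sc_comm -!mulrA sE mulrA -scM rt ag.
- split; first by apply: saZ; apply: saB => //; exact: sa1.
  exists r; rewrite mulrBr mulr1 subKr unm_scM ger0_norm ?(ltW r0)//.
  by rewrite -[leRHS]mulr1; apply: ler_wpM2l => //; exact: ltW.
- move=> x xa; rewrite mulrA sc_comm -!mulrA; congr (_ * _).
  rewrite mulrBr mulrBl mulr1 mul1r scom// /g mulrA sc_comm -!mulrA.
  by congr (_ * _); rewrite mulrBr mulrBl sc_comm xa.
Qed.

Lemma sc2 x : sc 2 * x = x + x.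
Proof. by rewrite scE rmorphMn rmorph1 scaler_nat mulr2n. Qed.

Definition im : R[i] := 'i%C.

Lemma im_im : im * im = -1.
Proof. by rewrite -expr2; exact: sqr_i. Qed.

Lemma conjc_im : conjc im = - im.
Proof. by rewrite /im; simpc. Qed.

Lemma re_im_mul x y : x * y = y * x ->
  (x - im *: y) * (x + im *: y) = x * x + y * y.
Proof.
move=> h; rewrite mulrDr !mulrBl -!scalerAr -!scalerAl scalerA im_im scaleN1r.
by rewrite opprK h addrA addrNK.
Qed.

Lemma ust_im x y : sa x -> sa y -> st (x + im *: y) = x - im *: y.
Proof.
move=> hx hy; rewrite ustD ustZ hx hy; congr (_ + _).
by rewrite conjc_im scaleNr.
Qed.

(* If [x] and [y] are commuting and self-adjoint, then [u = x + iy] has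
   [u^* u = x^2 + y^2], and [x] and [y] are recovered from [u] and [u^*]. *)
Lemma sum_sq_le x y t : sa x -> sa y -> x * y = y * x -> 0 <= t ->
  x * x + y * y = sc (t * t) -> nm x <= t /\ nm y <= t.
Proof.
move=> hx hy xy t0 h; set u := x + im *: y.
have stu : st u = x - im *: y by exact: ust_im.
have ut : nm u = t.
  apply/eqP; rewrite -(@eqrXn2 _ 2) ?unm_ge0// -unm_star stu re_im_mul// h unm_sc.
  by rewrite ger0_norm ?mulr_ge0// expr2.
have ust : nm (st u) = t by rewrite unm_ust.
split; rewrite -(@ler_pM2l _ 2)//.
  rewrite -[X in X * _]ger0_norm// -unm_scM sc2.
  rewrite (_ : x + x = u + st u); last by rewrite stu addrACA subrr addr0.
  by apply: le_trans (unmD _ _) _; rewrite ut ust mulr_natl mulr2n.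
rewrite -[X in X * _]ger0_norm// -unm_scM sc2.
rewrite (_ : nm (y + y) = nm (u - st u)).
  by apply: le_trans (unmB _ _) _; rewrite ut ust mulr_natl mulr2n.
by rewrite stu opprB [u + _]addrC /u addrA subrK -scalerDr unmZ normc_i mul1r.
Qed.

(** The square roots of [x] and [t - x] commute and their squares add up to [t], so [sum_sq_le]
    bounds them by the root of [t]. *)
Lemma cpos_le_sc x t : cpos x -> cpos (sc t - x) -> 0 <= t -> nm x <= t.
Proof.
move=> /cposP[y [ysa yx _ ycom]] /cposP[w [wsa wx _ wcom]] t0.
have yw : y * w = w * y.
  apply/wcom; rewrite mulrBr mulrBl sc_comm; congr (_ - _).
  by apply/esym/ycom; rewrite -yx mulrA.
have [] := @sum_sq_le y w (Num.sqrt t); rewrite ?sqrtr_ge0//.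
  by rewrite -[_ * Num.sqrt t]expr2 sqr_sqrtr// yx wx addrC subrK.
move=> h _; rewrite -yx unm_sa// -[leRHS]sqr_sqrtr//.
by rewrite ler_sqr ?nnegrE ?unm_ge0 ?sqrtr_ge0.
Qed.

(** The root [w] of [t^2 - y^2] given by [sq_root] commutes with [y] and satisfies
    [y^2 + w^2 = t^2], so [sum_sq_le] bounds it. This is what makes squares of self-adjoint elements
    positive. *)
Lemma unm_sq_sub y t : sa y -> nm y <= t -> nm (sc (t * t) - y * y) <= t * t.
Proof.
move=> ysa yt; have t0 : 0 <= t by apply: le_trans yt; exact: unm_ge0.
have [t00|tn0] := eqVneq t 0.
  rewrite t00 mul0r sc0 sub0r unmN; move: yt; rewrite t00 => /unm_le0 ->.
  by rewrite mul0r unm0.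
have {t0 tn0} t0 : 0 < t by rewrite lt_def tn0.
set g := sc (t^-1 * t^-1) * (y * y).
have gsa : sa g by apply: saZ; exact: saXX.
have ttg : sc (t * t) * g = y * y.
  by rewrite mulrA -scM mulrACA divff ?gt_eqF// mulr1 sc1 mul1r.
have [|s [ssa s1 sE scom]] := sq_root gsa.
  rewrite unm_scM unm_sa// ger0_norm ?mulr_ge0 ?invr_ge0 ?(ltW t0)//.
  rewrite -invfM mulrC ler_pdivrMr ?mulr_gt0// mul1r expr2.
  by apply: ler_pM; rewrite ?unm_ge0.
set w := sc t * (1 - s).
have wsa : sa w by apply: saZ; apply: saB => //; exact: sa1.
have ww : w * w = sc (t * t) - y * y.
  by rewrite -mulrA [X in _ * X]mulrA sc_comm -!mulrA sE mulrA -scM mulrBr mulr1 ttg.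
have yw : y * w = w * y.
  rewrite mulrA sc_comm -!mulrA; congr (_ * _); rewrite mulrBr mulrBl mulr1 mul1r.
  by rewrite scom// mulrA sc_comm -!mulrA.
have [] := @sum_sq_le y w t ysa wsa yw (ltW t0).
  by rewrite ww addrC subrK.
move=> _ h; rewrite -ww unm_sa// expr2; apply: ler_pM; rewrite ?unm_ge0//.
Qed.

Lemma cpos_sq y : sa y -> cpos (y * y).
Proof.
move=> ysa; split; first exact: saXX.
exists (nm y * nm y); exact: unm_sq_sub.
Qed.

Lemma cpos_unm a t : cpos a -> nm a <= t -> nm (sc t - a) <= t.
Proof.
move=> /cposP[y [ysa yx _ _]] at_.
have t0 : 0 <= t by apply: le_trans at_; exact: unm_ge0.
rewrite -yx -[t]sqr_sqrtr// expr2; apply: unm_sq_sub => //.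
rewrite -(@ler_pXn2r _ 2) ?nnegrE ?sqrtr_ge0 ?unm_ge0//.
by rewrite sqr_sqrtr// -unm_sa// yx.
Qed.

Lemma cpos_sa a : cpos a -> sa a. Proof. by case. Qed.

Lemma cposD a b : cpos a -> cpos b -> cpos (a + b).
Proof.
move=> [asa [t ta]] [bsa [s sb]]; split; first exact: saD.
exists (t + s); rewrite scD opprD addrACA.
by apply: le_trans (unmD _ _) _; exact: lerD.
Qed.

Lemma cpos0 : cpos (0 : U).
Proof. by rewrite -(mulr0 0); apply: cpos_sq; exact: ust0. Qed.

Lemma cposZ t a : 0 <= t -> cpos a -> cpos (sc t * a).
Proof.
move=> t0 [asa [s sb]]; split; first exact: saZ.
by exists (t * s); rewrite scM -mulrBr unm_scM ger0_norm//; exact: ler_wpM2l.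
Qed.

Lemma cpos_sc t : 0 <= t -> cpos (sc t).
Proof.
by move=> t0; split; [exact: sa_sc|exists t; rewrite subrr unm0].
Qed.

Lemma cpos_anti a : cpos a -> cpos (- a) -> a = 0.
Proof.
move=> h1 h2; apply: unm_le0; apply: (cpos_le_sc h1) => //.
by rewrite sc0 sub0r.
Qed.

Lemma cpos_sc_ge0 t : cpos (sc t) -> 0 <= t.
Proof.
move=> h; rewrite leNgt; apply/negP => t0.
have : sc t = 0 by apply: cpos_anti h _; rewrite -scN; apply: cpos_sc; lra.
by move=> /(congr1 nm); rewrite unm_sc unm0 => /eqP; rewrite normr_eq0 lt_eqF.
Qed.

(** The numbers [t] witnessing positivity of the approximants need not be bounded; [cpos_unm]
    replaces them by norms, which are at most [nm a + 1]. *)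
Lemma cpos_closed a : (forall e, 0 < e -> exists2 b, cpos b & nm (a - b) <= e) -> cpos a.
Proof.
move=> h; split.
  apply: unm_le_eps => e e0; have [|b bpos ab] := h (e / 2); first by rewrite divr_gt0.
  apply: le_trans (unm_tri b _ _) _; rewrite [leRHS]splitr; apply: lerD.
    by rewrite -[X in _ - X](cpos_sa bpos) -ustB unm_ust.
  by rewrite unm_distC.
exists (nm a + 1); apply/ler_addgt0Pl => e e0.
have [|b bpos ab] := h (Num.min e 1); first by rewrite lt_min e0 ltr01.
apply: le_trans (unm_tri b _ _) _; rewrite [leRHS]addrC.
apply: lerD; last by rewrite unm_distC; apply: le_trans ab _; rewrite ge_min lexx.
apply: cpos_unm => //; rewrite -[b](subrK a) addrC; apply: le_trans (unmD _ _) _.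
by rewrite lerD2l unm_distC; apply: le_trans ab _; rewrite ge_min lexx orbT.
Qed.

Lemma cposM_comm a b : cpos a -> cpos b -> a * b = b * a -> cpos (a * b).
Proof.
move=> /cposP[y [ysa ya _ ycom]] /cposP[z [zsa zb _ zcom]] ab.
have yb : b * y = y * b by apply: ycom.
have zy : y * z = z * y by apply: zcom.
have -> : a * b = (y * z) * (y * z).
  by rewrite -{1}ya -mulrA -yb -zb -!mulrA zy.
by apply: cpos_sq; exact: saM.
Qed.


Lemma cpos_scale_inv t a : 0 < t -> cpos (sc t * a) -> cpos a.
Proof.
move=> t0 h; have := cposZ (ltW (_ : 0 < t^-1)) h; rewrite invr_gt0 => /(_ t0).
by rewrite mulrA -scM mulVf ?gt_eqF// sc1 mul1r.
Qed.

Lemma cpos_sc_sub x t : sa x -> nm x <= t -> cpos (sc t - x).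
Proof.
move=> h xt; split; first by apply: saB => //; exact: sa_sc.
by exists t; rewrite subKr.
Qed.

(* The norm of a positive [q] is additive against scalars, so that
   [|q T + q^2| <= T |q|] is only possible for [q = 0]. *)
Lemma cpos_quad_eq0 q T : cpos q -> 0 <= T -> nm (sc T * q + q * q) <= T * nm q -> q = 0.
Proof.
move=> qpos T0 hq; set K := T * nm q.
have qsa := cpos_sa qpos.
have T2 : 0 <= T / 2 by rewrite divr_ge0.
have K0 : 0 <= K by rewrite mulr_ge0 ?unm_ge0.
have Tq : cpos (sc T * q + q * q) by apply: cposD; [exact: cposZ|exact: cpos_sq].
have hK : cpos (sc K - (sc T * q + q * q)) by apply: cpos_sc_sub => //; exact: cpos_sa.
set r := q + sc (T / 2).
have rpos : cpos r by apply: cposD => //; exact: cpos_sc.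
have rr : r * r = sc T * q + q * q + sc (T / 2 * (T / 2)).
  rewrite mulrDr !mulrDl -!scM (sc_comm _ q) addrA; congr (_ + _).
  by rewrite -addrA -mulrDl -scD -splitr addrC.
set S := Num.sqrt (K + T / 2 * (T / 2)).
have KT : 0 <= K + T / 2 * (T / 2) by rewrite addr_ge0// mulr_ge0.
have rS : nm r <= S.
  rewrite -(@ler_pXn2r _ 2) ?nnegrE ?sqrtr_ge0 ?unm_ge0// sqr_sqrtr//.
  rewrite -unm_sa; last exact: cpos_sa.
  apply: cpos_le_sc => //; first by apply: cpos_sq; exact: cpos_sa.
  by rewrite rr scD opprD addrACA subrr addr0.
have Sq : cpos (sc (S - T / 2) - q).
  rewrite scB -addrA -opprD [sc (T / 2) + q]addrC; apply: cpos_sc_sub => //.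
  exact: cpos_sa.
have S0 : 0 <= S - T / 2.
  by apply: cpos_sc_ge0; rewrite -[sc _](subrK q); exact: cposD.
have qS := cpos_le_sc qpos Sq S0.
have S2 : S ^+ 2 = K + T / 2 * (T / 2) by rewrite sqr_sqrtr.
have n0 := unm_ge0 q; apply: unm0_eq0; move: qS S0 S2 n0; rewrite /K.
by set n := nm q => *; nra.
Qed.

Lemma re_im_dec z : exists c d, [/\ sa c, sa d, z = c + im *: d &
  st z * z + z * st z = sc 2 * (c * c + d * d)].
Proof.
have hz : sc 2^-1 * (z + st z) + sc 2^-1 * (z - st z) = z.
  by rewrite -mulrDr addrACA subrr addr0 -sc2 mulrA -scM mulVf ?pnatr_eq0// sc1 mul1r.
exists (sc 2^-1 * (z + st z)), (- im *: (sc 2^-1 * (z - st z))).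
have s1 : sa (sc 2^-1 * (z + st z)).
  by apply: saZ; rewrite /sa ustD ustK addrC.
have s2 : sa (- im *: (sc 2^-1 * (z - st z))).
  rewrite /sa ustZ ustM ustB ustK ust_sc sc_comm (_ : conjc (- im) = im).
    by rewrite -opprB mulrN scalerN scaleNr.
  by apply/eqP; rewrite eq_complex /im /= oppr0 opprK !eqxx.
split => //; first by rewrite scalerA mulrN im_im opprK scale1r.
set c := sc 2^-1 * (z + st z); set d := - im *: _.
have zE : z = c + im *: d by rewrite scalerA mulrN im_im opprK scale1r.
have stz : st z = c - im *: d by rewrite zE ust_im.
clearbody c d.
rewrite sc2 stz zE !mulrDr !mulrDl !mulNr !mulrN -!scalerAl -!scalerAr !scalerA im_im.
rewrite !scaleN1r !opprK.
set u := im *: (c * d); set v := im *: (d * c).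
rewrite (_ : c * c - v + (u + d * d) = (c * c + d * d) + (u - v)); last first.
  by rewrite [u + _]addrC addrACA [- v + _]addrC.
rewrite (_ : c * c + v + (- u + d * d) = (c * c + d * d) - (u - v)); last first.
  by rewrite opprB [- u + _]addrC addrACA.
by rewrite addrACA subrr addr0.
Qed.

(** This takes the place of comparing the non-zero spectra of [z^* z] and [z z^*]. The decomposition
    [z = c + i d] shows that [p = z z^*] is positive; with [T] its norm,
    [z^* (T - p) z = -(T q + q^2)] has norm at most [T |z|^2 = T |q|], and [cpos_quad_eq0]
    concludes. *)
Lemma cpos_star_neg z q : st z * z = - q -> cpos q -> q = 0.
Proof.
move=> zq qpos; have [c [d [csa dsa _ cd]]] := re_im_dec z.
have ppos : cpos (z * st z).
  have -> : z * st z = sc 2 * (c * c + d * d) + q.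
    by rewrite -cd zq addrC addrA subrr add0r.
  by apply: cposD => //; apply: cposZ => //; apply: cposD; exact: cpos_sq.
set p := z * st z in ppos; set T := nm p.
apply: (cpos_quad_eq0 (T := T)) => //; first exact: unm_ge0.
have E : st z * (sc T - p) * z = - (sc T * q + q * q).
  rewrite mulrBr mulrBl sc_comm -[sc T * _ * _]mulrA zq mulrN.
  by rewrite /p (mulrA (st z) z) -(mulrA (st z * z)) zq mulrNN opprD.
rewrite -unmN -E; apply: le_trans (unmM3 _ _ _) _.
rewrite unm_ust mulrAC -expr2 -unm_star zq unmN mulrC.
by apply: ler_wpM2r; [exact: unm_ge0|exact: cpos_unm].
Qed.

(** With [a = x^* x] and [b = |a|], the element [N = b - a] is twice the negative part of [a]. As
    [a N = - b N], the element [x N] satisfies the hypothesis of [cpos_star_neg], so [N b N = 0];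
    then [N^3 = 0] and [a = b]. *)
Theorem cpos_star x : cpos (st x * x).
Proof.
set a := st x * x; have asa : sa a by exact: sa_star.
have /cposP[b [bsa bb bpos bcom]] := cpos_sq asa.
have ab : a * b = b * a by apply: bcom; rewrite mulrA.
have [N NE] : exists N, N = b - a by exists (b - a).
have Nsa : sa N by rewrite NE; exact: saB.
have aN : a * N = N * a by rewrite NE mulrBr mulrBl ab.
have bN : b * N = N * b by rewrite NE mulrBr mulrBl ab.
have key : (a + b) * N = 0 by rewrite NE addrC -comm_sqrB // bb subrr.
have aNb : a * N = - (b * N) by apply/eqP; rewrite -addr_eq0 -mulrDl key.
have zq : st (x * N) * (x * N) = - (N * (b * N)).
  by rewrite ustM Nsa -mulrA (mulrA (st x)) -/a aNb mulrN.
have NbN : cpos (N * (b * N)).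
  have /cposP[y [ysa yb _ ycom]] := bpos.
  have yN : N * y = y * N by apply: ycom.
  have -> : N * (b * N) = (N * y) * (N * y).
    by rewrite -yb yN -!mulrA -yN !mulrA yN.
  by apply: cpos_sq; exact: saM.
have q0 := cpos_star_neg zq NbN.
have N3 : N * (N * N) = 0.
  have : N * (a * N) = 0 by rewrite aNb mulrN q0 oppr0.
  have EN : N * N = b * N - a * N by rewrite -mulrBl -NE.
  by rewrite EN mulrBr q0 => ->; rewrite subrr.
have /unm_le0 N0 : nm N <= 0.
  have : nm ((N * N) * (N * N)) = 0 by rewrite -mulrA N3 mulr0 unm0.
  rewrite unm_sa; last exact: saXX.
  rewrite unm_sa// -exprM => /eqP; rewrite expf_eq0 /= => /eqP ->.
  exact: lexx.
by have -> : a = b; [apply/esym/eqP; rewrite -subr_eq0 -NE N0|].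
Qed.

Lemma cpos_conj x a : cpos a -> cpos (st x * a * x).
Proof.
move=> /cposP[y [ysa <- _ _]]; rewrite -mulrA -mulrA mulrA -{1}ysa -ustM.
exact: cpos_star.
Qed.

Lemma cpos_conj' x a : cpos a -> cpos (x * a * st x).
Proof. by move=> /(cpos_conj (st x)); rewrite ustK. Qed.

Lemma cpos_star' x : cpos (x * st x).
Proof. by rewrite -{1}[x]ustK; exact: cpos_star. Qed.

Lemma unm_mono a b : cpos a -> cpos (b - a) -> nm a <= nm b.
Proof.
move=> apos ab; apply: (cpos_le_sc apos); last exact: unm_ge0.
rewrite -[sc _](subrK b) -addrA; apply: cposD => //; apply: cpos_sc_sub => //.
by rewrite -[b](subrK a); apply: saD; exact: cpos_sa.
Qed.

Lemma unm_abs a t : cpos (sc t - a) -> cpos (sc t + a) -> nm a <= t.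
Proof.
move=> h1 h2.
have t0 : 0 <= t.
  have : cpos (sc (2 * t)).
    have -> : sc (2 * t) = (sc t - a) + (sc t + a).
      by rewrite addrACA addNr addr0 -scD mulr_natl mulr2n.
    exact: cposD.
  by move=> /cpos_sc_ge0; rewrite pmulr_rge0.
have asa : sa a.
  have -> : a = (sc t + a) - sc t by rewrite addrC addKr.
  by apply: saB; [exact: cpos_sa|exact: sa_sc].
have h : cpos (sc (t * t) - a * a).
  rewrite scM comm_sqrB; last by rewrite sc_comm.
  apply: cposM_comm => //.
  by rewrite mulrBr mulrBl !mulrDl !mulrDr (sc_comm _ a).
rewrite -(@ler_pXn2r _ 2) ?nnegrE ?unm_ge0// -unm_sa// expr2.
by apply: cpos_le_sc h _; rewrite ?mulr_ge0//; exact: cpos_sq.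
Qed.

End Positivity.

(** * Functional calculus *)

Section Bernstein.
Variable R : realType.
Implicit Types (f g h : nat -> R) (p q : {poly R}) (s t e x y : R).

(* The Bernstein polynomial of [k |-> g k], as iterated averages. *)
Fixpoint bern n g : {poly R} :=
  if n is n'.+1 then (1 - 'X) * bern n' g + 'X * bern n' (fun k => g k.+1) else (g 0)%:P.

Lemma bern_le n g h s : 0 <= s <= 1 -> (forall k, (k <= n)%N -> g k <= h k) ->
  (bern n g).[s] <= (bern n h).[s].
Proof.
move=> /andP[s0 s1]; elim: n g h => [|n ih] g h gh /=; first by rewrite !hornerC gh.
rewrite !hornerE; apply: lerD; apply: ler_wpM2l; rewrite ?subr_ge0//; apply: ih => k kn.
  by apply: gh; exact: leqW.
exact: gh.
Qed.

Lemma bern_lin n g c d s :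
  (bern n (fun k => c * g k + d)).[s] = c * (bern n g).[s] + d.
Proof.
elim: n g => [|n ih] g /=; first by rewrite !hornerC.
by rewrite !hornerE !ih; ring.
Qed.

(** Variance plus squared bias of a binomial variable; the shift [d] is there for the induction,
    which replaces [k] by [k + 1]. *)
Lemma bern_sq n c d s :
  (bern n (fun k => (k%:R + d - c) ^+ 2)).[s] = n%:R * s * (1 - s) + (n%:R * s + d - c) ^+ 2.
Proof.
elim: n d => [|n ih] d /=; first by rewrite !hornerC; ring.
rewrite !hornerE ih.
have -> : bern n (fun k => (k.+1%:R + d - c) ^+ 2) = bern n (fun k => (k%:R + (d + 1) - c) ^+ 2).
  by congr bern; apply/funext => k; rewrite -natr1; congr (_ ^+ 2); ring.
by rewrite ih -natr1; ring.
Qed.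

(** The class contains the cut-offs and resolvents and is closed under products; its Lipschitz
    constants yield the quadratic bound behind the approximation. *)
Definition llip (f : R -> R) := forall T, exists L, forall x y,
  0 <= x <= T -> 0 <= y <= T -> `|f x - f y| <= L * `|x - y|.

(* Bernstein: [|f x - f y| <= e + (L^2/4e) (x - y)^2], and averaging over the
   binomial distribution turns [(x - y)^2] into a variance. *)
Lemma llip_approx (f : R -> R) : llip f -> forall T e, 0 < e -> exists p,
  forall s, 0 <= s <= T -> `|p.[s] - f s| <= e.
Proof.
move=> lf T0 e e0.
wlog T0p : T0 / 0 < T0.
  move=> H; have [|p hp] := H (Num.max T0 1).
    by rewrite lt_max ltr01 orbT.
  exists p => s /andP[s0 sT]; apply: hp; rewrite s0 /=.
  by rewrite le_max sT.
have [L0 hL0] := lf T0.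
pose L := `|L0| * T0.
have hL x y : 0 <= x <= 1 -> 0 <= y <= 1 -> `|f (x * T0) - f (y * T0)| <= L * `|x - y|.
  move=> /andP[x0 x1] /andP[y0 y1].
  have h z : 0 <= z -> z <= 1 -> 0 <= z * T0 <= T0.
    by move=> z0 z1; rewrite mulr_ge0 ?(ltW T0p)//= -[leRHS]mul1r ler_pM2r.
  apply: le_trans (hL0 _ _ (h _ x0 x1) (h _ y0 y1)) _.
  rewrite -mulrBl normrM (gtr0_norm T0p) [_ * T0]mulrC mulrA /L.
  by apply: ler_wpM2r => //; apply: ler_wpM2r; [exact: ltW|exact: ler_norm].
have L_ge0 : 0 <= L by rewrite mulr_ge0// ltW.
set e2 := e / 2; have e20 : 0 < e2 by rewrite divr_gt0.
set C := L ^+ 2 / e2.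
have C0 : 0 <= C by rewrite divr_ge0 ?sqr_ge0 ?ltW.
have key x y : 0 <= x <= 1 -> 0 <= y <= 1 ->
    `|f (x * T0) - f (y * T0)| <= e2 + C * (x - y) ^+ 2.
  move=> hx hy; apply: le_trans (hL _ _ hx hy) _.
  rewrite -[(x - y) ^+ 2]real_normK ?num_real//; set d := `|x - y|.
  have d0 : 0 <= d by exact: normr_ge0.
  rewrite /C -subr_ge0.
  have -> : e2 + L ^+ 2 / e2 * d ^+ 2 - L * d =
      ((e2 - L * d / 2) ^+ 2 + 3 / 4 * (L * d) ^+ 2) / e2.
    by field; exact: lt0r_neq0.
  by apply: divr_ge0; [apply: addr_ge0; rewrite ?sqr_ge0// mulr_ge0 ?sqr_ge0|exact: ltW].
have [n n00 NC] : exists2 n, (0 < n)%N & C <= e2 * n%:R.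
  exists (Num.truncn (C / e2)).+1 => //; rewrite mulrC -ler_pdivrMr//.
  by apply: ltW; exact: truncnS_gt.
have n0 : (0 : R) < n%:R by rewrite ltr0n.
exists ((bern n (fun k => f (k%:R / n%:R * T0))) \Po (T0^-1 *: 'X)) => s /andP[s0 sT].
rewrite horner_comp !hornerE; set x := T0^-1 * s.
have -> : s = x * T0 by rewrite /x mulrAC mulVf ?mul1r// lt0r_neq0.
have hx : 0 <= x <= 1.
  by rewrite /x mulr_ge0 ?invr_ge0 ?(ltW T0p)//= ler_pdivrMl// mulr1.
clearbody x; set F := fun k => _.
have hk k : (k <= n)%N -> 0 <= (k%:R / n%:R : R) <= 1.
  by move=> kn; rewrite divr_ge0//= ler_pdivrMr// mul1r ler_nat.
have bound (c : R) : (bern n (fun k => C / n%:R ^+ 2 * (k%:R + 0 - n%:R * x) ^+ 2 + (e2 + c))).[x]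
    <= e + c.
  rewrite bern_lin bern_sq.
  have -> : n%:R * x + 0 - n%:R * x = 0 by ring.
  rewrite expr0n /= addr0.
  have -> : C / n%:R ^+ 2 * (n%:R * x * (1 - x)) = C / n%:R * (x * (1 - x)).
    by field; exact: lt0r_neq0.
  have Cn : C / n%:R <= e2 by rewrite ler_pdivrMr.
  have Cn0 : 0 <= C / n%:R by rewrite divr_ge0// ltW.
  have : x * (1 - x) <= 1 by case/andP: hx => *; nra.
  have : 0 <= x * (1 - x) by case/andP: hx => *; nra.
  have -> : e = e2 + e2 by rewrite -splitr.
  by move: Cn Cn0; set v := C / _; set w := x * _ => *; nra.
have sq k : C / n%:R ^+ 2 * (k%:R + 0 - n%:R * x) ^+ 2 = C * (k%:R / n%:R - x) ^+ 2.
  by field; exact: lt0r_neq0.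
rewrite ler_norml; apply/andP; split.
  have := bound (- f (x * T0)).
  have : (bern n (fun k => -1 * F k + 0)).[x] <=
      (bern n (fun k => C / n%:R ^+ 2 * (k%:R + 0 - n%:R * x) ^+ 2 + (e2 + - f (x * T0)))).[x].
    apply: bern_le => // k kn; rewrite sq; have := key _ _ (hk _ kn) hx.
    by rewrite /F ler_norml => /andP[]; lra.
  by rewrite bern_lin; lra.
have := bound (f (x * T0)).
have : (bern n (fun k => 1 * F k + 0)).[x] <=
    (bern n (fun k => C / n%:R ^+ 2 * (k%:R + 0 - n%:R * x) ^+ 2 + (e2 + f (x * T0)))).[x].
  apply: bern_le => // k kn; rewrite sq; have := key _ _ (hk _ kn) hx.
  by rewrite /F ler_norml => /andP[]; lra.
by rewrite bern_lin; lra.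
Qed.

Lemma llipC c : llip (fun=> c).
Proof. by move=> T; exists 0 => x y _ _; rewrite subrr normr0 mul0r. Qed.

Lemma llip_id : llip id.
Proof. by move=> T; exists 1 => x y _ _; rewrite mul1r. Qed.

Lemma llipD (f g : R -> R) : llip f -> llip g -> llip (fun t => f t + g t).
Proof.
move=> hf hg T; have [L hL] := hf T; have [K hK] := hg T.
exists (L + K) => x y hx hy; rewrite opprD addrACA mulrDl.
by apply: le_trans (ler_normD _ _) _; apply: lerD; auto.
Qed.

Lemma llipM (f g : R -> R) : llip f -> llip g -> llip (fun t => f t * g t).
Proof.
move=> hf hg T; have [L hL] := hf T; have [K hK] := hg T.
have [T0|T0] := leP 0 T; last first.
  by exists 0 => x y /andP[x0 xT]; have := le_lt_trans (le_trans x0 xT) T0; rewrite ltxx.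
have bnd (h : R -> R) M z : (forall x y, 0 <= x <= T -> 0 <= y <= T ->
    `|h x - h y| <= M * `|x - y|) -> 0 <= z <= T -> `|h z| <= `|h 0| + `|M| * T.
  move=> hh hz; rewrite -[h z](subrK (h 0)) addrC; apply: le_trans (ler_normD _ _) _.
  rewrite lerD2l; apply: le_trans (hh _ _ hz _) _; rewrite ?lexx//.
  rewrite subr0; case/andP: hz => z0 zT; rewrite (ger0_norm z0).
  apply: (@le_trans _ _ (`|M| * z)); first by apply: ler_wpM2r => //; exact: ler_norm.
  exact: ler_wpM2l.
exists ((`|f 0| + `|L| * T) * `|K| + (`|g 0| + `|K| * T) * `|L|) => x y hx hy.
have -> : f x * g x - f y * g y = f x * (g x - g y) + g y * (f x - f y) by ring.
apply: le_trans (ler_normD _ _) _; rewrite mulrDl -!mulrA !normrM; apply: lerD.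
  apply: ler_pM => //; first exact: bnd.
  by apply: le_trans (hK _ _ hx hy) _; apply: ler_wpM2r => //; exact: ler_norm.
apply: ler_pM => //; first exact: bnd.
by apply: le_trans (hL _ _ hx hy) _; apply: ler_wpM2r => //; exact: ler_norm.
Qed.

Lemma llip_max (f : R -> R) c : llip f -> llip (fun t => Num.max (f t) c).
Proof.
move=> hf T; have [L hL] := hf T; exists L => x y hx hy.
apply: le_trans (hL _ _ hx hy).
have h1 := ler_norm (f x - f y); have h2 := ler_norm (f y - f x).
rewrite distrC in h2; move: h1 h2; set D := `|f x - f y| => h1 h2; rewrite ler_norml.
by apply/andP; split; rewrite !maxEle; case: (leP (f x) c) => ?; case: (leP (f y) c) => ?; lra.
Qed.

Lemma llipN (f : R -> R) : llip f -> llip (fun t => - f t).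
Proof.
move=> hf T; have [L hL] := hf T; exists L => x y hx hy.
by rewrite -opprD normrN; exact: hL.
Qed.

Lemma llip_min (f : R -> R) c : llip f -> llip (fun t => Num.min (f t) c).
Proof.
move=> hf; have := llipN (llip_max (- c) (llipN hf)).
by congr llip; apply/funext => t; rewrite oppr_max !opprK.
Qed.

Lemma llipV (f : R -> R) d : 0 < d -> (forall t, 0 <= t -> d <= f t) -> llip f ->
  llip (fun t => (f t)^-1).
Proof.
move=> d0 fd hf T; have [L hL] := hf T.
exists (`|L| / d ^+ 2) => x y hx hy.
have fx : d <= f x by apply: fd; case/andP: hx.
have fy : d <= f y by apply: fd; case/andP: hy.
have fx0 := lt_le_trans d0 fx; have fy0 := lt_le_trans d0 fy.
have -> : (f x)^-1 - (f y)^-1 = (f y - f x) / (f x * f y).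
  by field; rewrite !lt0r_neq0.
rewrite normrM normfV (gtr0_norm (mulr_gt0 fx0 fy0)) ler_pdivrMr ?mulr_gt0//.
rewrite distrC; apply: le_trans (hL _ _ hx hy) _.
apply: (@le_trans _ _ (`|L| * `|x - y|)); first by apply: ler_wpM2r => //; exact: ler_norm.
rewrite -!mulrA [_^-1 * _]mulrCA; apply: ler_wpM2l => //.
rewrite -[leLHS]mulr1; apply: ler_wpM2l => //.
by rewrite ler_pdivlMl ?exprn_gt0// mulr1 expr2; apply: ler_pM => //; exact: ltW.
Qed.
End Bernstein.

(** * Functional calculus on positive elements *)

Section FunctionalCalculus.
Variables (R : realType) (U : ucstarType R).
Implicit Types (x y z a b c d : U) (p q : {poly R}) (s t e : R) (f g : R -> R).
Local Notation nm := (@unm R U).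
Local Notation st := (@ust R U).
Local Notation sc := (@sc R U).

Definition ev a p : U := horner_alg a (map_poly (real_complex R) p).

Lemma evD a p q : ev a (p + q) = ev a p + ev a q.
Proof. by rewrite /ev !rmorphD. Qed.
Lemma evN a p : ev a (- p) = - ev a p.
Proof. by rewrite /ev !rmorphN. Qed.
Lemma evB a p q : ev a (p - q) = ev a p - ev a q.
Proof. by rewrite evD evN. Qed.
Lemma evM a p q : ev a (p * q) = ev a p * ev a q.
Proof. by rewrite /ev !rmorphM. Qed.
Lemma evC a t : ev a t%:P = sc t.
Proof. by rewrite /ev map_polyC horner_algC. Qed.
Lemma evX a : ev a 'X = a.
Proof. by rewrite /ev map_polyX horner_algX. Qed.
Lemma ev_comm2 a p q : ev a p * ev a q = ev a q * ev a p.
Proof. by rewrite -!evM mulrC. Qed.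

Lemma ev_comm a p x : x * a = a * x -> x * ev a p = ev a p * x.
Proof.
move=> xa; elim/poly_ind: p => [|p t ih].
  by rewrite (_ : 0 = 0%:P) // evC sc0 mulr0 mul0r.
by rewrite evD evM evC evX mulrDr mulrDl sc_comm mulrA ih -!mulrA xa.
Qed.

Lemma ev_sa a p : sa a -> sa (ev a p).
Proof.
move=> asa; elim/poly_ind: p => [|p t ih].
  by rewrite (_ : 0 = 0%:P) // evC; exact: sa_sc.
rewrite evD evM evC evX; apply: saD; last exact: sa_sc.
by apply: saM => //; rewrite ev_comm.
Qed.

(** A non-real root of the complexified [p] is also a root of the remainder modulo
    [(X - x)^2 + y^2]. That remainder has degree at most one and real coefficients, hence
    vanishes. *)
Lemma poly_cases p : (1 < size p)%N ->
  (exists (q : {poly R}) (x : R), p = q * ('X - x%:P)) \/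
  (exists (q : {poly R}) (x y : R), y != 0 /\ p = q * (('X - x%:P) ^+ 2 + (y ^+ 2)%:P)).
Proof.
move=> p1; have /closed_rootP[[x y] /rootP z0] : size (map_poly (real_complex R) p) != 1%N.
  by rewrite size_map_poly; case: (size p) p1 => [|[]].
have [y0|y0] := eqVneq y 0.
  left; move: z0; rewrite y0 -[(x +i* 0)%C]/(x%:C)%C horner_map => h.
  have /factor_theorem[q ->] : root p x by apply/rootP; case: h.
  by exists q, x.
right; set D := ('X - x%:P) ^+ 2 + (y ^+ 2)%:P.
have szD : size D = 3%N.
  by rewrite size_polyDl size_exp_XsubC// size_polyC; case: (_ != 0).
have D0 : D != 0 by rewrite -size_poly_eq0 szD.
have rE : p %% D = ((p %% D)`_1)%:P * 'X + ((p %% D)`_0)%:P.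
  apply/polyP => i; rewrite coefD coefCM coefX coefC.
  case: i => [|[|i]] /=; rewrite ?mulr0 ?mulr1 ?addr0 ?add0r//.
  by rewrite nth_default// -ltnS; apply: (@leq_trans 3%N) => //; rewrite -szD ltn_modp.
set al := (p %% D)`_1 in rE; set be := (p %% D)`_0 in rE.
have Dz : (map_poly (real_complex R) D).[(x +i* y)%C] = 0.
  rewrite rmorphD rmorphXn rmorphB /= map_polyX !map_polyC !hornerE /=.
  by apply/eqP; rewrite eq_complex /=; apply/andP; split; apply/eqP; ring.
have : (map_poly (real_complex R) (p %% D)).[(x +i* y)%C] = 0.
  move: z0; rewrite {1}(divp_eq p D) rmorphD rmorphM /= hornerD hornerM Dz mulr0 add0r.
  exact.
rewrite rE rmorphD rmorphM /= map_polyX !map_polyC !hornerE /= => /eqP.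
rewrite eq_complex /= => /andP[/eqP h1 /eqP h2].
have al0 : al = 0.
  by apply: (mulIf y0); move: h2; rewrite !(mul0r, mulr0, addr0, add0r).
have be0 : be = 0 by move: h1; rewrite al0 !mul0r subr0 add0r.
exists (p %/ D), x, y; split => //.
by rewrite {1}(divp_eq p D) rE al0 be0 mul0r addr0 addr0.
Qed.

(** A substitute for the spectral mapping theorem. A real polynomial that is positive on [[0, t]]
    has no root there, so one can split off an irreducible quadratic factor, or a factor [X - x]
    with [x < 0], or [x - X] with [x > t]. Each of these is positive at [a], the cofactor keeps its
    sign on [[0, t]], and commuting positive elements have positive product. *)
Lemma ev_pos_strict a p t : cpos a -> cpos (sc t - a) ->
  (forall s, 0 <= s <= t -> 0 < p.[s]) -> cpos (ev a p).
Proof.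
move=> apos ta; have t0 : 0 <= t.
  by apply: (@cpos_sc_ge0 _ U); rewrite -[sc t](subrK a); exact: cposD.
have [n] := ubnP (size p); elim: n p => // n ih p; rewrite ltnS => pn ppos.
have [p1|p1] := leqP (size p) 1.
  move: ppos; rewrite (size1_polyC p1) evC => /(_ 0); rewrite hornerC lexx t0.
  by move=> /(_ isT)/ltW; exact: cpos_sc.
have [[q [x pE]]|[q [x [y [y0 pE]]]]] := poly_cases p1; last first.
  have szq : (size q < size p)%N.
    have q0 : q != 0 by apply/eqP => q0; move: p1; rewrite pE q0 mul0r size_poly0.
    have szD : size (('X - x%:P) ^+ 2 + (y ^+ 2)%:P) = 3%N.
      by rewrite size_polyDl size_exp_XsubC// size_polyC; case: (_ != 0).
    rewrite pE size_mul// ?szD; first by rewrite addnS /= addn2.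
    by rewrite -size_poly_eq0 szD.
  rewrite pE evM; apply: cposM_comm; last exact: ev_comm2.
    apply: ih => [|s /ppos]; first exact: leq_trans pn.
    rewrite pE hornerM pmulr_lgt0// !hornerE; apply: ltr_wpDl; first exact: sqr_ge0.
    by rewrite lt_def sqr_ge0 sqrf_eq0 y0.
  rewrite evD expr2 evM evC; apply: cposD; last by apply: cpos_sc; exact: sqr_ge0.
  by apply: cpos_sq; apply: ev_sa; exact: cpos_sa.
have szq : (size q < size p)%N.
  have q0 : q != 0 by apply/eqP => q0; move: p1; rewrite pE q0 mul0r size_poly0.
  by rewrite pE size_Mmonic ?monicXsubC// size_XsubC addn2.
have [x0|x0] := ltP x 0.
  rewrite pE evM; apply: cposM_comm; last exact: ev_comm2.
    apply: ih => [|s /[dup]/andP[s0 _] /ppos]; first exact: leq_trans pn.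
    by rewrite pE hornerM pmulr_lgt0// !hornerE subr_gt0; exact: lt_le_trans x0 s0.
  rewrite evB evX evC -scN; apply: cposD => //; apply: cpos_sc.
  by rewrite oppr_ge0 ltW.
have [xt|xt] := ltP t x.
  rewrite pE -mulrNN evM; apply: cposM_comm; last exact: ev_comm2.
    apply: ih => [|s /[dup]/andP[_ st] /ppos]; first by rewrite size_polyN; exact: leq_trans pn.
    rewrite pE -mulrNN hornerM pmulr_lgt0// !hornerE opprB subr_gt0.
    exact: le_lt_trans st xt.
  rewrite opprB evB evX evC -[sc x](subrK (sc t)) -addrA; apply: cposD => //.
  by rewrite -scB; apply: cpos_sc; rewrite subr_ge0 ltW.
have := ppos x; rewrite x0 xt => /(_ isT).
by rewrite pE hornerM !hornerE subrr mulr0 ltxx.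
Qed.

Lemma ev_pos a p : cpos a -> (forall s, 0 <= s <= nm a -> 0 <= p.[s]) -> cpos (ev a p).
Proof.
move=> apos pp; apply: cpos_closed => e e0; exists (ev a (p + e%:P)).
  apply: (ev_pos_strict (t := nm a)) => //.
    by apply: cpos_sc_sub => //; exact: cpos_sa.
  by move=> s /pp hp; rewrite !hornerE; exact: ltr_wpDl.
by rewrite evD evC opprD addNKr unmN unm_sc gtr0_norm.
Qed.

Lemma ev_norm a p K : cpos a -> (forall s, 0 <= s <= nm a -> `|p.[s]| <= K) ->
  nm (ev a p) <= K.
Proof.
move=> apos pK; apply: unm_abs; rewrite -(evC a) -?evB -?evD; apply: ev_pos => // s /pK;
  by rewrite !hornerE ler_norml => /andP[]; lra.
Qed.

Definition is_fc a f c := forall e, 0 < e -> exists2 p,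
  (forall s, 0 <= s <= nm a -> `|p.[s] - f s| <= e) & nm (ev a p - c) <= e.

Lemma is_fc_norm a f g c d K : cpos a -> is_fc a f c -> is_fc a g d ->
  (forall s, 0 <= s <= nm a -> `|f s - g s| <= K) -> nm (c - d) <= K.
Proof.
move=> apos hc hd fg; apply/ler_addgt0Pl => e e0.
have e4 : 0 < e / 4 by rewrite divr_gt0.
have [p pf pc] := hc _ e4; have [q qg qd] := hd _ e4.
have pq : nm (ev a (p - q)) <= e / 2 + K.
  apply: ev_norm => // s hs; rewrite hornerD hornerN.
  have h1 := pf _ hs; have h2 := qg _ hs; have h3 := fg _ hs.
  by move: h1 h2 h3; rewrite !ler_norml => /andP[? ?] /andP[? ?] /andP[? ?]; apply/andP; split; lra.
apply: le_trans (unm_tri (ev a p) _ _) _; rewrite unm_distC.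
have := unm_tri (ev a q) (ev a p) d; rewrite -evB => h.
by lra.
Qed.

Lemma is_fc_uniq a f c d : cpos a -> is_fc a f c -> is_fc a f d -> c = d.
Proof.
move=> apos hc hd; apply: unm_le_eps => e e0.
by apply: is_fc_norm hc hd _ => // s _; rewrite subrr normr0 ltW.
Qed.

Lemma is_fc_exists a f : cpos a -> llip f -> exists c, is_fc a f c.
Proof.
move=> apos hf.
have H n : {p | forall s, 0 <= s <= nm a -> `|p.[s] - f s| <= n.+1%:R^-1}.
  by apply: cid; apply: llip_approx.
have small := @invS_small R.
have cauchy m n : nm (ev a (sval (H m)) - ev a (sval (H n))) <= m.+1%:R^-1 + n.+1%:R^-1.
  rewrite -evB; apply: ev_norm => // s hs; rewrite hornerD hornerN.
  have h1 := svalP (H m) s hs; have h2 := svalP (H n) s hs.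
  by apply: le_trans (ler_distD (f s) _ _) _; rewrite [`|f s - _|]distrC; exact: lerD.
have [e e0|l hl] := @unm_complete _ U (fun n => ev a (sval (H n))).
  have [N hN] := small _ (divr_gt0 e0 (ltr0n R 2)).
  exists N => m n /hN hm /hN hn; apply: le_trans (cauchy _ _) _.
  by rewrite [leRHS]splitr; exact: lerD.
exists l => e e0; have [N hN] := hl _ e0; have [M hM] := small _ e0.
exists (sval (H (maxn M N))); last by apply: hN; exact: leq_maxr.
by move=> s hs; apply: le_trans (svalP (H _) s hs) (hM _ (leq_maxl _ _)).
Qed.

Definition fc f a : U := xget 0 [set c | is_fc a f c]%classic.

Lemma fcP a f : cpos a -> llip f -> is_fc a f (fc f a).
Proof. by move=> apos hf; apply: (@xgetPex _ _ [set c | is_fc a f c]%classic); exact: is_fc_exists. Qed.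

Lemma is_fc_ev a p : is_fc a (horner p) (ev a p).
Proof. by move=> e e0; exists p => [s _|]; rewrite subrr ?normr0 ?unm0 ltW. Qed.

Lemma fc_is a f c : cpos a -> is_fc a f c -> fc f a = c.
Proof.
by move=> apos h; apply: (is_fc_uniq apos _ h); apply: (@xgetPex _ _ [set c | is_fc a f c]%classic); exists c.
Qed.

Lemma eq_is_fc a f g c : (forall s, 0 <= s <= nm a -> f s = g s) -> is_fc a f c -> is_fc a g c.
Proof.
by move=> fg h e /h[p hp pc]; exists p => // s hs; rewrite -fg//; exact: hp.
Qed.

Lemma is_fcD a f g c d : is_fc a f c -> is_fc a g d ->
  is_fc a (fun s => f s + g s) (c + d).
Proof.
move=> hc hd e e0; have e2 : 0 < e / 2 by rewrite divr_gt0.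
have [p pf pc] := hc _ e2; have [q qg qd] := hd _ e2.
exists (p + q).
  move=> s hs; rewrite hornerD opprD addrACA [leRHS]splitr.
  by apply: le_trans (ler_normD _ _) _; apply: lerD; auto.
rewrite evD opprD addrACA [leRHS]splitr.
by apply: le_trans (unmD _ _) _; exact: lerD.
Qed.

Lemma is_fc_bound a f c : is_fc a f c ->
  exists2 K, 0 < K & forall s, 0 <= s <= nm a -> `|f s| <= K.
Proof.
move=> h; have [p pf _] := h _ ltr01.
have [K K0 hK] : exists2 K, 0 <= K & forall s, 0 <= s <= nm a -> `|p.[s]| <= K.
  elim/poly_ind: (p) => [|q t [K K0 hK]].
    by exists 0 => // s _; rewrite horner0 normr0.
  exists (K * nm a + `|t|) => [|s /[dup] hs /andP[s0 sa]].
    by rewrite addr_ge0// mulr_ge0// unm_ge0.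
  rewrite !hornerE; apply: le_trans (ler_normD _ _) _; rewrite lerD2r normrM.
  by apply: ler_pM => //; [exact: hK|rewrite ger0_norm].
exists (K + 1); first by rewrite ltr_wpDl.
move=> s hs; have := pf _ hs; have := hK _ hs.
by rewrite !ler_norml => /andP[? ?] /andP[? ?]; apply/andP; split; lra.
Qed.

Lemma is_fcM a f g c d : is_fc a f c -> is_fc a g d ->
  is_fc a (fun s => f s * g s) (c * d).
Proof.
move=> hc hd e e0.
have [K K0 fK] := is_fc_bound hc; have [L L0 gL] := is_fc_bound hd.
set B := K + L + nm c + nm d + 1.
have B0 : 0 < B by rewrite ltr_wpDl// !addr_ge0 ?unm_ge0// ltW.
set t := Num.min 1 (e / (2 * B + 1)).
have t1 : t <= 1 by rewrite ge_min lexx.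
have t0 : 0 < t by rewrite lt_min ltr01 divr_gt0// ltr_wpDl// mulr_ge0// ltW.
have tB : t * (2 * B + 1) <= e.
  rewrite -ler_pdivlMr ?ge_min ?lexx ?orbT//.
  by rewrite ltr_wpDl// mulr_ge0// ltW.
have [p pf pc] := hc _ t0; have [q qg qd] := hd _ t0.
have c0 := unm_ge0 c; have d0 := unm_ge0 d.
exists (p * q).
  move=> s hs; rewrite hornerM.
  have -> : p.[s] * q.[s] - f s * g s =
    (p.[s] - f s) * (q.[s] - g s) + (p.[s] - f s) * g s + f s * (q.[s] - g s) by ring.
  apply: le_trans (ler_normD _ _) _; apply: le_trans (lerD (ler_normD _ _) (lexx _)) _.
  rewrite !normrM; have h1 := pf _ hs; have h2 := qg _ hs.
  have h3 := fK _ hs; have h4 := gL _ hs.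
  apply: le_trans tB; rewrite /B; move: h1 h2 h3 h4.
  have := normr_ge0 (p.[s] - f s); have := normr_ge0 (q.[s] - g s).
  have := normr_ge0 (f s); have := normr_ge0 (g s).
  by set u1 := `|p.[s] - _|; set u2 := `|q.[s] - _|; set u3 := `|f s|; set u4 := `|g s| => *; nra.
rewrite evM.
have -> : ev a p * ev a q - c * d =
    (ev a p - c) * (ev a q - d) + (ev a p - c) * d + c * (ev a q - d).
  by rewrite -mulrDr subrK mulrBl mulrBr addrA subrK.
apply: le_trans (unmD _ _) _; apply: le_trans (lerD (unmD _ _) (lexx _)) _.
have := unmM (ev a p - c) (ev a q - d); have := unmM (ev a p - c) d.
have := unmM c (ev a q - d); have := unm_ge0 (ev a p - c); have := unm_ge0 (ev a q - d).
move: pc qd tB; rewrite /B.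
set u1 := nm (ev a p - c); set u2 := nm (ev a q - d) => *.
have : u1 * u2 <= t * 1 by apply: ler_pM => //; lra.
have : u1 * nm d <= t * nm d by exact: ler_wpM2r.
have : nm c * u2 <= nm c * t by exact: ler_wpM2l.
have : 0 <= t * K by rewrite mulr_ge0// ltW.
have : 0 <= t * L by rewrite mulr_ge0// ltW.
have : 0 <= t * nm c by rewrite mulr_ge0// ltW.
have : 0 <= t * nm d by rewrite mulr_ge0// ltW.
by lra.
Qed.

Lemma is_fc_pos a f c : cpos a -> is_fc a f c -> (forall s, 0 <= s <= nm a -> 0 <= f s) ->
  cpos c.
Proof.
move=> apos hc f0; apply: cpos_closed => e e0.
have e2 : 0 < e / 2 by rewrite divr_gt0.
have [p pf pc] := hc _ e2; exists (ev a (p + (e / 2)%:P)).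
  apply: ev_pos => // s hs; rewrite !hornerE; have := pf _ hs; have := f0 _ hs.
  by rewrite ler_norml => ? /andP[? ?]; lra.
rewrite evD evC opprD addrA; apply: le_trans (unmB _ _) _.
by rewrite [leRHS]splitr unm_distC unm_sc gtr0_norm// lerD.
Qed.

Lemma is_fc_comm a f c x : cpos a -> is_fc a f c -> x * a = a * x -> x * c = c * x.
Proof.
move=> apos hc xa; apply: unm_le_eps => e e0.
have x1 : 0 < 2 * (nm x + 1) by rewrite mulr_gt0// ltr_wpDl ?unm_ge0.
have [|p _ pc] := hc (e / (2 * (nm x + 1))); first exact: divr_gt0.
have -> : x * c - c * x = (ev a p - c) * x - x * (ev a p - c).
  by rewrite mulrBl mulrBr ev_comm// opprB [RHS]addrC addrA subrK.
apply: le_trans (unmB _ _) _.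
have h1 := unmM (ev a p - c) x; have h2 := unmM x (ev a p - c).
rewrite ler_pdivlMr// in pc; apply: le_trans pc.
have := unm_ge0 (ev a p - c); have := unm_ge0 x; move: h1 h2.
set u := nm (ev a p - c); set v := nm x => *; nra.
Qed.

Section Fc.
Variable a : U.
Hypothesis apos : cpos a.
Hint Resolve apos : core.

Lemma fcD f g : llip f -> llip g -> fc (fun s => f s + g s) a = fc f a + fc g a.
Proof. by move=> hf hg; apply: fc_is => //; apply: is_fcD; exact: fcP. Qed.

Lemma fcM f g : llip f -> llip g -> fc (fun s => f s * g s) a = fc f a * fc g a.
Proof. by move=> hf hg; apply: fc_is => //; apply: is_fcM; exact: fcP. Qed.

Lemma fcC t : fc (fun=> t) a = sc t.
Proof.
apply: fc_is => //; rewrite -(evC a); apply: eq_is_fc (is_fc_ev a t%:P) => s _.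
by rewrite hornerC.
Qed.

Lemma fc_id : fc id a = a.
Proof.
apply: fc_is => //; rewrite -{2}(evX a); apply: eq_is_fc (is_fc_ev a 'X) => s _.
by rewrite hornerX.
Qed.

Lemma fcB f g : llip f -> llip g -> fc (fun s => f s - g s) a = fc f a - fc g a.
Proof.
move=> hf hg; apply/eqP; rewrite eq_sym subr_eq -fcD//; last first.
  by apply: llipD => //; exact: llipN.
by apply/eqP; congr (fc _ a); apply/funext => s; rewrite subrK.
Qed.

Lemma eq_fc f g : llip f -> llip g -> (forall s, 0 <= s <= nm a -> f s = g s) ->
  fc f a = fc g a.
Proof. by move=> hf hg fg; apply: fc_is => //; apply: (eq_is_fc _ (fcP apos hg)) => s /fg. Qed.

Lemma fc_pos f : llip f -> (forall s, 0 <= s <= nm a -> 0 <= f s) -> cpos (fc f a).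
Proof. by move=> hf; exact: is_fc_pos (fcP apos hf). Qed.

Lemma fc_sa f : llip f -> sa (fc f a).
Proof.
move=> hf; apply: unm_le_eps => e e0.
have [|p _ pc] := fcP apos hf (e := e / 2); first by rewrite divr_gt0.
apply: le_trans (unm_tri (ev a p) _ _) _; rewrite [leRHS]splitr; apply: lerD => //.
by rewrite -(ev_sa p (cpos_sa apos)) -ustB unm_ust unm_distC.
Qed.

Lemma fc_norm f K : llip f -> (forall s, 0 <= s <= nm a -> `|f s| <= K) -> nm (fc f a) <= K.
Proof.
move=> hf fK; rewrite -[fc f a]subr0 -[X in _ - X]sc0 -(fcC 0).
by apply: is_fc_norm (fcP apos hf) (fcP apos (llipC 0)) _ => // s hs; rewrite subr0; exact: fK.
Qed.

Lemma fc_mono f g : llip f -> llip g -> (forall s, 0 <= s <= nm a -> f s <= g s) ->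
  cpos (fc g a - fc f a).
Proof.
move=> hf hg fg; rewrite -fcB//; apply: fc_pos => [|s /fg]; last by rewrite subr_ge0.
by apply: llipD => //; exact: llipN.
Qed.

Lemma fc_dist f g K : llip f -> llip g -> (forall s, 0 <= s <= nm a -> `|f s - g s| <= K) ->
  nm (fc f a - fc g a) <= K.
Proof. by move=> hf hg; apply: is_fc_norm; [|exact: fcP|exact: fcP]. Qed.

Lemma fc_comm f x : llip f -> x * a = a * x -> x * fc f a = fc f a * x.
Proof. by move=> hf; apply: is_fc_comm (fcP apos hf). Qed.

End Fc.
End FunctionalCalculus.

(** * Cuntz comparison *)

Section CuntzComparison.
Variables (R : realType) (U : ucstarType R).
Implicit Types (x y z a b c r v w : U) (s t e d : R) (f g : R -> R).
Local Notation nm := (@unm R U).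
Local Notation st := (@ust R U).
Local Notation sc := (@sc R U).

Definition cle a b := forall e, 0 < e -> exists v, nm (v * b * st v - a) <= e.
(** Membership of [r] in the closed right ideal generated by [y]. *)
Definition rcl y r := forall e, 0 < e -> exists v, nm (y * v - r) <= e.
Definition cutf e : R -> R := fun t => Num.max (t - e) 0.
Definition cut e a := fc (cutf e) a.
(* [t / (t + e)], an approximate unit for [e -> 0] *)
Definition resf e : R -> R := fun t => (t + e)^-1.
Definition auf e : R -> R := fun t => t * resf e t.

Lemma cut_llip e : llip (cutf e).
Proof. by apply: llip_max; apply: llipD; [exact: llip_id|exact: llipC]. Qed.
Lemma resf_llip e : 0 < e -> llip (resf e).
Proof.
move=> e0; apply: (llipV e0); first by move=> t t0; rewrite lerDr.
by apply: llipD; [exact: llip_id|exact: llipC].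
Qed.
Lemma auf_llip e : 0 < e -> llip (auf e).
Proof. by move=> e0; apply: llipM; [exact: llip_id|exact: resf_llip]. Qed.
Hint Resolve cut_llip resf_llip auf_llip llip_id llipC : core.

Lemma auf_bnd e t : 0 < e -> 0 <= t -> 0 <= auf e t <= 1.
Proof.
move=> e0 t0; have te : 0 < t + e by rewrite ltr_wpDl.
by rewrite /auf /resf divr_ge0 ?(ltW te)//= ler_pdivrMr// mul1r lerDl ltW.
Qed.

Lemma auf_sub e t : 0 < e -> 0 <= t -> 0 <= t - t * auf e t <= e.
Proof.
move=> e0 t0; have te : 0 < t + e by rewrite ltr_wpDl.
have -> : t - t * auf e t = e * auf e t by rewrite /auf /resf; field; exact: lt0r_neq0.
have /andP[h1 h2] := auf_bnd e0 t0.
by rewrite mulr_ge0 ?(ltW e0)//= -[leRHS]mulr1; apply: ler_wpM2l => //; exact: ltW.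
Qed.

Lemma auf_sub2 e t : 0 < e -> 0 <= t -> `|auf e t * t * auf e t - t| <= 2 * e.
Proof.
move=> e0 t0; have /andP[h1 h2] := auf_bnd e0 t0; have /andP[h3 h4] := auf_sub e0 t0.
by move: (auf e t) h1 h2 h3 h4 => u *; rewrite ler_norml; apply/andP; split; nra.
Qed.

Lemma cut_pos e a : cpos a -> cpos (cut e a).
Proof. by move=> apos; apply: fc_pos => // t _; rewrite /cutf le_max lexx orbT. Qed.

Lemma cut_dist e a : 0 <= e -> cpos a -> nm (cut e a - a) <= e.
Proof.
move=> e0 apos; rewrite -{2}(fc_id apos); apply: fc_dist => // t /andP[t0 _].
rewrite /cutf maxEle /id; case: (leP (t - e) 0) => h; rewrite ler_norml; apply/andP; split; lra.
Qed.

Lemma cut_le e d a : cpos a -> d <= e -> cpos (cut d a - cut e a).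
Proof.
move=> apos de; apply: fc_mono => // t _; rewrite /cutf.
by rewrite ge_max !le_max lexx orbT andbT; apply/orP; left; lra.
Qed.

Lemma cut_le_id e a : cpos a -> 0 <= e -> cpos (a - cut e a).
Proof.
move=> apos de; rewrite -{1}(fc_id apos); apply: fc_mono => // t /andP[t0 _].
by rewrite /cutf ge_max t0 andbT; lra.
Qed.

Lemma ev_fc a f (p : {poly R}) : cpos a -> llip f ->
  llip (fun t => p.[f t]) /\ ev (fc f a) p = fc (fun t => p.[f t]) a.
Proof.
move=> apos hf; elim/poly_ind: p => [|p k [ih1 ih2]].
  have -> : (fun t => (0 : {poly R}).[f t]) = fun=> 0 by apply/funext => t; rewrite horner0.
  by split => //; rewrite fcC// -(evC (fc f a)).
have E : (fun t => (p * 'X + k%:P).[f t]) = fun t => p.[f t] * f t + k.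
  by apply/funext => t; rewrite !hornerE.
split; rewrite E; first by apply: llipD => //; exact: llipM.
rewrite fcD//; last exact: llipM.
by rewrite fcM// fcC// evD evM evX evC ih2.
Qed.

Lemma fc_comp a f g : cpos a -> llip f -> (forall t, 0 <= t -> 0 <= f t) ->
  llip g -> llip (g \o f) -> fc g (fc f a) = fc (g \o f) a.
Proof.
move=> apos hf f0 hg hgf; have fpos : cpos (fc f a).
  by apply: fc_pos => // t /andP[t0 _]; exact: f0.
apply: fc_is => // e e0.
have [K K0 fK] := is_fc_bound (fcP apos hf).
have [p hp] := llip_approx hg (Num.max K (nm (fc f a))) e0.
exists p => [t /andP[t0 tn]|]; first by apply: hp; rewrite t0 le_max tn orbT.
have [h1 ->] := ev_fc p apos hf; apply: fc_dist => // t ht.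
apply: hp; rewrite f0; last by case/andP: ht.
by rewrite le_max (le_trans (ler_norm _) (fK _ ht)).
Qed.

Lemma cut_cut e d a : cpos a -> 0 <= e -> 0 <= d -> cut d (cut e a) = cut (e + d) a.
Proof.
move=> apos e0 d0; have E : cutf d \o cutf e = cutf (e + d).
  apply/funext => t /=; rewrite /cutf !maxEle.
  by case: (leP (t - e) 0) => h1; case: leP => h2; case: leP => h3 //; lra.
by rewrite /cut fc_comp ?E// => t _; rewrite /cutf le_max lexx orbT.
Qed.

Lemma nm_half e : 0 < e -> 0 < e / 2.
Proof. by move=> e0; rewrite divr_gt0. Qed.

Lemma cle_closed a b : (forall e, 0 < e -> exists2 c, cle c b & nm (c - a) <= e) -> cle a b.
Proof.
move=> h e e0; have [c cb ca] := h _ (nm_half e0).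
have [v hv] := cb _ (nm_half e0); exists v.
by apply: le_trans (unm_tri c _ _) _; rewrite [leRHS]splitr; exact: lerD.
Qed.

Lemma cle_trans b a c : cle a b -> cle b c -> cle a c.
Proof.
move=> ab bc; apply: cle_closed => e e0; have [v hv] := ab _ e0.
exists (v * b * st v) => // d d0.
have v0 := unm_ge0 v.
have V0 : 0 < nm v * nm v + 1 by rewrite ltr_wpDl// mulr_ge0.
have [w hw] := bc _ (divr_gt0 d0 V0); exists (v * w).
have -> : v * w * c * st (v * w) - v * b * st v = v * (w * c * st w - b) * st v.
  by rewrite ustM mulrBr mulrBl !mulrA.
apply: le_trans (unmM3 _ _ _) _; rewrite unm_ust mulrAC.
rewrite ler_pdivlMr// mulrC in hw; apply: le_trans hw.
by apply: ler_wpM2r; rewrite ?unm_ge0// lerDl.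
Qed.

Lemma cle_conj v b : cle (v * b * st v) b.
Proof. by move=> e e0; exists v; rewrite subrr unm0 ltW. Qed.

Lemma cle_conj' v b : cle (st v * b * v) b.
Proof. by rewrite -{2}[v]ustK; exact: cle_conj. Qed.

Lemma rcl_trans x y z : rcl x y -> rcl y z -> rcl x z.
Proof.
move=> xy yz e e0; have [v hv] := yz _ (nm_half e0).
have v0 := unm_ge0 v; have V0 : 0 < nm v + 1 by rewrite ltr_wpDl.
have [w hw] := xy _ (divr_gt0 (nm_half e0) V0); exists (w * v).
apply: le_trans (unm_tri (y * v) _ _) _; rewrite [leRHS]splitr; apply: lerD => //.
rewrite mulrA -mulrBl; apply: le_trans (unmM _ _) _.
rewrite ler_pdivlMr// in hw; apply: le_trans hw.
by apply: ler_wpM2l; rewrite ?unm_ge0// lerDl.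
Qed.

Lemma rclM x v : rcl x (x * v).
Proof. by move=> e e0; exists v; rewrite subrr unm0 ltW. Qed.

Lemma rcl_refl x : rcl x x.
Proof. by rewrite -{2}[x]mulr1; exact: rclM. Qed.

Lemma rclMr x y v : rcl x y -> rcl x (y * v).
Proof. by move=> h; apply: rcl_trans h (rclM _ _). Qed.

Lemma rclMl x y v : rcl x y -> rcl (v * x) (v * y).
Proof.
move=> h e e0; have v0 := unm_ge0 v; have V0 : 0 < nm v + 1 by rewrite ltr_wpDl.
have [w hw] := h _ (divr_gt0 e0 V0); exists w.
rewrite -mulrA -mulrBr; apply: le_trans (unmM _ _) _.
rewrite ler_pdivlMr// mulrC in hw; apply: le_trans hw.
by apply: ler_wpM2r; rewrite ?unm_ge0// lerDl.
Qed.

Lemma rclD x y z : rcl x y -> rcl x z -> rcl x (y + z).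
Proof.
move=> h1 h2 e e0; have [v hv] := h1 _ (nm_half e0); have [w hw] := h2 _ (nm_half e0).
exists (v + w); rewrite mulrDr opprD addrACA [leRHS]splitr.
by apply: le_trans (unmD _ _) _; exact: lerD.
Qed.

Lemma rclN x y : rcl x y -> rcl x (- y).
Proof. by move=> /(rclMr (-1)); rewrite mulrN1. Qed.

Lemma rcl_closed x y : (forall e, 0 < e -> exists2 z, rcl x z & nm (z - y) <= e) -> rcl x y.
Proof.
move=> h e e0; have [z xz zy] := h _ (nm_half e0); have [v hv] := xz _ (nm_half e0).
by exists v; apply: le_trans (unm_tri z _ _) _; rewrite [leRHS]splitr; exact: lerD.
Qed.

Lemma rcl_star_star y r : rcl y r -> cle (st r * r) (st y * y).
Proof.
move=> yr e e0; have r0 := unm_ge0 r.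
set C := 2 * nm r + 1; have C0 : 0 < C by rewrite ltr_wpDl// mulr_ge0.
pose t := Num.min 1 (e / C).
have t0 : 0 < t by rewrite lt_min ltr01 divr_gt0.
have t1 : t <= 1 by rewrite ge_min lexx.
have tC : t * C <= e by rewrite -ler_pdivlMr// ge_min lexx orbT.
have [v hv] := yr _ t0; exists (st v).
have -> : st v * (st y * y) * st (st v) - st r * r =
    st (y * v - r) * (y * v - r) + st (y * v - r) * r + st r * (y * v - r).
  rewrite ustK -mulrDr subrK ustB mulrBl mulrBr addrA subrK ustM -!mulrA; congr (_ - _).
apply: le_trans (unmD _ _) _; apply: le_trans (lerD (unmD _ _) (lexx _)) _.
have h1 := unmM (st (y * v - r)) (y * v - r); have h2 := unmM (st (y * v - r)) r.
have h3 := unmM (st r) (y * v - r); rewrite !unm_ust in h1 h2 h3.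
move: h1 h2 h3 hv; have := unm_ge0 (y * v - r); rewrite /C in tC.
set u := nm (y * v - r) => u0 h1 h2 h3 ut.
have : u * u <= t * 1 by apply: ler_pM => //; lra.
have : u * nm r <= t * nm r by exact: ler_wpM2r.
by lra.
Qed.

(** [f(a)] is the limit of [a (a + d)^-1 f(a)]: the error [d (a + d)^-1 f(a)] is at most [d L] since
    [f] is at most [L t]. *)
Lemma fc_rcl a f L : cpos a -> llip f -> 0 <= L ->
  (forall t, 0 <= t <= nm a -> `|f t| <= L * t) -> rcl a (fc f a).
Proof.
move=> apos hf L0 fL e e0.
pose d := e / (L + 1); have d0 : 0 < d by rewrite divr_gt0// ltr_wpDl.
exists (fc (fun t => resf d t * f t) a).
have hg : llip (fun t => resf d t * f t) by apply: llipM; auto.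
rewrite -{1}(fc_id apos) -fcM//; apply: fc_dist => //; first by apply: llipM; auto.
move=> t ht; have /andP[t0 _] := ht; have td : 0 < t + d by rewrite ltr_wpDl.
have -> : id t * (resf d t * f t) - f t = - (d * resf d t * f t).
  by rewrite /resf /id; field; exact: lt0r_neq0.
rewrite normrN normrM ger0_norm; last by rewrite mulr_ge0 ?invr_ge0 ?ltW.
apply: (@le_trans _ _ (d * resf d t * (L * t))).
  by apply: ler_wpM2l; [rewrite mulr_ge0 ?invr_ge0 ?ltW|exact: fL].
have /andP[h1 h2] := auf_bnd d0 t0.
rewrite (_ : _ * _ = d * L * auf d t); last by rewrite /auf; ring.
apply: (@le_trans _ _ (d * L)).
  by rewrite -[leRHS]mulr1; apply: ler_wpM2l => //; rewrite mulr_ge0// ltW.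
by rewrite /d mulrAC ler_pdivrMr ?ltr_wpDl//; apply: ler_wpM2l; rewrite ?lerDl ?ltW.
Qed.

Lemma cut_rcl e a : cpos a -> 0 <= e -> rcl a (cut e a).
Proof.
move=> apos e0; apply: (fc_rcl (L := 1)) => // t /andP[t0 _]; rewrite mul1r.
by rewrite /cutf maxEle; case: (leP (t - e) 0) => h; rewrite ?normr0// ler_norml; apply/andP; split; lra.
Qed.

Lemma auf_rcl e a : cpos a -> 0 < e -> rcl a (fc (auf e) a).
Proof. by move=> apos e0; rewrite /auf fcM// ?fc_id//; auto; exact: rclM. Qed.

Lemma sqrt_rcl a y : cpos y -> y * y = a -> rcl a y.
Proof.
move=> ypos <- e e0; exists (fc (resf e) y); rewrite -mulrA.
have E : y * fc (resf e) y = fc (auf e) y by rewrite fcM// ?fc_id//; auto.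
rewrite E -{1 3}(fc_id ypos) -fcM//; auto.
rewrite unm_distC; apply: fc_dist; auto; first by apply: llipM; auto.
by move=> t /andP[t0 _]; have /andP[h1 h2] := auf_sub e0 t0; rewrite ger0_norm.
Qed.

Lemma unm_star_sub x y : nm (st x * x - st y * y) <= nm (x - y) * (nm x + nm y).
Proof.
have -> : st x * x - st y * y = st x * (x - y) + st (x - y) * y.
  by rewrite ustB mulrBr mulrBl addrA subrK.
apply: le_trans (unmD _ _) _; rewrite [leRHS]mulrDr; apply: lerD.
  by apply: le_trans (unmM _ _) _; rewrite unm_ust mulrC.
by apply: le_trans (unmM _ _) _; rewrite unm_ust.
Qed.

Lemma star_closed r c : (forall e, 0 < e -> exists2 x, nm (x - r) <= e &
  nm (st x * x - c) <= e) -> st r * r = c.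
Proof.
move=> h; apply: unm_le_eps => e e0; have r0 := unm_ge0 r.
set C := 2 * nm r + 2; have C0 : 0 < C by rewrite ltr_wpDl// mulr_ge0.
pose t := Num.min 1 (e / C).
have t0 : 0 < t by rewrite lt_min ltr01 divr_gt0.
have t1 : t <= 1 by rewrite ge_min lexx.
have tC : t * C <= e by rewrite -ler_pdivlMr// ge_min lexx orbT.
have [x xr xc] := h _ t0.
apply: le_trans (unm_tri (st x * x) _ _) _.
have h1 := unm_star_sub r x; rewrite unm_distC in h1.
have h2 : nm x <= nm r + t.
  by rewrite -[x](subrK r) addrC; apply: le_trans (unmD _ _) _; rewrite lerD2l.
have : nm (x - r) * (nm r + nm x) <= t * (2 * nm r + 1).
  by apply: ler_pM; rewrite ?unm_ge0// ?addr_ge0 ?unm_ge0//; lra.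
by move: tC; rewrite /C; lra.
Qed.

(* Polar decomposition: [r = lim y (|y| + e)^-1 c^(1/2)]. *)
Lemma polar y c : cpos c -> cpos (st y * y - c) -> exists2 r, rcl y r & st r * r = c.
Proof.
move=> cpos_c hc; have [z [zsa zz zpos zcom]] := cposP (cpos_star y).
have [k [ksa kk kpos kcom]] := cposP cpos_c.
pose h e := fc (resf e) z; pose rr e := y * h e * k.
have hsa e : 0 < e -> sa (h e) by move=> e0; apply: fc_sa; auto.
have ny x : nm (y * x) = nm (z * x).
  apply/eqP; rewrite -(@eqrXn2 _ 2) ?unm_ge0// -!unm_star !ustM zsa !mulrA.
  by rewrite -(mulrA _ (st y)) -(mulrA _ z z) zz.
(* The hypothesis [c <= y^* y = z^2] enters here. It turns estimates on [y h k] into estimates on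
   functions of [z] alone. *)
have est w : sa w -> nm (w * k) <= nm (z * w).
  move=> wsa; rewrite -(@ler_pXn2r _ 2) ?nnegrE ?unm_ge0//.
  rewrite -[nm (w * k)]unm_ust -!unm_star ustK !ustM wsa ksa zsa !mulrA.
  rewrite -(mulrA w k) kk -(mulrA w z) zz -[w in w * c]wsa -{3}wsa.
  apply: unm_mono; first exact: cpos_conj.
  by rewrite -mulrBl -mulrBr; exact: cpos_conj.
have zh e : 0 < e -> z * h e = fc (auf e) z.
  by move=> e0; rewrite /auf fcM// ?fc_id//; auto.
have rr_dist e d : 0 < e -> 0 < d -> nm (rr e - rr d) <= `|e - d|.
  move=> e0 d0; rewrite /rr -mulrBl -mulrBr -mulrA ny mulrA.
  have ha : llip (fun t => auf e t - auf d t) by apply: llipD; [auto|apply: llipN; auto].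
  rewrite mulrBr !zh// -fcB//; auto.
  apply: le_trans (est _ _) _; first exact: fc_sa.
  rewrite -{1}(fc_id zpos) -fcM//; auto.
  apply: fc_norm => //; first exact: llipM.
  move=> t /andP[t0 _]; have te : 0 < t + e by rewrite ltr_wpDl.
  have td : 0 < t + d by rewrite ltr_wpDl.
  have -> : id t * (auf e t - auf d t) = (d - e) * (auf e t * auf d t).
    by rewrite /auf /resf /id; field; rewrite !lt0r_neq0.
  rewrite normrM distrC; have /andP[h1 h2] := auf_bnd e0 t0.
  have /andP[h3 h4] := auf_bnd d0 t0.
  rewrite (ger0_norm (mulr_ge0 h1 h3)) -[leRHS]mulr1; apply: ler_wpM2l => //.
  by rewrite -[1]mulr1; apply: ler_pM.
have rr_star e : 0 < e -> nm (st (rr e) * rr e - c) <= e * (2 * nm k).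
  move=> e0; set f := fc (auf e) z.
  have fsa : sa f by apply: fc_sa; auto.
  have E : st (rr e) * rr e = st (f * k) * (f * k).
    rewrite /rr /f -zh// !ustM ksa (hsa _ e0) zsa !mulrA.
    by rewrite -(mulrA _ (st y)) -(mulrA _ z z) zz.
  have f1 : nm (f * k) <= nm k.
    apply: le_trans (unmM _ _) _; rewrite -[leRHS]mul1r; apply: ler_wpM2r; first exact: unm_ge0.
    apply: fc_norm; auto => t /andP[t0 _]; have /andP[h1 h2] := auf_bnd e0 t0.
    by rewrite ger0_norm.
  have ck : c = st k * k by rewrite ksa kk.
  rewrite E {1}ck; apply: le_trans (unm_star_sub _ _) _.
  apply: ler_pM; rewrite ?unm_ge0 ?addr_ge0 ?unm_ge0//; last by rewrite mulr_natl mulr2n lerD2r.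
  rewrite -{2}[k]mul1r -mulrBl; apply: le_trans (est _ _) _.
    by apply: saB => //; exact: sa1.
  rewrite mulrBr mulr1 -{1 2}(fc_id zpos) -fcM//; auto.
  apply: fc_dist; auto; first by apply: llipM; auto.
  move=> t /andP[t0 _]; have /andP[h1 h2] := auf_sub e0 t0.
  by rewrite distrC ger0_norm.
pose ee n : R := n.+1%:R^-1.
have ee0 n : 0 < ee n by rewrite invr_gt0.
have ees e : 0 < e -> exists N, forall n, (N <= n)%N -> ee n <= e by exact: invS_small.
have [e e0|r hr] := @unm_complete _ U (fun n => rr (ee n)).
  have [N hN] := ees _ e0; exists N => m n /hN hm /hN hn.
  apply: le_trans (rr_dist _ _ (ee0 _) (ee0 _)) _.
  by have := ee0 m; have := ee0 n; rewrite ler_norml => *; apply/andP; split; lra.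
exists r.
  apply: rcl_closed => e /hr[N hN]; exists (rr (ee N)); last exact: hN.
  by rewrite /rr -mulrA; exact: rclM.
apply: star_closed => e e0; have [N hN] := hr _ e0.
have [M hM] := ees (e / (2 * nm k + 1)) (divr_gt0 e0 (ltr_wpDl (mulr_ge0 (ler0n _ 2) (unm_ge0 k)) ltr01)).
exists (rr (ee (maxn M N))); first by apply: hN; exact: leq_maxr.
apply: le_trans (rr_star _ (ee0 _)) _.
have := hM _ (leq_maxl M N).
rewrite ler_pdivlMr; last by rewrite ltr_wpDl// mulr_ge0 ?unm_ge0.
by have := ee0 (maxn M N); set u := ee _; have := unm_ge0 k; set v := nm k => *; nra.
Qed.

Lemma cle_mono a b : cpos a -> cpos b -> cpos (b - a) -> cle a b.
Proof.
move=> apos bpos ab; have [y [ysa yy ypos _]] := cposP bpos.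
have [|r yr <-] := @polar y a apos; first by rewrite ysa yy.
by rewrite -yy -{1}ysa; exact: rcl_star_star.
Qed.

Lemma rcl_starE x : rcl (x * st x) x.
Proof.
apply: rcl_closed => e e0; have Tpos := cpos_star' x; set T := x * st x in Tpos *.
have e2 : 0 < e ^+ 2 by rewrite exprn_gt0.
set f := fc (auf (e ^+ 2)) T.
have fsa : sa f by apply: fc_sa; auto.
exists (f * x); first by apply: rclMr; exact: auf_rcl.
rewrite -{2}[x]mul1r -mulrBl; have f1 : sa (f - 1) by apply: saB => //; exact: sa1.
rewrite -(@ler_pXn2r _ 2) ?nnegrE ?unm_ge0 ?(ltW e0)//.
rewrite -unm_ust -unm_star ustK ustM f1 -mulrA (mulrA x) -/T mulrA.
have -> : (f - 1) * T * (f - 1) = fc (fun t => (auf (e ^+ 2) t - 1) * t * (auf (e ^+ 2) t - 1)) T.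
  have h1 : llip (fun t => auf (e ^+ 2) t - 1) by apply: llipD; [auto|apply: llipC].
  rewrite !fcM//; last by apply: llipM; auto.
  by rewrite fcB//; auto; rewrite fcC// sc1 fc_id.
apply: fc_norm => // [|t /andP[t0 _]].
  by do 2?[apply: llipM]; auto; apply: llipD; auto.
have /andP[h1 h2] := auf_bnd e2 t0; have /andP[h3 h4] := auf_sub e2 t0.
set u := auf _ _ in h1 h2 h3 h4 *.
rewrite ger0_norm; last by rewrite mulrAC -expr2 mulr_ge0 ?sqr_ge0.
by nra.
Qed.

Lemma cle_sq a : cpos a -> cle (a * a) a.
Proof.
move=> apos; have [y [ysa yy ypos _]] := cposP apos.
have -> : a * a = y * a * st y by rewrite ysa -yy !mulrA.
exact: cle_conj.
Qed.

Lemma cle_starC x : cle (st x * x) (x * st x).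
Proof.
have T := cpos_star' x; apply: cle_trans (cle_sq T).
have := rcl_star_star (rcl_starE x); by rewrite (cpos_sa T).
Qed.

Lemma cle_starC' x : cle (x * st x) (st x * x).
Proof. by have := cle_starC (st x); rewrite ustK. Qed.

Lemma cle_refl a : cpos a -> cle a a.
Proof.
move=> apos; have [y [ysa yy _ _]] := cposP apos.
by have := cle_starC y; rewrite ysa yy.
Qed.

Lemma cle_sq' a : cpos a -> cle a (a * a).
Proof.
move=> apos; have [y [ysa yy _ _]] := cposP apos.
have := rcl_star_star (rcl_starE y); rewrite !ustM ustK ysa yy.
by [].
Qed.

Lemma rcl_cle b r : cpos b -> rcl b r -> cle (st r * r) b.
Proof.
move=> bpos /rcl_star_star; rewrite (cpos_sa bpos) => h.
exact: cle_trans h (cle_sq bpos).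
Qed.

Lemma rcl_pos_cle a b : cpos a -> cpos b -> rcl b a -> cle a b.
Proof.
move=> apos bpos /(rcl_cle bpos); rewrite (cpos_sa apos).
exact: cle_trans (cle_sq' apos).
Qed.

Lemma cle_scl t b : 0 < t -> cpos b -> cle (sc t * b) b.
Proof.
move=> t0 bpos; apply: rcl_pos_cle => //; first by apply: cposZ => //; exact: ltW.
by rewrite -sc_comm; exact: rclM.
Qed.

Lemma cle_monoZ t a b : 0 < t -> cpos a -> cpos b -> cpos (sc t * b - a) -> cle a b.
Proof.
move=> t0 apos bpos h; apply: cle_trans (cle_scl t0 bpos).
by apply: cle_mono => //; apply: cposZ => //; exact: ltW.
Qed.

Lemma cut_cle e a : cpos a -> 0 <= e -> cle (cut e a) a.
Proof.
by move=> apos e0; apply: cle_mono => //; [exact: cut_pos|exact: cut_le_id].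
Qed.

Lemma cut_cle2 e d a : cpos a -> d <= e -> cle (cut e a) (cut d a).
Proof. by move=> apos de; apply: cle_mono; [exact: cut_pos|exact: cut_pos|exact: cut_le]. Qed.

Lemma cle_cut_closed a b : cpos a -> (forall e, 0 < e -> cle (cut e a) b) -> cle a b.
Proof.
move=> apos h; apply: cle_closed => e e0; exists (cut e a); first exact: h.
exact: cut_dist (ltW e0) apos.
Qed.

(* Kirchberg-Rordam: [(a - e)_+ <= f b f] for a suitable [f] in C*(a). *)
Lemma kr_dom a b e d : cpos a -> sa b -> nm (a - b) <= d -> 0 <= d -> d < e ->
  exists2 f, sa f & cpos (f * b * f - cut e a).
Proof.
(* The midpoint [m] leaves room on both sides: [f] vanishes below [m], in particular wherever
   [t - d] is negative, and is at least 1 above [e]. Hence [f(t)^2 (t - d)] dominates the cut-down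
   at [e]. *)
move=> apos bsa ab d0 de; pose m := (d + e) / 2.
have dm : d < m by rewrite /m; lra.
have me : m < e by rewrite /m; lra.
pose k := (e - m)^-1; have k0 : 0 < k by rewrite invr_gt0 subr_gt0.
pose f t := k * cutf m t.
have hf : llip f by apply: llipM; auto.
exists (fc f a); first exact: fc_sa.
have h1 : cpos (b - (a - sc d)).
  have -> : b - (a - sc d) = sc d - (a - b) by rewrite !opprB addrCA.
  by apply: cpos_sc_sub => //; apply: saB => //; exact: cpos_sa.
have {h1} h1 := cpos_conj (fc f a) h1; rewrite (fc_sa apos hf) in h1.
rewrite -(subrK (fc f a * (a - sc d) * fc f a) (_ * b * _)) -addrA; apply: cposD.
  by move: h1; rewrite mulrBr mulrBl.
have -> : fc f a * (a - sc d) * fc f a = fc (fun t => f t * (t - d) * f t) a.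
  have h : llip (fun t => t - d) by apply: llipD; auto; apply: llipC.
  have E : fc (fun t => t - d) a = a - sc d.
    by rewrite (@fcB _ _ a apos id (fun=> d)) ?fcC ?fc_id.
  by rewrite -E -(fcM apos hf h) -(fcM apos _ hf)//; exact: llipM.
apply: fc_mono => //.
  by apply: llipM => //; apply: llipM => //; apply: llipD; auto; apply: llipC.
move=> t _; rewrite {1}/cutf ge_max; apply/andP; split.
  have [te|te] := leP (t - e) 0.
    apply: le_trans te _; rewrite mulrAC -expr2.
    have [tm|tm] := leP (t - m) 0.
      by rewrite /f /cutf maxEle tm mulr0 expr0n /= mul0r.
    by rewrite mulr_ge0 ?sqr_ge0//; lra.
  rewrite /f /cutf maxEle; case: (leP (t - m) 0) => tm; first lra.
  have : 1 <= k * (t - m).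
    by rewrite /k ler_pdivlMl ?subr_gt0// mulr1; lra.
  set u := k * _ => u1; have : t - e <= t - d by lra.
  move=> h; apply: le_trans h _; rewrite mulrAC -[leLHS]mul1r.
  by apply: ler_wpM2r; [lra|nra].
rewrite mulrAC -expr2.
have [tm|tm] := leP (t - m) 0.
  by rewrite /f /cutf maxEle tm mulr0 expr0n /= mul0r.
by rewrite mulr_ge0 ?sqr_ge0//; lra.
Qed.

(** By [kr_dom] the cut-down is dominated by [x^* x] for [x = b^(1/2) v^* f], which lies in the
    right ideal of [b]. Polar decomposition then realizes it exactly, without leaving that ideal. *)
Lemma kr_exact a b v e d : cpos a -> cpos b -> nm (v * b * st v - a) <= d -> 0 <= d -> d < e ->
  exists2 r, rcl b r & st r * r = cut e a.
Proof.
move=> apos bpos ab d0 de; rewrite unm_distC in ab.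
have bsa : sa (v * b * st v) by apply/cpos_sa/cpos_conj'.
have [f fsa hf] := kr_dom apos bsa ab d0 de.
have [y [ysa yy ypos _]] := cposP bpos.
have [|r hr rE] := @polar (y * (st v * f)) _ (cut_pos e apos).
  by move: hf; rewrite !ustM ustK fsa ysa -!mulrA (mulrA y) yy !mulrA.
exists r => //; apply: rcl_trans hr; apply: rclMr; exact: sqrt_rcl.
Qed.

Lemma kr a b e d : cpos a -> cpos b -> nm (a - b) <= d -> 0 <= d -> d < e -> cle (cut e a) b.
Proof.
move=> apos bpos ab d0 de; rewrite unm_distC in ab.
have [|r hr <-] := @kr_exact a b 1 e d apos bpos _ d0 de.
  by rewrite ust1 mul1r mulr1.
exact: rcl_cle.
Qed.

Lemma cle_exact a b e : cpos a -> cpos b -> cle a b -> 0 < e ->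
  exists2 r, rcl b r & st r * r = cut e a.
Proof.
move=> apos bpos ab e0; have [v hv] := ab _ (nm_half e0).
by apply: (kr_exact apos bpos hv); lra.
Qed.

(** Rordam's lemma. For a fixed approximating [v], a small cut-down of [b] changes [v b v^*] by at
    most [e / 4]; together with the approximation error [e / 4] this stays below [e], and [kr]
    applies. *)
Lemma rordam a b e : cpos a -> cpos b -> cle a b -> 0 < e ->
  exists2 d, 0 < d & cle (cut e a) (cut d b).
Proof.
move=> apos bpos ab e0; have [v hv] := ab _ (nm_half (nm_half e0)).
have v0 := unm_ge0 v; have V0 : 0 < nm v * nm v + 1 by rewrite ltr_wpDl// mulr_ge0.
exists (e / 2 / 2 / (nm v * nm v + 1)); first by rewrite !divr_gt0.
set d := _ / (_ + 1); have d0 : 0 < d by rewrite !divr_gt0.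
apply: (@cle_trans (v * cut d b * st v)); last exact: cle_conj.
apply: (@kr _ _ _ (e / 2)) => //.
- exact: cpos_conj' (cut_pos _ bpos).
- apply: le_trans (unm_tri (v * b * st v) _ _) _; rewrite unm_distC [leRHS]splitr.
  apply: lerD => //; rewrite -mulrBl -mulrBr.
  apply: le_trans (unmM3 _ _ _) _; rewrite unm_ust mulrAC unm_distC.
  apply: (@le_trans _ _ ((nm v * nm v + 1) * d)); last by rewrite mulrC divfK ?lt0r_neq0.
  by apply: ler_pM; rewrite ?unm_ge0 ?mulr_ge0 ?lerDl//; exact: cut_dist (ltW d0) bpos.
- by lra.
- by lra.
Qed.

Definition cwb a b := exists2 e, 0 < e & cle a (cut e b).

Lemma cwb_cut a e : cpos a -> 0 < e -> cwb (cut e a) a.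
Proof. by move=> apos e0; exists e => //; apply: cle_refl; exact: cut_pos. Qed.

Lemma cwb_cle a b : cpos b -> cwb a b -> cle a b.
Proof. by move=> bpos [e e0 h]; apply: cle_trans h (cut_cle bpos (ltW e0)). Qed.

Lemma cwb_trans_le a b c : cpos b -> cpos c -> cwb a b -> cle b c -> cwb a c.
Proof.
move=> bpos cpos_c [e e0 ab] bc; have [d d0 h] := rordam bpos cpos_c bc e0.
by exists d => //; exact: cle_trans ab h.
Qed.

Lemma cwb_le_trans a b c : cle a b -> cwb b c -> cwb a c.
Proof. by move=> ab [e e0 bc]; exists e => //; exact: cle_trans ab bc. Qed.

Lemma cwb_interp a c : cpos c -> cwb a c -> exists2 e, 0 < e & cwb a (cut e c).
Proof.
move=> cpos_c [e e0 ac]; exists (e / 2); first exact: nm_half.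
exists (e / 2); first exact: nm_half.
by rewrite cut_cut// -?splitr// ltW// nm_half.
Qed.

End CuntzComparison.

(** * Orthogonal sums and the refinement properties (O5), (O6), (O7) *)

Section CuntzRefinement.
Variables (R : realType) (U : ucstarType R).
Implicit Types (x y z a b c r u v w p q : U) (s t e d : R) (f g : R -> R).
Local Notation nm := (@unm R U).
Local Notation st := (@ust R U).
Local Notation sc := (@sc R U).

Hint Resolve cut_llip resf_llip auf_llip llip_id llipC : core.

Lemma rcl_orth a x y : y * a = 0 -> rcl a x -> y * x = 0.
Proof.
move=> ya ax; apply: unm_le_eps => e e0; have y0 := unm_ge0 y.
have V0 : 0 < nm y + 1 by rewrite ltr_wpDl.
have [v hv] := ax _ (divr_gt0 e0 V0).
rewrite subr0 -[x](subrK (a * v)) mulrDr mulrA ya mul0r addr0.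
apply: le_trans (unmM _ _) _; rewrite ler_pdivlMr// mulrC unm_distC in hv.
by apply: le_trans hv; apply: ler_wpM2r; rewrite ?unm_ge0// lerDl.
Qed.

Lemma orthC a b : sa a -> sa b -> a * b = 0 -> b * a = 0.
Proof. by move=> ha hb h; rewrite -[LHS]ustK ustM ha hb h ust0. Qed.

Lemma rcl_orth_star x y r z : st x * y = 0 -> rcl x r -> rcl y z -> st r * z = 0.
Proof.
move=> xy xr yz; apply: (rcl_orth _ yz).
by rewrite -[LHS]ustK ustM ustK (rcl_orth _ xr) ?ust0// -[LHS]ustK ustM ustK xy ust0.
Qed.

Lemma rcl_orthl a b : a * b = 0 -> cpos a -> cpos b -> rcl (a + b) a.
Proof.
move=> ab apos bpos; have ba := orthC (cpos_sa apos) (cpos_sa bpos) ab.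
apply: rcl_trans (sqrt_rcl apos erefl).
have -> : a * a = (a + b) * a by rewrite mulrDl ba addr0.
exact: rclM.
Qed.

Lemma rcl_orthr a b : a * b = 0 -> cpos a -> cpos b -> rcl (a + b) b.
Proof.
move=> ab apos bpos; rewrite addrC; apply: rcl_orthl => //.
by apply: orthC => //; exact: cpos_sa.
Qed.

Lemma ev_orth a b (p : {poly R}) : a * b = 0 -> b * a = 0 ->
  ev (a + b) (p * 'X) = ev a (p * 'X) + ev b (p * 'X).
Proof.
move=> ab ba; elim/poly_ind: p => [|p k ih].
  by rewrite mul0r -[0 : {poly R}]/(0%:P) !evC sc0 addr0.
have E x : ev x ((p * 'X + k%:P) * 'X) = ev x (p * 'X) * x + sc k * x.
  by rewrite mulrDl evD evM [in X in _ + X]evM evC evX.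
have cab : ev a (p * 'X) * b = 0 by rewrite evM evX -mulrA ab mulr0.
have cba : ev b (p * 'X) * a = 0 by rewrite evM evX -mulrA ba mulr0.
rewrite !E ih !mulrDr !mulrDl cab cba addr0 add0r.
by rewrite addrACA.
Qed.

Lemma fc_orthD a b f : cpos a -> cpos b -> a * b = 0 -> llip f -> f 0 = 0 ->
  fc f (a + b) = fc f a + fc f b.
Proof.
move=> apos bpos ab hf f0; have ba := orthC (cpos_sa apos) (cpos_sa bpos) ab.
have abpos : cpos (a + b) by exact: cposD.
have na : nm a <= nm (a + b) by apply: unm_mono => //; rewrite addrC addKr.
have nb : nm b <= nm (a + b) by apply: unm_mono => //; rewrite addrK.
apply: fc_is => // e e0; have e4 : 0 < e / 4 by rewrite divr_gt0.
have [p hp] := llip_approx hf (nm (a + b)) e4.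
have p0 : `|p.[0]| <= e / 4.
  by have := hp 0; rewrite f0 subr0 lexx unm_ge0 => /(_ isT).
have [q pq] : exists q : {poly R}, p - (p.[0])%:P = q * 'X.
  have /factor_theorem[q qE] : root (p - (p.[0])%:P) 0.
    by apply/rootP; rewrite !hornerE subrr.
  by exists q; rewrite qE subr0.
have close : forall s, 0 <= s <= nm (a + b) -> `|(q * 'X).[s] - f s| <= e / 2.
  move=> s /hp; rewrite -pq hornerD hornerN hornerC; move: p0.
  by rewrite !ler_norml => /andP[? ?] /andP[? ?]; apply/andP; split; lra.
have cl x : cpos x -> nm x <= nm (a + b) -> nm (ev x (q * 'X) - fc f x) <= e / 2.
  move=> xpos xn; apply: is_fc_norm (is_fc_ev _ _) (fcP xpos hf) _ => // s /andP[s0 sx].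
  by apply: close; rewrite s0 (le_trans sx).
exists (q * 'X).
  by move=> s /close h; apply: le_trans h _; lra.
rewrite ev_orth// opprD addrACA [leRHS]splitr.
by apply: le_trans (unmD _ _) _; apply: lerD; exact: cl.
Qed.

Lemma cut0 e : 0 <= e -> cutf e 0 = 0.
Proof. by move=> e0; rewrite /cutf sub0r maxEle oppr_le0 e0. Qed.

Lemma cut_orthD e a b : cpos a -> cpos b -> a * b = 0 -> 0 <= e ->
  cut e (a + b) = cut e a + cut e b.
Proof. by move=> apos bpos ab e0; apply: fc_orthD => //; exact: cut0. Qed.

Lemma cut_orth e a b : cpos a -> cpos b -> 0 <= e -> a * b = 0 -> cut e a * cut e b = 0.
Proof.
move=> apos bpos e0 ab; rewrite -(cpos_sa (cut_pos e apos)).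
by apply: (@rcl_orth_star a b); rewrite ?(cpos_sa apos)//; exact: cut_rcl.
Qed.

(** The elements [r] and [w] realizing the cut-downs of [p] and [q] lie in the right ideals of the
    orthogonal [a] and [b], so the cross terms of their sum vanish. *)
Lemma cle_add p q a b : cpos p -> cpos q -> cpos a -> cpos b -> a * b = 0 ->
  cle p a -> cle q b -> cle (p + q) (a + b).
Proof.
move=> ppos qpos apos bpos ab pa qb; have abpos := cposD apos bpos.
apply: cle_closed => e e0; have e2 := nm_half e0.
have [r ar rE] := cle_exact ppos apos pa e2; have [w bw wE] := cle_exact qpos bpos qb e2.
have rw : st r * w = 0.
  by apply: (rcl_orth_star _ ar bw); rewrite (cpos_sa apos).
have wr : st w * r = 0 by rewrite -[LHS]ustK ustM ustK rw ust0.
exists (cut (e / 2) p + cut (e / 2) q).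
  have -> : cut (e / 2) p + cut (e / 2) q = st (r + w) * (r + w).
    by rewrite ustD mulrDr !mulrDl rw wr rE wE addr0 add0r.
  apply: rcl_cle => //; apply: rclD.
    by apply: rcl_trans ar; exact: rcl_orthl.
  by apply: rcl_trans bw; exact: rcl_orthr.
rewrite opprD addrACA [leRHS]splitr; apply: le_trans (unmD _ _) _.
by apply: lerD; apply: cut_dist => //; exact: ltW.
Qed.

Lemma cwb_add p q a b : cpos p -> cpos q -> cpos a -> cpos b -> a * b = 0 ->
  cwb p a -> cwb q b -> cwb (p + q) (a + b).
Proof.
move=> ppos qpos apos bpos ab [e e0 pa] [d d0 qb].
have m0 : 0 < Num.min e d by rewrite lt_min e0.
exists (Num.min e d) => //; rewrite cut_orthD//; last exact: ltW.
apply: cle_add => //; [exact: cut_pos|exact: cut_pos|by apply: cut_orth => //; exact: ltW|..].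
  by apply: cle_trans pa _; apply: cut_cle2 => //; rewrite ge_min lexx.
by apply: cle_trans qb _; apply: cut_cle2 => //; rewrite ge_min lexx orbT.
Qed.

Lemma cwb_split p a b : cpos a -> cpos b -> a * b = 0 -> cwb p (a + b) ->
  exists2 e, 0 < e & cle p (cut e a + cut e b).
Proof. by move=> apos bpos ab [e e0]; rewrite cut_orthD// ?ltW// => h; exists e. Qed.

Lemma conj_parallelogram x y b :
  (x - y) * b * (x - y) + (x + y) * b * (x + y) = sc 2 * (x * b * x + y * b * y).
Proof.
rewrite sc2 !mulrDl !mulrDr !mulrN !mulNr !opprK.
set p := x * b * x; set q := y * b * y; set u := x * b * y; set v := y * b * x.
rewrite (_ : p - u + (- v + q) = (p + q) - (u + v)); last first.
  by rewrite [- v + q]addrC addrACA opprD.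
rewrite (_ : p + u + (v + q) = (p + q) + (u + v)); last first.
  by rewrite [v + q]addrC addrACA.
by rewrite addrACA addNr addr0.
Qed.

Lemma conj_sc_sub x y b t : sa x -> sa y -> y * y = b ->
  sc t * (x * b * x) - x * b * st (x * b) = x * y * (sc t - b) * st (x * y).
Proof.
move=> xsa ysa <-; rewrite !ustM xsa ysa mulrBr mulrBl sc_comm.
by congr (_ - _); rewrite !mulrA.
Qed.

(* With [r^* r = (a + d - e/2)_+] and [r] in the right ideal of [b], the summands
   become orthogonal in the hereditary subalgebra of [b] as [r A r^*], [r D r^*];
   for a bump [E] of the first one, [(1 - E) b (1 - E)] is its complement. *)
Lemma cle_O5 a z b e : cpos a -> cpos z -> cpos b -> a * z = 0 -> cle (a + z) b -> 0 < e ->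
  exists p c u, [/\ cpos p, cpos c, cpos u & p * c = 0] /\
    [/\ cle (cut e a) p, cle (p + c) b, cle u a, cle b (u + c) & cle (cut e z) c].
Proof.
move=> apos zpos bpos az azb e0; have e2 := nm_half e0; have e20 := ltW e2.
have [r br rE] := cle_exact (cposD apos zpos) bpos azb e2.
rewrite cut_orthD// in rE.
have Apos := cut_pos (e / 2) apos; have Dpos := cut_pos (e / 2) zpos.
set A := cut (e / 2) a in rE Apos; set D := cut (e / 2) z in rE Dpos.
have AD : A * D = 0 by exact: cut_orth.
have DA : D * A = 0 by apply: orthC => //; exact: cpos_sa.
have equi B B' : cpos B -> B' * B = 0 -> st r * r = B + B' ->
    [/\ cpos (r * B * st r), rcl b (r * B * st r), cle B (r * B * st r) & cle (r * B * st r) B].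
  move=> Bpos B'B rr; have [y [ysa yy ypos _]] := cposP Bpos.
  have E1 : (r * y) * st (r * y) = r * B * st r by rewrite ustM ysa -yy !mulrA.
  have E2 : st (r * y) * (r * y) = B * B.
    rewrite ustM ysa mulrA -(mulrA y) rr mulrDr mulrDl.
    rewrite -[X in _ + X]mulrA (rcl_orth B'B (sqrt_rcl ypos yy)) mulr0 addr0.
    by rewrite -yy !mulrA.
  split; first exact: cpos_conj'.
  - by do 2?[apply: rclMr].
  - by apply: cle_trans (cle_sq' Bpos) _; rewrite -E1 -E2; exact: cle_starC.
  - by apply: cle_trans (cle_sq Bpos); rewrite -E1 -E2; exact: cle_starC'.
have [a1pos ba1 Aa1 a1A] := equi A D Apos DA rE.
have [d1pos bd1 Dd1 d1D] : [/\ cpos (r * D * st r), rcl b (r * D * st r),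
    cle D (r * D * st r) & cle (r * D * st r) D].
  by apply: (equi D A) => //; rewrite addrC.
have d1a1 : (r * D * st r) * (r * A * st r) = 0.
  have h : D * (st r * r) * A = 0 by rewrite rE mulrDr DA add0r -mulrA DA mulr0.
  have -> : r * D * st r * (r * A * st r) = r * (D * (st r * r) * A) * st r.
    by rewrite !mulrA.
  by rewrite h mulr0 mul0r.
set a1 := r * A * st r in a1pos ba1 Aa1 a1A d1a1.
set d1 := r * D * st r in d1pos bd1 Dd1 d1D d1a1.
have [n n0 hn] := rordam Apos a1pos Aa1 e2.
rewrite /A cut_cut// -splitr in hn.
have n0' := ltW n0.
(* The bump equals 1 on the support of [cutf n], so the complement [F] annihilates the cut-down of
   [a1]; it is bounded by a multiple of [t], so [E] stays in the right ideal of [a1]. *)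
pose f t := Num.min (n^-1 * t) 1.
have hf : llip f by apply: llip_min; apply: llipM; auto.
have fbnd t : 0 <= t -> `|f t| <= n^-1 * t.
  move=> t0; have nt : 0 <= n^-1 * t by rewrite mulr_ge0 ?invr_ge0.
  by rewrite ger0_norm ?le_min ?nt ?ler01// ge_min lexx.
set E := fc f a1; have Esa : sa E by exact: fc_sa.
have aE : rcl a1 E.
  by apply: (@fc_rcl _ _ _ _ n^-1) => //; [rewrite invr_ge0|move=> t /andP[t0 _]; exact: fbnd].
set F := 1 - E; have Fsa : sa F by apply: saB => //; exact: sa1.
have pF : cut n a1 * F = 0.
  have -> : F = fc (fun t => 1 - f t) a1.
    by rewrite (@fcB _ _ a1 a1pos (fun=> 1) f)// fcC// sc1.
  have h1 : llip (fun t => 1 - f t) by apply: llipD; auto; exact: llipN.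
  rewrite -fcM// -(sc0 U) -(fcC a1pos 0); apply: eq_fc => //; first exact: llipM.
  move=> t /andP[t0 _]; rewrite /cutf /f maxEle minEle.
  case: (leP (t - n) 0) => tn; first by rewrite mul0r.
  case: (leP (n^-1 * t) 1) => nt; last by rewrite subrr mulr0.
  by move: nt; rewrite ler_pdivrMl// mulr1; lra.
set c := F * b * F.
have cpos_c : cpos c by rewrite /c -{1}Fsa; exact: cpos_conj.
have bE : rcl b E by exact: rcl_trans ba1 aE.
exists (cut n a1), c, (E * b * E); split; split => //.
- exact: cut_pos.
- by rewrite -{1}Esa; exact: cpos_conj.
- by rewrite /c !mulrA pF !mul0r.
- apply: rcl_pos_cle => //; first by apply: cposD => //; exact: cut_pos.
  apply: rclD; first by apply: rcl_trans ba1 _; exact: cut_rcl.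
  rewrite /c {1}/F mulrBl mul1r mulrBl; apply: rclD; first exact: rclM.
  by apply: rclN; do 2?[apply: rclMr].
- apply: cle_trans (cut_cle apos e20); apply: cle_trans a1A.
  apply: rcl_pos_cle => //; first by rewrite -{1}Esa; exact: cpos_conj.
  by do 2?[apply: rclMr].
- have ub : cpos (E * b * E) by rewrite -{1}Esa; exact: cpos_conj.
  (* As [E + F = 1], the parallelogram identity gives [b <= 2 (E b E + F b F)]. *)
  apply: (@cle_monoZ _ _ 2) => //; first exact: cposD.
  have EF : E + F = 1 by rewrite /F addrC subrK.
  have EFsa : sa (E - F) by exact: saB.
  by rewrite -conj_parallelogram EF mulr1 mul1r addrK -{1}EFsa; exact: cpos_conj.
- apply: (@cle_trans _ _ D).
    by apply: cut_cle2 => //; rewrite ler_pdivrMr// mulr_natr mulr2n lerDl ltW.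
  apply: cle_trans Dd1 _.
  have d1E : d1 * E = 0 by exact: rcl_orth d1a1 aE.
  have Ed1 : E * d1 = 0 by apply: orthC => //; exact: cpos_sa.
  have hd : rcl (F * b) d1.
    have -> : d1 = F * d1 by rewrite mulrBl mul1r Ed1 subr0.
    exact: rclMl.
  apply: cle_trans (cle_sq' d1pos) _; rewrite -{1}(cpos_sa d1pos).
  apply: cle_trans (rcl_star_star hd) _; apply: cle_trans (cle_starC _) _.
  have [y [ysa yy ypos _]] := cposP bpos.
  have b0 := unm_ge0 b.
  apply: (@cle_monoZ _ _ (nm b + 1)) => //; first by rewrite ltr_wpDl.
    exact: cpos_star'.
  rewrite /c (conj_sc_sub _ Fsa ysa yy).
  apply: cpos_conj'; apply: cpos_sc_sub; first exact: cpos_sa.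
  by rewrite lerDl.
Qed.

Lemma auf_approx w r e : cpos w -> rcl w r -> 0 < e ->
  exists2 d, 0 < d & nm (fc (auf d) w * r - r) <= e.
Proof.
move=> wpos wr e0; have [v hv] := wr _ (nm_half e0).
have v0 := unm_ge0 v; have V0 : 0 < nm v + 1 by rewrite ltr_wpDl.
pose d := e / 2 / (nm v + 1); have d0 : 0 < d by rewrite !divr_gt0.
exists d => //; set g := fc (auf d) w.
have g1 : nm (g - 1) <= 1.
  rewrite -sc1 -(fcC wpos); apply: fc_dist; auto.
  by move=> t /andP[t0 _]; have /andP[h1 h2] := auf_bnd d0 t0; rewrite ler_norml; lra.
have gw : nm ((g - 1) * w) <= d.
  rewrite mulrBl mul1r -{1 2}(fc_id wpos) -fcM//; auto; rewrite unm_distC.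
  apply: fc_dist; auto; first by apply: llipM; auto.
  by move=> t /andP[t0 _]; have /andP[h1 h2] := auf_sub d0 t0; rewrite mulrC ger0_norm.
have -> : g * r - r = (g - 1) * w * v - (g - 1) * (w * v - r).
  by rewrite -mulrA -mulrBr subKr mulrBl mul1r.
apply: le_trans (unmB _ _) _; rewrite [leRHS]splitr; apply: lerD.
  apply: le_trans (unmM _ _) _; apply: (@le_trans _ _ (d * (nm v + 1))).
    by apply: ler_pM; rewrite ?unm_ge0// lerDl.
  by rewrite divfK ?lt0r_neq0.
apply: le_trans (unmM _ _) _; rewrite -[leRHS]mul1r.
by apply: ler_pM; rewrite ?unm_ge0.
Qed.

(** Write a cut-down of [a] as [r^* r] with [r] in the right ideal of [b + c]. An approximate unit
    [g(b + c)] inserted between the factors changes little and splits as [g(b) + g(c)] by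
    orthogonality; the two summands are below [a] because [g <= 1], and below [b] and [c]
    respectively. *)
Lemma cle_O6 a b c e : cpos a -> cpos b -> cpos c -> b * c = 0 -> cle a (b + c) -> 0 < e ->
  exists u w, [/\ cpos u, cpos w & cle (cut e a) (u + w)] /\
    [/\ cle u a, cle u b, cle w a & cle w c].
Proof.
move=> apos bpos cpos_c bc abc e0; have e2 := nm_half e0; have bcpos := cposD bpos cpos_c.
have [r hr rE] := cle_exact apos bcpos abc e2.
have r0 := unm_ge0 r; have R0 : 0 < nm r + 1 by rewrite ltr_wpDl.
have [d d0 hd] := auf_approx bcpos hr (divr_gt0 (nm_half e2) R0).
have hg : llip (auf d) by auto.
have g0 : auf d 0 = 0 by rewrite /auf mul0r.
have side x : cpos x -> [/\ cpos (st r * fc (auf d) x * r), cle (st r * fc (auf d) x * r) a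
    & cle (st r * fc (auf d) x * r) x].
  move=> xpos; have gpos : cpos (fc (auf d) x).
    by apply: fc_pos => // t /andP[t0 _]; have /andP[] := auf_bnd d0 t0.
  split; first exact: cpos_conj.
    apply: cle_trans (cut_cle apos (ltW e2)); rewrite -rE.
    apply: cle_mono; [exact: cpos_conj|exact: cpos_star|].
    rewrite -{1}[st r]mulr1 -mulrBl -mulrBr; apply: cpos_conj.
    rewrite -sc1 -(fcC xpos); apply: fc_mono => //.
    by move=> t /andP[t0 _]; have /andP[] := auf_bnd d0 t0.
  apply: cle_trans (cle_conj' _ _) _; apply: rcl_pos_cle => //; exact: auf_rcl.
have [h1 h2 h3] := side _ bpos; have [h4 h5 h6] := side _ cpos_c.
exists (st r * fc (auf d) b * r), (st r * fc (auf d) c * r); split; split => //.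
have E : cut e a = cut (e / 2) (cut (e / 2) a) by rewrite cut_cut ?ltW// -splitr.
rewrite E; apply: (@kr _ _ _ _ _ (e / 2 / 2)).
- exact: cut_pos.
- exact: cposD.
- rewrite -mulrDl -mulrDr -fc_orthD// -rE -mulrA -mulrBr.
  apply: le_trans (unmM _ _) _; rewrite unm_ust unm_distC.
  rewrite ler_pdivlMr// mulrC in hd; apply: le_trans hd.
  by apply: ler_wpM2r; rewrite ?unm_ge0// lerDl.
- by rewrite !divr_ge0// ltW.
- by rewrite [ltRHS]splitr ltrDl nm_half.
Qed.

(** The cut-downs of [a] and [b] are [r^* r] and [v^* v] with [r] and [v] in the right ideal of [c].
    Passing to [r r^*] and [v v^*] moves both into the hereditary subalgebra of [c], where their sum
    dominates each of them. *)
Lemma cle_O7 a b c e : cpos a -> cpos b -> cpos c -> cle a c -> cle b c -> 0 < e ->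
  exists u w, [/\ cpos u, cpos w & cle (u + w) c] /\
    [/\ cle u a, cle w b, cle (cut e a) (u + w) & cle (cut e b) (u + w)].
Proof.
move=> apos bpos cpos_c ac bc e0.
have [r hr rE] := cle_exact apos cpos_c ac e0; have [v hv vE] := cle_exact bpos cpos_c bc e0.
have rpos := cpos_star' r; have vpos := cpos_star' v; have e00 := ltW e0.
exists (r * st r), (v * st v); split; split => //.
- apply: rcl_pos_cle => //; first exact: cposD.
  by apply: rclD; exact: rclMr.
- by apply: cle_trans (cle_starC' r) _; rewrite rE; exact: cut_cle.
- by apply: cle_trans (cle_starC' v) _; rewrite vE; exact: cut_cle.
- rewrite -rE; apply: cle_trans (cle_starC r) _; apply: cle_mono => //; first exact: cposD.
  by rewrite addrC addKr.
- rewrite -vE; apply: cle_trans (cle_starC v) _; apply: cle_mono => //; first exact: cposD.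
  by rewrite addrK.
Qed.
End CuntzRefinement.

(** * Unitization *)

Local Open Scope classical_set_scope.
Section RealNorm.
Variables (R : realType) (A : normedModType R[i]).
Implicit Types (x y : A).

Definition rn x : R := complex.Re `|x|.

Lemma rnE x : `|x| = (rn x)%:C.
Proof. by rewrite /rn RRe_real// ger0_real. Qed.

Lemma rn_ge0 x : 0 <= rn x.
Proof. by rewrite -lecR -rnE normr_ge0. Qed.

Lemma rn0_eq0 x : rn x = 0 -> x = 0.
Proof. by move=> h; apply/normr0_eq0; rewrite rnE h. Qed.

Lemma rn0 : rn 0 = 0.
Proof. by rewrite /rn normr0. Qed.

Lemma rnD x y : rn (x + y) <= rn x + rn y.
Proof. by rewrite -lecR rmorphD /= -!rnE; exact: ler_normD. Qed.

Lemma normcEC (z : R[i]) : `|z| = (normc z)%:C.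
Proof. by case: z => a b; rewrite normc_def. Qed.

Lemma rnZ (z : R[i]) x : rn (z *: x) = normc z * rn x.
Proof. by apply: (@complexI R); rewrite rmorphM /= -!rnE normrZ normcEC. Qed.

Lemma rnN x : rn (- x) = rn x.
Proof. by rewrite /rn normrN. Qed.

Lemma rn_distC x y : rn (x - y) = rn (y - x).
Proof. by rewrite -rnN opprB. Qed.

Lemma rn_tri z x y : rn (x - y) <= rn (x - z) + rn (z - y).
Proof. by apply: le_trans (rnD _ _); rewrite addrA subrK. Qed.

Lemma rn_cvgP (u : nat -> A) l : u @ \oo --> l <->
  forall e : R, 0 < e -> exists N, forall n, (N <= n)%N -> rn (u n - l) <= e.
Proof.
split=> [/cvgrPdist_le h e e0|h].
  have [|N _ hN] := h e%:C; first by rewrite ltcR.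
  by exists N => n /hN /=; rewrite rnE lecR rn_distC.
apply/cvgrPdist_le => e e0; have er : e = (complex.Re e)%:C by rewrite RRe_real// gtr0_real.
have [|N hN] := h (complex.Re e); first by rewrite -ltcR -er.
by exists N => // n /hN /=; rewrite rn_distC er rnE lecR.
Qed.
End RealNorm.

Lemma rn_complete (R : realType) (A : completeNormedModType R[i]) (u : nat -> A) :
  (forall e : R, 0 < e -> exists N, forall m n, (N <= m)%N -> (N <= n)%N ->
      rn (u m - u n) <= e) ->
  exists l, forall e : R, 0 < e -> exists N, forall n, (N <= n)%N -> rn (u n - l) <= e.
Proof.
move=> h; suff /rn_cvgP : cvg (u @ \oo) by exists (lim (u @ \oo)).
apply/cauchy_cvgP/cauchy_exP => e e0.
have er : e = (complex.Re e)%:C by rewrite RRe_real// gtr0_real.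
have e1 : 0 < complex.Re e by rewrite -ltcR -er.
have [N hN] := h (complex.Re e / 2) (divr_gt0 e1 (ltr0n R 2)).
exists (u N), N => // n /= Nn; rewrite -ball_normE /= er rnE ltcR.
by apply: le_lt_trans (hN _ _ (leqnn _) Nn) _; lra.
Qed.

(** * The unitization as a unital C*-algebra *)

Section Unitization.
Variables (R : realType) (A : cstarAlgType R).
Implicit Types (a b c x y : A) (z : R[i]).
Local Notation rn := (@rn R A).

Lemma cmul0l a : 0 ** a = 0.
Proof. by apply: (addrI (0 ** a)); rewrite -cmulDl !addr0. Qed.
Lemma cmul0r a : a ** 0 = 0.
Proof. by apply: (addrI (a ** 0)); rewrite -cmulDr !addr0. Qed.
Lemma rnM a b : rn (a ** b) <= rn a * rn b.
Proof. by rewrite -lecR rmorphM /= -!rnE; exact: cnormM. Qed.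
Lemma rn_star a : rn (cstar a ** a) = rn a ^+ 2.
Proof. by apply: (@complexI R); rewrite rmorphXn /= -!rnE cnorm_star. Qed.

Definition unitz := (R[i]^o * A)%type.
HB.instance Definition _ := GRing.Lmodule.on unitz.
Implicit Types (u v w : unitz).

Definition unitz_one : unitz := (1, 0).
Definition unitz_mul u v : unitz := (u.1 * v.1, u.1 *: v.2 + v.1 *: u.2 + u.2 ** v.2).
Definition unitz_star u : unitz := (conjc u.1, cstar u.2).
Definition unitz_act u b : A := u.1 *: b + u.2 ** b.

Lemma unitz_mulA : associative unitz_mul.
Proof.
move=> [z a] [w b] [t c]; rewrite /unitz_mul /=; congr pair; first exact: mulrA.
rewrite !scalerDr !cmulDr !cmulDl !cmulZl !cmulZr !scalerA cmulA !addrA.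
rewrite (mulrC w t) (mulrC t z); congr (_ + _).
rewrite -!addrA; congr (_ + (_ + _)).
by rewrite [LHS]addrCA; congr (_ + _); rewrite addrA addrC.
Qed.

Lemma unitz_mul1l : left_id unitz_one unitz_mul.
Proof. by move=> [z a]; rewrite /unitz_mul /= mul1r scale1r scaler0 cmul0l !addr0. Qed.
Lemma unitz_mul1r : right_id unitz_one unitz_mul.
Proof. by move=> [z a]; rewrite /unitz_mul /= mulr1 scale1r scaler0 cmul0r add0r addr0. Qed.
Lemma unitz_mulDl : left_distributive unitz_mul +%R.
Proof.
move=> [z a] [w b] [t c]; rewrite /unitz_mul /=; congr pair; first exact: mulrDl.
rewrite [RHS](_ : _ = z *: c + t *: a + a ** c + (w *: c + t *: b + b ** c))//.
by rewrite /= scalerDl scalerDr cmulDl (addrACA (z *: c)) [LHS]addrACA.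
Qed.
Lemma unitz_mulDr : right_distributive unitz_mul +%R.
Proof.
move=> [z a] [w b] [t c]; rewrite /unitz_mul /=; congr pair; first exact: mulrDr.
rewrite [RHS](_ : _ = z *: b + w *: a + a ** b + (z *: c + t *: a + a ** c))//.
by rewrite /= scalerDl scalerDr cmulDr (addrACA (z *: b)) [LHS]addrACA.
Qed.
Lemma unitz_one_neq0 : unitz_one != 0.
Proof. by apply/eqP => -[] /eqP; rewrite oner_eq0. Qed.

HB.instance Definition _ := GRing.Zmodule_isNzRing.Build unitz unitz_mulA unitz_mul1l
  unitz_mul1r unitz_mulDl unitz_mulDr unitz_one_neq0.

Lemma unitz_scalerAl z u v : z *: (u * v) = (z *: u) * v.
Proof.
case: u v => [w a] [t b]; congr pair; first exact: mulrA.
by rewrite /= !scalerDr !scalerA cmulZl; congr (_ + _ *: _ + _); rewrite mulrC.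
Qed.
HB.instance Definition _ := GRing.Lmodule_isLalgebra.Build R[i] unitz unitz_scalerAl.

Lemma unitz_scalerAr z u v : z *: (u * v) = u * (z *: v).
Proof.
case: u v => [w a] [t b]; congr pair; first exact: mulrCA.
by rewrite /= !scalerDr !scalerA cmulZr; congr (_ *: _ + _ + _); rewrite mulrC.
Qed.
HB.instance Definition _ := GRing.Lalgebra_isAlgebra.Build R[i] unitz unitz_scalerAr.

Lemma unitz_actM u v b : unitz_act (u * v) b = unitz_act u (unitz_act v b).
Proof.
rewrite /unitz_act /= !scalerDr !cmulDl !cmulDr !cmulZl !cmulZr cmulA !scalerA.
by rewrite -!addrA; congr (_ + _); rewrite addrCA.
Qed.

Lemma unitz_actD u v b : unitz_act (u + v) b = unitz_act u b + unitz_act v b.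
Proof. by rewrite /unitz_act /= scalerDl cmulDl addrACA. Qed.

Lemma unitz_actZ z u b : unitz_act (z *: u) b = z *: unitz_act u b.
Proof. by rewrite /unitz_act /= scalerDr scalerA cmulZl. Qed.

Lemma unitz_act_bnd u b : rn (unitz_act u b) <= (normc u.1 + rn u.2) * rn b.
Proof.
by rewrite mulrDl; apply: le_trans (rnD _ _) _; rewrite rnZ lerD2l; exact: rnM.
Qed.

(** The norm of [u] acting on [A] by left multiplication; for this norm the C*-identity of [A]
    passes to the unitization. *)
Definition opn u : R := sup [set rn (unitz_act u b) | b in [set b | rn b <= 1]].

Lemma opn_has_sup u : has_sup [set rn (unitz_act u b) | b in [set b | rn b <= 1]].
Proof.
split; first by exists (rn (unitz_act u 0)), 0 => //=; rewrite rn0.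
exists (normc u.1 + rn u.2) => _ [b /= b1 <-]; apply: le_trans (unitz_act_bnd _ _) _.
by rewrite -[leRHS]mulr1; apply: ler_wpM2l => //; rewrite addr_ge0 ?normc_ge0 ?rn_ge0.
Qed.

Lemma opn_act u b : rn (unitz_act u b) <= opn u * rn b.
Proof.
have [b0|b0] := eqVneq (rn b) 0.
  by rewrite (rn0_eq0 b0) /unitz_act scaler0 cmul0r addr0 rn0 mulr0.
have bp : 0 < rn b by rewrite lt_def b0 rn_ge0.
rewrite -ler_pdivrMr//; have -> : rn (unitz_act u b) / rn b = rn (unitz_act u ((rn b)^-1%:C *: b)).
  rewrite (_ : unitz_act u (_ *: b) = (rn b)^-1%:C *: unitz_act u b); last first.
    by rewrite /unitz_act cmulZr scalerDr !scalerA mulrC.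
  by rewrite rnZ normc_real gtr0_norm ?invr_gt0// mulrC.
apply: sup_upper_bound; first exact: opn_has_sup.
exists ((rn b)^-1%:C *: b) => //=.
by rewrite rnZ normc_real gtr0_norm ?invr_gt0// mulVf.
Qed.

Lemma opn_le u K : 0 <= K -> (forall b, rn (unitz_act u b) <= K * rn b) -> opn u <= K.
Proof.
move=> K0 h; apply: ge_sup; first by have [] := opn_has_sup u.
move=> _ [b /= b1 <-]; apply: le_trans (h _) _.
by rewrite -[leRHS]mulr1; exact: ler_wpM2l.
Qed.

Lemma opn_ge0 u : 0 <= opn u.
Proof.
apply: sup_upper_bound; first exact: opn_has_sup.
by exists 0; rewrite /= ?rn0// /unitz_act scaler0 cmul0r addr0 rn0.
Qed.

Lemma opnM u v : opn (u * v) <= opn u * opn v.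
Proof.
apply: opn_le => [|b]; first by rewrite mulr_ge0 ?opn_ge0.
rewrite unitz_actM; apply: le_trans (opn_act _ _) _.
by rewrite -mulrA; apply: ler_wpM2l; [exact: opn_ge0|exact: opn_act].
Qed.

Lemma opnD u v : opn (u + v) <= opn u + opn v.
Proof.
apply: opn_le => [|b]; first by rewrite addr_ge0 ?opn_ge0.
rewrite unitz_actD mulrDl; apply: le_trans (rnD _ _) _.
by apply: lerD; exact: opn_act.
Qed.

Lemma opnZ z u : opn (z *: u) = normc z * opn u.
Proof.
suff h t w : opn (t *: w) <= normc t * opn w.
  apply/le_anti; rewrite h /=.
  have [->|z0] := eqVneq z 0; first by rewrite normc0 mul0r opn_ge0.
  have zp : 0 < normc z.
    by rewrite lt_def normc_ge0 andbT; apply: contra z0 => /eqP/eq0_normc ->.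
  rewrite -ler_pdivlMl// -normcV.
  by have := h z^-1 (z *: u); rewrite scalerA mulVf// scale1r.
apply: opn_le => [|b]; first by rewrite mulr_ge0 ?normc_ge0 ?opn_ge0.
rewrite unitz_actZ rnZ -mulrA; apply: ler_wpM2l; [exact: normc_ge0|exact: opn_act].
Qed.

Lemma cstar_act u b : cstar (unitz_act u b) ** unitz_act u b =
  cstar b ** unitz_act (unitz_star u * u) b.
Proof.
rewrite unitz_actM /unitz_act /= cstarD cstarZ cstarM.
by rewrite cmulDl [in RHS]cmulDr cmulZl cmulZr cmulA.
Qed.

Lemma opn_star_le u : opn u ^+ 2 <= opn (unitz_star u * u).
Proof.
have h0 := opn_ge0 (unitz_star u * u).
rewrite -[leRHS]sqr_sqrtr// ler_sqr ?nnegrE ?opn_ge0 ?sqrtr_ge0//.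
apply: opn_le => [|b]; first exact: sqrtr_ge0.
rewrite -(@ler_pXn2r _ 2) ?nnegrE ?rn_ge0 ?mulr_ge0 ?sqrtr_ge0 ?rn_ge0//.
rewrite -rn_star cstar_act exprMn sqr_sqrtr//; apply: le_trans (rnM _ _) _.
have -> : rn (cstar b) = rn b.
  have sle x : rn x <= rn (cstar x).
    have [->|x0] := eqVneq (rn x) 0; first exact: rn_ge0.
    have xp : 0 < rn x by rewrite lt_def x0 rn_ge0.
    by rewrite -(ler_pM2r xp) -expr2 -rn_star; exact: rnM.
  by apply/le_anti; rewrite sle andbT -{2}[b]cstarK sle.
by apply: le_trans (ler_wpM2l (rn_ge0 _) (opn_act _ _)) _; rewrite mulrCA expr2.
Qed.

Lemma opn_star u : opn (unitz_star u) = opn u.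
Proof.
have sle (x : unitz) : opn x <= opn (unitz_star x).
  have [->|x0] := eqVneq (opn x) 0; first exact: opn_ge0.
  have xp : 0 < opn x by rewrite lt_def x0 opn_ge0.
  by rewrite -(ler_pM2r xp) -expr2; apply: le_trans (opn_star_le _) (opnM _ _).
apply/le_anti; rewrite sle andbT; have := sle (unitz_star u).
by rewrite /unitz_star /= conjcK cstarK -surjective_pairing.
Qed.

Lemma opn_inj a : opn (0, a) = rn a.
Proof.
apply/le_anti/andP; split.
  apply: opn_le => [|b]; first exact: rn_ge0.
  by rewrite /unitz_act scale0r add0r; exact: rnM.
have [->|a0] := eqVneq (rn a) 0; first exact: opn_ge0.
have ap : 0 < rn a by rewrite lt_def a0 rn_ge0.
rewrite -opn_star (_ : unitz_star _ = (0, cstar a)); last by congr pair; exact: conjc0.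
rewrite -(ler_pM2r ap) -expr2 -rn_star.
by have := opn_act (0, cstar a) a; rewrite /unitz_act scale0r add0r.
Qed.

(* If [A] has a unit then [opn] vanishes on its difference with [unitz_one]. *)
Definition unitz_nm u : R := Num.max (normc u.1) (opn u).

Lemma unitz_nm_ge u : normc u.1 <= unitz_nm u /\ opn u <= unitz_nm u.
Proof. by rewrite /unitz_nm !le_max !lexx orbT. Qed.

Lemma unitz_starK : involutive unitz_star.
Proof. by move=> [z a]; rewrite /unitz_star /= conjcK cstarK. Qed.
Lemma unitz_starD : {morph unitz_star : u v / u + v}.
Proof. by move=> [z a] [w b]; rewrite /unitz_star /= rmorphD cstarD. Qed.
Lemma unitz_starZ z u : unitz_star (z *: u) = conjc z *: unitz_star u.
Proof. by case: u => w a; rewrite /unitz_star /= rmorphM cstarZ. Qed.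
Lemma unitz_starM u v : unitz_star (u * v) = unitz_star v * unitz_star u.
Proof.
case: u v => [z a] [w b]; rewrite /unitz_star /=; congr pair; first by rewrite mulrC rmorphM.
by rewrite /= !cstarD !cstarZ cstarM; congr (_ + _); rewrite addrC.
Qed.
Lemma unitz_nm0 u : unitz_nm u = 0 -> u = 0.
Proof.
have [h1 h2] := unitz_nm_ge u => h; rewrite h in h1 h2.
have z0 : u.1 = 0 by apply: eq0_normc; apply/le_anti; rewrite h1 normc_ge0.
case: u z0 {h h1} h2 => z a /= -> h2; congr pair; apply: rn0_eq0.
by apply/le_anti; rewrite rn_ge0 andbT -opn_inj.
Qed.
Lemma unitz_nmD u v : unitz_nm (u + v) <= unitz_nm u + unitz_nm v.
Proof.
have [h1 h2] := unitz_nm_ge u; have [h3 h4] := unitz_nm_ge v.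
rewrite /unitz_nm ge_max; apply/andP; split.
  by apply: le_trans (le_normcD _ _) _; exact: lerD.
by apply: le_trans (opnD _ _) _; exact: lerD.
Qed.
Lemma unitz_nmZ z u : unitz_nm (z *: u) = normc z * unitz_nm u.
Proof. by rewrite /unitz_nm opnZ /= normcM maxr_pMr// normc_ge0. Qed.
Lemma unitz_nmM u v : unitz_nm (u * v) <= unitz_nm u * unitz_nm v.
Proof.
have [h1 h2] := unitz_nm_ge u; have [h3 h4] := unitz_nm_ge v.
rewrite /unitz_nm ge_max; apply/andP; split.
  by rewrite normcM; apply: ler_pM; rewrite ?normc_ge0.
by apply: le_trans (opnM _ _) _; apply: ler_pM; rewrite ?opn_ge0.
Qed.
Lemma unitz_nm_star u : unitz_nm (unitz_star u * u) = unitz_nm u ^+ 2.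
Proof.
have E1 : opn (unitz_star u * u) = opn u ^+ 2.
  apply/le_anti; rewrite opn_star_le andbT; apply: le_trans (opnM _ _) _.
  by rewrite opn_star expr2.
rewrite /unitz_nm E1 /= normcM (_ : normc (conjc u.1) = normc u.1); last first.
  by case: u.1 => a b /=; rewrite sqrrN.
have h1 := normc_ge0 u.1; have h2 := opn_ge0 u.
rewrite -expr2 !maxEle ler_sqr ?nnegrE//.
by case: ifP.
Qed.

Lemma normc_parts (z : R[i]) : `|complex.Re z| <= normc z /\ `|complex.Im z| <= normc z /\
  normc z <= `|complex.Re z| + `|complex.Im z|.
Proof.
case: z => a b /=; split; first by rewrite -sqrtr_sqr ler_wsqrtr// lerDl sqr_ge0.
split; first by rewrite -sqrtr_sqr ler_wsqrtr// lerDr sqr_ge0.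
rewrite -[leRHS]ger0_norm ?addr_ge0// -sqrtr_sqr ler_wsqrtr//.
by rewrite sqrrD !real_normK ?num_real// addrAC lerDl mulrn_wge0 ?mulr_ge0.
Qed.

Lemma unitz_complete (u : nat -> unitz) :
  (forall e : R, 0 < e -> exists N, forall m n, (N <= m)%N -> (N <= n)%N ->
      unitz_nm (u m - u n) <= e) ->
  exists l, forall e : R, 0 < e -> exists N, forall n, (N <= n)%N -> unitz_nm (u n - l) <= e.
Proof.
move=> h.
have hR (f : R[i] -> R) : (forall z w : R[i], f (z - w) = f z - f w) -> (forall z, `|f z| <= normc z) ->
    exists l : R, forall e : R, 0 < e -> exists N, forall n, (N <= n)%N -> `|f (u n).1 - l| <= e.
  move=> fB fn; pose v n := f (u n).1.
  have cv : cvgn v.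
    apply/cauchy_cvgP/cauchy_exP => e e0; have [N hN] := h _ (divr_gt0 e0 (ltr0n R 2)).
    exists (v N), N => // n /= Nn; rewrite -ball_normE /= /v -fB.
    apply: le_lt_trans (fn _) _; have := hN _ _ (leqnn _) Nn.
    have [h1 _] := unitz_nm_ge (u N - u n); move: h1 => /=; lra.
  exists (limn v) => e e0; move/cvgrPdist_le: cv => /(_ _ e0)[N _ hN].
  by exists N => n /hN /=; rewrite distrC.
have [x hx] := hR (@complex.Re R) (fun z w : R[i] => raddfB _ z w) (fun z : R[i] => (normc_parts z).1).
have [y hy] := hR (@complex.Im R) (fun z w : R[i] => raddfB _ z w) (fun z : R[i] => (normc_parts z).2.1).
have [a ha] : exists a : A, forall e : R, 0 < e -> exists N, forall n, (N <= n)%N -> rn ((u n).2 - a) <= e.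
  apply: rn_complete => e e0; have [N hN] := h _ (divr_gt0 e0 (ltr0n R 2)).
  exists N => m n hm hn; have := hN _ _ hm hn; have [h1 h2] := unitz_nm_ge (u m - u n).
  rewrite -opn_inj (_ : (0, _) = (u m - u n) + (- (u m - u n).1) *: (1 : unitz)).
    have := opnD (u m - u n) (- (u m - u n).1 *: (1 : unitz)).
    rewrite opnZ normcN => h3.
    have o1 : opn 1 <= 1.
      by apply: opn_le => // b; rewrite /unitz_act /= scale1r cmul0l addr0 mul1r.
    have : normc (u m - u n).1 * opn 1 <= normc (u m - u n).1 * 1.
      by apply: ler_wpM2l; rewrite ?normc_ge0.
    lra.
  by congr pair; rewrite /= ?scaler0 ?addr0// /GRing.scale /= mulr1 subrr.
exists ((x +i* y)%C, a) => e e0; have e3 : 0 < e / 3 by rewrite divr_gt0.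
have [N1 h1] := hx _ e3; have [N2 h2] := hy _ e3; have [N3 h3] := ha _ e3.
exists (maxn N1 (maxn N2 N3)) => n; rewrite !geq_max => /and3P[/h1 g1 /h2 g2 /h3 g3].
have E : normc ((u n).1 - (x +i* y)%C) <= e / 3 + e / 3.
  have [_ [_ hz]] := normc_parts ((u n).1 - (x +i* y)%C); apply: le_trans hz _.
  by rewrite !raddfB /=; exact: lerD.
rewrite /unitz_nm ge_max; apply/andP; split; first by move: E => /=; lra.
apply: opn_le => [|b]; first exact: ltW.
apply: le_trans (unitz_act_bnd _ _) _; apply: ler_wpM2r; first exact: rn_ge0.
by move: E g3 => /=; lra.
Qed.

HB.instance Definition _ := isUnitalCStar.Build R unitz unitz_starK unitz_starD unitz_starZ
  unitz_starM unitz_nm0 unitz_nmD unitz_nmZ unitz_nmM unitz_nm_star unitz_complete.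

Definition inj a : unitz := (0, a).

End Unitization.

(** * Passage between a C*-algebra and its unitization *)

Section Bridge.
Variables (R : realType) (B : cstarAlgType R).
Implicit Types (a b c x y : B) (u v w : unitz B) (e d t : R).
Local Notation rn := (@rn R B).
Local Notation inj := (@inj R B).
Local Notation nm := (@unm R (unitz B)).

Lemma injD a b : inj (a + b) = inj a + inj b.
Proof. by rewrite /inj; congr pair; rewrite /= addr0. Qed.
Lemma injN a : inj (- a) = - inj a.
Proof. by rewrite /inj; congr pair; rewrite /= oppr0. Qed.
Lemma injB a b : inj (a - b) = inj a - inj b.
Proof. by rewrite injD injN. Qed.
Lemma inj0 : inj 0 = 0. Proof. by []. Qed.
Lemma injZ (z : R[i]) a : inj (z *: a) = z *: inj a.
Proof. by rewrite /inj; congr pair; rewrite /= scaler0. Qed.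
Lemma injM a b : inj (a ** b) = inj a * inj b.
Proof. by rewrite /inj; congr pair; rewrite /= ?mul0r// !scale0r !add0r. Qed.
Lemma inj_star a : inj (cstar a) = ust (inj a).
Proof. by congr pair; exact/esym/conjc0. Qed.
Lemma inj_inj : injective inj. Proof. by move=> a b []. Qed.
Lemma unm_inj a : nm (inj a) = rn a.
Proof.
have h : normc (inj a).1 = 0 by exact: normc0.
by rewrite -[LHS]/(Num.max (normc (inj a).1) (opn (inj a))) opn_inj h max_r// rn_ge0.
Qed.
Lemma inj_sum n (F : 'I_n -> B) : inj (\sum_i F i) = \sum_i inj (F i).
Proof. by apply: (big_morph _ injD). Qed.

Lemma fstD u v : (u + v).1 = u.1 + v.1. Proof. by []. Qed.
Lemma fstM u v : (u * v).1 = u.1 * v.1. Proof. by []. Qed.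
Lemma fst_nm u : normc u.1 <= nm u.
Proof. by have [] := unitz_nm_ge u. Qed.
Lemma fst_inj a : (inj a).1 = 0. Proof. by []. Qed.
Lemma fst0E u : u.1 = 0 -> u = inj u.2.
Proof. by case: u => z a /= ->. Qed.

Lemma cposB_positive a : positive a <-> cpos (inj a).
Proof.
split=> [[x ->]|/cposP[y [ysa ya _ _]]]; first by rewrite injM inj_star; exact: cpos_star.
have y0 : y.1 = 0.
  by have /eqP := congr1 fst ya; rewrite fstM fst_inj mulf_eq0 orbb => /eqP.
exists y.2; apply: inj_inj; rewrite injM inj_star -fst0E// ysa ya//.
Qed.

Lemma fst_cle u v : v.1 = 0 -> cle u v -> u.1 = 0.
Proof.
move=> v0 uv; apply: eq0_normc; apply/le_anti; rewrite normc_ge0 andbT.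
apply/ler_addgt0Pl => e /uv[w hw]; rewrite addr0; apply: le_trans hw.
apply: le_trans (fst_nm _); rewrite fstD !fstM v0 mulr0 mul0r add0r.
by rewrite -[(- u).1]/(- u.1) normcN.
Qed.

(** An approximating [w] from the unitization is replaced by [w g], where [g] is an approximate unit
    formed from [b]: it lies in [B] and [g b g] is close to [b]. *)
Lemma cuntz_leP a b : positive b -> cuntz_le a b <-> cle (inj a) (inj b).
Proof.
move=> /cposB_positive bpos; split.
  move=> [v /rn_cvgP h] e /h[N hN]; exists (inj (v N)).
  rewrite -inj_star -!injM -injB unm_inj; exact: hN.
move=> ab.
have H n : {v : B | rn (v ** b ** cstar v - a) <= n.+1%:R^-1}.
  apply: cid; set e := _^-1; have e0 : 0 < e by rewrite invr_gt0.
  have [w hw] := ab _ (nm_half e0); have w0 := unm_ge0 w.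
  have W0 : 0 < nm w * nm w + 1 by rewrite ltr_wpDl// mulr_ge0.
  pose d := e / 2 / (nm w * nm w + 1) / 2; have d0 : 0 < d by rewrite !divr_gt0.
  set g := fc (auf d) (inj b).
  have ha := auf_llip d0.
  have gsa : sa g by exact: fc_sa.
  have g0 : g.1 = 0.
    by rewrite /g fcM ?fc_id//; [exact: mul0r|exact: llip_id|exact: resf_llip].
  have wg0 : (w * g).1 = 0 by rewrite fstM g0 mulr0.
  exists (w * g).2; rewrite -unm_inj injB !injM inj_star -fst0E// ustM gsa.
  have -> : w * g * inj b * (g * ust w) = w * (g * inj b * g) * ust w by rewrite !mulrA.
  apply: le_trans (unm_tri (w * inj b * ust w) _ _) _; rewrite [leRHS]splitr; apply: lerD => //.
  rewrite -mulrBl -mulrBr; apply: le_trans (unmM3 _ _ _) _; rewrite unm_ust mulrAC.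
  apply: (@le_trans _ _ ((nm w * nm w + 1) * (2 * d))); last first.
    rewrite /d; set k := nm w * nm w + 1 in W0 *; rewrite le_eqVlt; apply/orP; left.
    by apply/eqP; field; exact: lt0r_neq0.
  apply: ler_pM; rewrite ?unm_ge0 ?mulr_ge0 ?lerDl//.
  have hm : llip (fun t => auf d t * t) by apply: llipM => //; exact: llip_id.
  have -> : g * inj b * g = fc (fun t => auf d t * t * auf d t) (inj b).
    by rewrite (fcM bpos hm ha) (fcM bpos ha (@llip_id R)) fc_id.
  rewrite -[X in _ - X](fc_id bpos); apply: fc_dist => //.
  - exact: llipM.
  - exact: llip_id.
  by move=> t /andP[t0 _]; exact: auf_sub2.
exists (fun n => sval (H n)); apply/rn_cvgP => e e0.
have [N hN] := invS_small e0; exists N => n /hN; exact: le_trans (svalP (H n)).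
Qed.

Lemma ev_sum (w : unitz B) (q : {poly R}) :
  ev w q = \sum_(i < size q) sc (unitz B) (q`_i) * w ^+ i.
Proof.
rewrite -{1}(coefK q) poly_def /ev !rmorph_sum /=; apply: eq_bigr => i _.
rewrite -/(ev w _) -mul_polyC evM evC; congr (_ * _).
elim: (nat_of_ord i) => [|k ih]; last by rewrite !exprS evM evX ih.
by rewrite !expr0 (_ : 1 = 1%:P)// evC sc1.
Qed.

Lemma inj_poly a (q : {poly R}) :
  inj (\sum_(i < size q) (q`_i)%:C *: cpowS a i) = ev (inj a) (q * 'X).
Proof.
have powE i : inj (cpowS a i) = inj a ^+ i.+1.
  by elim: i => [|i ih]; rewrite ?expr1// exprS -ih -injM.
rewrite inj_sum evM evX ev_sum mulr_suml; apply: eq_bigr => i _.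
by rewrite injZ powE -scE exprSr mulrA.
Qed.

Lemma inj_fcalc a f : positive a -> llip f -> f 0 = 0 -> inj (fcalc f a) = fc f (inj a).
Proof.
move=> /cposB_positive apos hf f0.
have rng t : (0 <= t <= nm (inj a)) = (0 <= t) && (t%:C <= `|a|).
  by rewrite unm_inj rnE lecR.
have to_fc c : is_fcalc f a c -> inj c = fc f (inj a).
  move=> [q [hq /rn_cvgP qc]]; apply/esym/fc_is => // e e0.
  have [N1 _ h1] := hq _ e0; have [N2 h2] := qc _ e0.
  exists (q (maxn N1 N2) * 'X).
    move=> s; rewrite rng => /andP[s0 sa]; have := h1 _ (leq_maxl N1 N2) s s0 sa.
    by rewrite hornerMX mulrC => /ltW.
  by rewrite -inj_poly -injB unm_inj; apply: h2; exact: leq_maxr.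
suff [c hc] : exists c, is_fcalc f a c by apply/to_fc/(@getPex _ (is_fcalc f a)); exists c.
have H n : {q : {poly R} | (forall s, 0 <= s <= nm (inj a) -> `|(q * 'X).[s] - f s| <= n.+1%:R^-1)
   /\ nm (ev (inj a) (q * 'X) - fc f (inj a)) <= n.+1%:R^-1}.
  apply: cid; set e := _^-1; have e0 : 0 < e by rewrite invr_gt0.
  have [p hp] := llip_approx hf (nm (inj a)) (nm_half e0).
  have p0 : `|p.[0]| <= e / 2.
    by have := hp 0; rewrite f0 subr0 lexx unm_ge0 => /(_ isT).
  have [q pq] : exists q : {poly R}, p - (p.[0])%:P = q * 'X.
    have /factor_theorem[q qE] : root (p - (p.[0])%:P) 0.
      by apply/rootP; rewrite !hornerE subrr.
    by exists q; rewrite qE subr0.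
  have close s : 0 <= s <= nm (inj a) -> `|(q * 'X).[s] - f s| <= e.
    move=> /hp; rewrite -pq hornerD hornerN hornerC; move: p0.
    by rewrite !ler_norml => /andP[? ?] /andP[? ?]; apply/andP; split; lra.
  exists q; split => //; apply: is_fc_norm (is_fc_ev _ _) (fcP apos hf) close; exact: apos.
have small := @invS_small R.
have c0 : (fc f (inj a)).1 = 0.
  apply: eq0_normc; apply/le_anti; rewrite normc_ge0 andbT; apply/ler_addgt0Pl => e e0.
  have [N /(_ N (leqnn _)) hN] := small _ e0; rewrite addr0; apply: le_trans hN.
  apply: le_trans (svalP (H N)).2; rewrite unm_distC; apply: le_trans (fst_nm _).
  by rewrite evM evX -[(_ - _).1]/(_ - _ * _) mulr0 subr0.
exists (fc f (inj a)).2, (fun n => sval (H n)); split.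
  move=> d d0; have [N hN] := small _ (nm_half d0); exists N => // n /= /hN h t t0 ta.
  have ht : 0 <= t <= nm (inj a) by rewrite rng t0.
  have := (svalP (H n)).1 _ ht; rewrite hornerMX mulrC => h2.
  by apply: le_lt_trans (le_trans h2 h) _; lra.
apply/rn_cvgP => e e0; have [N hN] := small _ e0; exists N => n /hN h.
apply: le_trans h; rewrite -unm_inj injB inj_poly -fst0E//.
exact: (svalP (H n)).2.
Qed.

Lemma closureP (S : set B) r :
  closure S r <-> forall e, 0 < e -> exists2 x, S x & rn (x - r) <= e.
Proof.
split=> [h e e0|h C].
  have [|x [Sx]] := h (ball r e%:C); first by apply: nbhsx_ballx; rewrite ltcR.
  rewrite -ball_normE /= => xr; exists x => //.
  by rewrite -lecR -rnE distrC ltW.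
move=> /nbhs_ballP[e /= e0 eC]; have er : e = (complex.Re e)%:C by rewrite RRe_real// gtr0_real.
have e1 : 0 < complex.Re e by rewrite -ltcR -er.
have [x Sx xr] := h _ (nm_half e1); exists x; split => //; apply: eC.
rewrite -ball_normE /= distrC er rnE ltcR; apply: le_lt_trans xr _; lra.
Qed.

Lemma hereditaryP a r : hereditary a r <->
  forall e, 0 < e -> exists x, rn (a ** x ** a - r) <= e.
Proof.
split=> [/closureP h e /h[_ [x ->]]|h]; first by exists x.
by apply/closureP => e /h[x hx]; exists (a ** x ** a) => //; exists x.
Qed.

Lemma inj_cutdown a e : positive a -> 0 <= e -> inj (cutdown a e) = cut e (inj a).
Proof. by move=> apos e0; apply: inj_fcalc => //; [exact: cut_llip|exact: cut0]. Qed.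

Lemma cutdown_pos a e : positive a -> 0 <= e -> positive (cutdown a e).
Proof.
move=> apos e0; apply/cposB_positive; rewrite inj_cutdown//.
exact/cut_pos/cposB_positive.
Qed.

Definition ceq a b := cle (inj a) (inj b) /\ cle (inj b) (inj a).

Lemma cuntz_eqP a b : positive a -> positive b -> cuntz_eq a b <-> ceq a b.
Proof.
by move=> apos bpos; split=> -[h1 h2]; split; apply/cuntz_leP.
Qed.

Lemma ceq_refl a : positive a -> ceq a a.
Proof. by move=> /cposB_positive apos; split; exact: cle_refl. Qed.

Lemma ceq_sym a b : ceq a b -> ceq b a. Proof. by case. Qed.

Lemma ceq_trans b a c : ceq a b -> ceq b c -> ceq a c.
Proof. by move=> [h1 h2] [h3 h4]; split; [exact: cle_trans h1 h3|exact: cle_trans h4 h2]. Qed.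

Lemma cu_is_pos (x : Cu B) a : cu_is x a -> positive a. Proof. by case. Qed.

Lemma cu_repr (x : Cu B) : exists a, cu_is x a.
Proof. by case: x => s [a [apos sE]]; exists a. Qed.

Lemma cu_is_ceq (x : Cu B) a b : cu_is x a -> positive b -> ceq a b -> cu_is x b.
Proof.
move=> [apos xa] bpos ab; split => //; rewrite xa; apply/seteqP; split=> c [cpos_ ca];
  split => //; apply/(cuntz_eqP cpos_) => //; move/(cuntz_eqP cpos_): ca => ca.
  exact: ceq_trans (ca apos) ab.
exact: ceq_trans (ca bpos) (ceq_sym ab).
Qed.

Lemma cu_is_uniq (x : Cu B) a b : cu_is x a -> cu_is x b -> ceq a b.
Proof.
move=> [apos xa] [bpos xb]; apply/(cuntz_eqP apos bpos).
have : cu_set x a by rewrite xa; split => //; apply/cuntz_eqP => //; exact: ceq_refl.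
by rewrite xb => -[].
Qed.

Lemma cu_is_inj (x y : Cu B) a : cu_is x a -> cu_is y a -> x = y.
Proof.
case: x => s sP; case: y => t tP [_ /= h1] [_ /= h2].
by move: sP tP; rewrite h1 h2 => sP tP; congr MkCu; exact: Prop_irrelevance.
Qed.

Definition cu_of a (apos : positive a) : Cu B :=
  MkCu (ex_intro _ a (conj apos erefl)).

Lemma cu_of_is a (apos : positive a) : cu_is (cu_of apos) a.
Proof. by []. Qed.

Lemma cu_ofP a : positive a -> exists x : Cu B, cu_is x a.
Proof. by move=> apos; exists (cu_of apos). Qed.

Lemma cu_leP (x y : Cu B) a b : cu_is x a -> cu_is y b ->
  cu_le x y <-> cle (inj a) (inj b).
Proof.
move=> xa yb; split=> [[a' [b' [xa' yb' /(cuntz_leP _ (cu_is_pos yb')) h]]]|h].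
  have [h1 _] := cu_is_uniq xa xa'; have [_ h2] := cu_is_uniq yb yb'.
  exact: cle_trans h1 (cle_trans h h2).
by exists a, b; split => //; apply/cuntz_leP => //; exact: cu_is_pos yb.
Qed.

Lemma cu_wbP (x y : Cu B) a b : cu_is x a -> cu_is y b ->
  cu_wb x y <-> cwb (inj a) (inj b).
Proof.
move=> xa yb; have bpos := cu_is_pos yb; split.
  move=> [a' [b' [xa' yb' [e e0]]]]; have b'pos := cu_is_pos yb'.
  move=> /(cuntz_leP _ (cutdown_pos b'pos (ltW e0))); rewrite inj_cutdown// ?ltW// => h.
  have [h1 _] := cu_is_uniq xa xa'; have [_ h2] := cu_is_uniq yb yb'.
  apply: cwb_le_trans h1 _; apply: (@cwb_trans_le _ _ _ (inj b')) => //.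
  - exact/cposB_positive.
  - exact/cposB_positive.
  - by exists e.
move=> [e e0 h]; exists a, b; split => //; exists e => //.
apply/cuntz_leP; first by apply: cutdown_pos => //; exact: ltW.
by rewrite inj_cutdown// ltW.
Qed.
End Bridge.

(** * The Cuntz semigroup as an ordered monoid *)

Section CuMonoid.
Variables (R : realType) (B : cstarAlgType R).
Implicit Types (a b c x y : B) (u v w : unitz B) (e d t s : R) (X Y Z : Cu B).
Local Notation rn := (@rn R B).
Local Notation inj := (@inj R B).
Local Notation nm := (@unm R (unitz B)).

Lemma diag2_conj (v : 'M[B]_2) a b (i j : 'I_2) :
  \sum_(l < 2) \sum_(p < 2) v i l ** diag2 a b l p ** cstar (v j p) =
  v i 0 ** a ** cstar (v j 0) + v i 1 ** b ** cstar (v j 1).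
Proof.
have l1 : lift ord0 ord0 = 1 :> 'I_2 by apply/val_inj.
rewrite !big_ord_recl !big_ord0 !addr0 l1 !mxE /=.
by rewrite !(cmul0r, cmul0l) addr0 add0r.
Qed.

Lemma positiveD a b : positive a -> positive b -> positive (a + b).
Proof.
by move=> /cposB_positive ha /cposB_positive hb; apply/cposB_positive; rewrite injD; exact: cposD.
Qed.

Lemma auf_conv a : positive a -> exists g : nat -> B,
  [/\ forall n, cstar (g n) = g n,
      forall n b, inj a * inj b = 0 -> g n ** b = 0 &
      (fun n => g n ** a ** g n) @ \oo --> a].
Proof.
move=> /cposB_positive apos.
pose ee n : R := n.+1%:R^-1.
have ee0 n : 0 < ee n by rewrite invr_gt0.
pose G n := fc (auf (ee n)) (inj a).
have Ga n : G n = inj a * fc (resf (ee n)) (inj a).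
  by rewrite /G fcM ?fc_id//; [exact: llip_id|exact: resf_llip].
have Gsa n : sa (G n) by apply: fc_sa => //; exact: auf_llip.
have G0 n : (G n).1 = 0 by rewrite Ga fstM mul0r.
have GE n : G n = inj (G n).2 by exact: fst0E.
exists (fun n => (G n).2); split=> [n|n b ab|].
- by apply: (@inj_inj _ B); rewrite inj_star -GE Gsa.
- apply: (@inj_inj _ B); rewrite injM -GE Ga fc_comm//; last exact: resf_llip.
  by rewrite -mulrA ab mulr0.
apply/rn_cvgP => e e0; exists (Num.truncn (2 / e)) => n Nn.
rewrite -unm_inj injB !injM -GE.
have ha := auf_llip (ee0 n); have hm : llip (fun t => auf (ee n) t * t).
  by apply: llipM => //; exact: llip_id.
have -> : G n * inj a * G n = fc (fun t => auf (ee n) t * t * auf (ee n) t) (inj a).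
  by rewrite (fcM apos hm ha) (fcM apos ha (@llip_id R)) fc_id.
rewrite -[X in _ - X](fc_id apos).
apply: (@le_trans _ _ (2 * ee n)).
  apply: fc_dist => //; [exact: llipM|exact: llip_id|].
  by move=> t /andP[t0 _]; exact: auf_sub2.
rewrite /ee ler_pdivrMr ?ltr0n// mulrC -ler_pdivrMr//; apply: ltW.
by apply: lt_le_trans (truncnS_gt _) _; rewrite ler_nat.
Qed.


Lemma cstar0 : cstar (0 : B) = 0.
Proof. by apply: (addrI (cstar 0)); rewrite -cstarD !addr0. Qed.

Lemma cstar_pos a : positive a -> cstar a = a.
Proof. by move=> [x ->]; rewrite cstarM cstarK. Qed.

(** With approximate units [g n] of [a] and [h n] of [b], the matrices with first row [g n], [h n]
    carry [diag2 a b] to [diag2 (a + b) 0] in the limit, and those with first column [g n], [h n]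
    carry it back; the mixed terms vanish by orthogonality. *)
Lemma mx_orth_eq a b : positive a -> positive b -> inj a * inj b = 0 ->
  mx_cuntz_eq (diag2 (a + b) 0) (diag2 a b).
Proof.
move=> apos bpos ab.
have ba : inj b * inj a = 0.
  by apply: orthC => //; apply: cpos_sa; exact/cposB_positive.
have [g [gs gb gc]] := auf_conv apos; have [h [hs ha hc]] := auf_conv bpos.
have bg n : b ** g n = 0.
  by apply: (can_inj (@cstarK _ B)); rewrite cstarM gs cstar0 cstar_pos//; exact: gb.
split.
  exists (fun n => \matrix_(i, j) if i == 0 then (if j == 0 then g n else h n) else 0) => i j.
  under eq_fun do rewrite diag2_conj !mxE /=.
  rewrite mxE; case: (eqVneq i 0) => i0; case: (eqVneq j 0) => j0.
  - by rewrite i0 j0 eqxx; under eq_fun do rewrite gs hs; exact: cvgD.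
  - rewrite i0 eq_sym (negbTE j0); under eq_fun do rewrite cstar0 !cmul0r addr0; exact: cvg_cst.
  - rewrite j0 (negbTE i0); under eq_fun do rewrite !cmul0l addr0; exact: cvg_cst.
  - under eq_fun do rewrite !cmul0l addr0.
    by case: ifP => _; exact: cvg_cst.
exists (fun n => \matrix_(i, j) if j == 0 then (if i == 0 then g n else h n) else 0) => i j.
under eq_fun do rewrite diag2_conj !mxE /= cmul0l cmul0l addr0 cmulDr.
have ga (n x : nat) : g n ** a ** cstar (h x) = 0.
  rewrite hs -cmulA (_ : a ** h x = 0) ?cmul0r//; apply: (can_inj (@cstarK _ B)).
  by rewrite cstarM hs cstar0 cstar_pos//; exact: ha.
rewrite mxE; case: (eqVneq i 0) => i0; case: (eqVneq j 0) => j0.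
- rewrite i0 j0 eqxx; under eq_fun do rewrite gs (gb _ b)// addr0; exact: gc.
- rewrite i0 eq_sym (negbTE j0); under eq_fun do rewrite (gb _ b)// addr0 ga; exact: cvg_cst.
- rewrite j0 (negbTE i0); under eq_fun do rewrite (ha _ a)// add0r gs -cmulA bg cmul0r; exact: cvg_cst.
- have -> : (i == j) = true by case: i i0 => [[|[|]]]// ? _; case: j j0 => [[|[|]]].
  by under eq_fun do rewrite (ha _ a)// add0r hs; exact: hc.
Qed.

Lemma cuM_sa a : positive a -> sa (inj a).
Proof. by move=> /cposB_positive/cpos_sa. Qed.

(** Only the upper left entry is read off: it exhibits [c] as a limit of sums of a conjugate of [a']
    and one of [b'], which [cle_add] places below the orthogonal sum. *)
Lemma mx_le_diag c a b : positive a -> positive b -> positive c -> forall a' b',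
  ceq a' a -> ceq b' b -> positive a' -> positive b' ->
  mx_cuntz_le (diag2 c 0) (diag2 a' b') -> inj a * inj b = 0 -> cle (inj c) (inj (a + b)).
Proof.
move=> /cposB_positive apos /cposB_positive bpos /cposB_positive cpos_c a' b' [a'a _] [b'b _].
move=> /cposB_positive a'pos /cposB_positive b'pos [v hv] ab.
apply: cle_closed => e e0; have := hv 0 0; under eq_fun do rewrite diag2_conj.
rewrite mxE eqxx => /rn_cvgP/(_ _ e0)[N /(_ N (leqnn _)) hN].
exists (inj (v N 0 0 ** a' ** cstar (v N 0 0) + v N 0 1 ** b' ** cstar (v N 0 1))).
  rewrite !injD !injM !inj_star; apply: cle_add => //; try exact: cpos_conj'.
    by apply: cle_trans a'a; exact: cle_conj.
  by apply: cle_trans b'b; exact: cle_conj.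
by rewrite -injB unm_inj.
Qed.

Lemma conj_split (V : zmodType) (x11 x12 x21 x22 p q s t : V) :
  x11 + x12 + (x21 + x22) - (s + t) =
  x11 - p + x12 + (x21 + (x22 - q)) + (p - s + (q - t)).
Proof.
by rewrite (addrAC x11 (- p)) (addrA x21) (addrACA (x11 + x12) (- p)) (addrACA p) -!opprD [RHS]addrA subrK.
Qed.

Lemma sq_sum4 s t d (p q r z : R) : p <= s * s * d -> q <= s * t * d -> r <= t * s * d ->
  z <= t * t * d -> p + q + (r + z) <= (s + t) ^+ 2 * d.
Proof. by rewrite expr2 mulrDl !mulrDr !mulrDl (mulrC t s); lra. Qed.

(** If [s] and [t] carry [a'] and [b'] close to [a] and [b], and [x], [y] is the first column of
    [v n], then conjugating [c] by [s x + t y] approximates [a + b]. The cross terms are small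
    because the off-diagonal entries of [diag2 a' b'] are 0; [K] accounts for the norms of [s] and
    [t]. *)
Lemma mx_diag_le c a b a' b' : positive a -> positive b -> positive c ->
  ceq a a' -> ceq b b' -> mx_cuntz_le (diag2 a' b') (diag2 c 0) -> cle (inj (a + b)) (inj c).
Proof.
move=> apos bpos cpos_c [aa' _] [bb' _] [v hv] e e0.
have e4 : 0 < e / 4 by rewrite divr_gt0.
have [s hs] := aa' _ (nm_half (nm_half e0)); have [t ht] := bb' _ (nm_half (nm_half e0)).
pose K := (nm s + nm t) ^+ 2 + 1; have s0 := unm_ge0 s; have t0 := unm_ge0 t.
have K0 : 0 < K by rewrite ltr_wpDl// sqr_ge0.
have d0 : 0 < e / 2 / K by rewrite !divr_gt0.
have ent i j : exists N, forall n, (N <= n)%N ->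
    rn (v n i 0 ** c ** cstar (v n j 0) - diag2 a' b' i j) <= e / 2 / K.
  have := hv i j; under eq_fun do rewrite diag2_conj cmul0r cmul0l addr0.
  by move=> /rn_cvgP/(_ _ d0).
have [N00 h00] := ent 0 0; have [N01 h01] := ent 0 1; have [N10 h10] := ent 1 0.
have [N11 h11] := ent 1 1.
pose N := maxn (maxn N00 N01) (maxn N10 N11).
have := h00 N; have := h01 N; have := h10 N; have := h11 N.
rewrite !leq_max !leqnn !orbT /= => /(_ isT) {}h11 /(_ isT) {}h10 /(_ isT) {}h01 /(_ isT) {}h00.
move: h11 h10 h01 h00; rewrite -!unm_inj !injB !injM !inj_star !mxE /= !inj0 !subr0.
set x := inj (v N 0 0); set y := inj (v N 1 0) => h11 h10 h01 h00.
exists (s * x + t * y); set C := inj c in h11 h10 h01 h00 *.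
have -> : (s * x + t * y) * C * ust (s * x + t * y) - inj (a + b) =
  (s * (x * C * ust x - inj a') * ust s + s * (x * C * ust y) * ust t +
  (t * (y * C * ust x) * ust s + t * (y * C * ust y - inj b') * ust t)) +
  ((s * inj a' * ust s - inj a) + (t * inj b' * ust t - inj b)).
  rewrite ustD !ustM injD !mulrDl !mulrDr !mulrDl !mulrN !mulNr !mulrA.
  exact: conj_split.
have M3 p z q : nm z <= e / 2 / K -> nm (p * z * ust q) <= nm p * nm q * (e / 2 / K).
  move=> hz; apply: le_trans (unmM3 _ _ _) _; rewrite unm_ust mulrAC.
  by apply: ler_wpM2l => //; rewrite mulr_ge0 ?unm_ge0.
apply: le_trans (unmD _ _) _.
have h1 := M3 s _ s h00; have h2 := M3 s _ t h01; have h3 := M3 t _ s h10; have h4 := M3 t _ t h11.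
apply: (@le_trans _ _ (e / 2 + e / 2)); last by rewrite -splitr.
apply: lerD; last first.
  by apply: le_trans (unmD _ _) _; rewrite [leRHS]splitr; exact: lerD.
apply: (@le_trans _ _ ((nm s + nm t) ^+ 2 * (e / 2 / K))); last first.
  by rewrite -[leRHS](divfK (lt0r_neq0 K0)) mulrC; apply: ler_wpM2l; rewrite ?(ltW d0)// lerDl.
apply: le_trans (unmD _ _) _.
apply: le_trans (lerD (unmD _ _) (unmD _ _)) _.
exact: sq_sum4.
Qed.

(** [cu_add] is a choice made by [get]. The orthogonal sum shows that there is something to choose,
    and the two comparisons with diagonal matrices show that every choice has the class of
    [a + b]. *)
Lemma cu_addP X Y a b : cu_is X a -> cu_is Y b -> inj a * inj b = 0 ->
  cu_is (cu_add X Y) (a + b).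
Proof.
move=> Xa Yb ab; have apos := cu_is_pos Xa; have bpos := cu_is_pos Yb.
have abpos := positiveD apos bpos.
have : exists z, [set z | exists a b c, [/\ cu_is X a, cu_is Y b, cu_is z c &
    mx_cuntz_eq (diag2 c 0) (diag2 a b)]] z.
  exists (cu_of abpos), a, b, (a + b); split => //; exact: mx_orth_eq.
move=> /getPex; rewrite -/(cu_add X Y) => -[a' [b' [c [Xa' Yb' Zc [h1 h2]]]]].
have aa' := cu_is_uniq Xa Xa'; have bb' := cu_is_uniq Yb Yb'.
have cpos_c := cu_is_pos Zc.
apply: (cu_is_ceq Zc) => //; split.
  apply: mx_le_diag h1 ab => //; try exact: ceq_sym; [exact: cu_is_pos Xa'|exact: cu_is_pos Yb'].
exact: mx_diag_le h2.
Qed.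

Lemma cu0_is : cu_is (cu0 B) 0. Proof. by split => //; exact: positive0. Qed.

(** * Orthogonal representatives and the monoid of Cuntz classes *)

Section Orth.
(** [S1] and [S2] stand for left multiplication by two isometries of the multiplier algebra with
    orthogonal ranges, expressed by their inner product relations inside [B]. *)
Variables S1 S2 : B -> B.
Hypotheses (S1E : forall x y, cstar (S1 x) ** S1 y = cstar x ** y)
  (S2E : forall x y, cstar (S2 x) ** S2 y = cstar x ** y)
  (S12 : forall x y, cstar (S1 x) ** S2 y = 0).

Let Tr x := x ** cstar x.

Lemma cu_is_mulstar X z x : cu_is X (cstar x ** x) -> cstar z ** z = cstar x ** x -> cu_is X (Tr z).
Proof.
move=> Xx zx; apply: (cu_is_ceq Xx); first by exists (cstar z); rewrite cstarK.
rewrite -zx; split; rewrite !injM !inj_star; [exact: cle_starC|exact: cle_starC'].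
Qed.

Lemma orth_Tr x y : cstar x ** y = 0 -> inj (Tr x) * inj (Tr y) = 0.
Proof. by move=> h; rewrite -injM /Tr -cmulA (cmulA (cstar x)) h cmul0l cmul0r. Qed.

Lemma cu_repr2 X : exists x, cu_is X (cstar x ** x).
Proof. by have [a Xa] := cu_repr X; have [x ax] := cu_is_pos Xa; exists x; rewrite -ax. Qed.

Lemma cu_orth2 X Y : exists p q, [/\ cu_is X p, cu_is Y q & inj p * inj q = 0].
Proof.
have [x Xx] := cu_repr2 X; have [y Yy] := cu_repr2 Y; exists (Tr (S1 x)), (Tr (S2 y)); split.
- exact: cu_is_mulstar Xx (S1E _ _).
- exact: cu_is_mulstar Yy (S2E _ _).
- exact: orth_Tr.
Qed.

Lemma cu_orth3 X Y Z : exists p q r, [/\ cu_is X p, cu_is Y q & cu_is Z r] /\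
  [/\ inj p * inj q = 0, inj p * inj r = 0 & inj q * inj r = 0].
Proof.
have [x Xx] := cu_repr2 X; have [y Yy] := cu_repr2 Y; have [z Zz] := cu_repr2 Z.
exists (Tr (S1 x)), (Tr (S2 (S1 y))), (Tr (S2 (S2 z))); split; split.
- exact: cu_is_mulstar Xx (S1E _ _).
- by apply: cu_is_mulstar Yy _; rewrite S2E S1E.
- by apply: cu_is_mulstar Zz _; rewrite !S2E.
- exact: orth_Tr.
- exact: orth_Tr.
- by apply: orth_Tr; rewrite S2E.
Qed.

Lemma cu_addA : associative (@cu_add R B).
Proof.
move=> X Y Z; have [p [q [r [[Xp Yq Zr] [pq pr qr]]]]] := cu_orth3 X Y Z.
have h1 : cu_is (cu_add X (cu_add Y Z)) (p + (q + r)).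
  by apply: cu_addP => //; [exact: cu_addP|rewrite injD mulrDr pq pr addr0].
have h2 : cu_is (cu_add (cu_add X Y) Z) (p + q + r).
  by apply: cu_addP => //; [exact: cu_addP|rewrite injD mulrDl qr pr addr0].
by apply: (cu_is_inj h1); rewrite addrA.
Qed.

Lemma cu_addC : commutative (@cu_add R B).
Proof.
move=> X Y; have [p [q [Xp Yq pq]]] := cu_orth2 X Y.
have qp : inj q * inj p = 0.
  by apply: orthC => //; [exact: cuM_sa (cu_is_pos Xp)|exact: cuM_sa (cu_is_pos Yq)].
by apply: (cu_is_inj (cu_addP Xp Yq pq)); rewrite addrC; exact: cu_addP.
Qed.

Lemma cu_add0 : left_id (cu0 B) (@cu_add R B).
Proof.
move=> X; have [a Xa] := cu_repr X.
have := cu_addP cu0_is Xa; rewrite add0r inj0 mul0r => /(_ erefl) h.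
exact: cu_is_inj h Xa.
Qed.

Definition cuN : nmodType :=
  HB.pack (Cu B) (GRing.isNmodule.Build (Cu B) cu_addA cu_addC cu_add0).

Lemma cuN_muln n (X : cuN) : cu_muln n X = X *+ n.
Proof. by elim: n => [|n ih] //; rewrite mulrS -ih. Qed.

Lemma cuN_sum n (Y : 'I_n -> cuN) : cu_sum Y = \sum_j Y j.
Proof. by []. Qed.

Lemma cu_of_cle u b : cpos u -> cle u (inj b) -> exists Z, exists2 c, cu_is Z c & inj c = u.
Proof.
move=> upos ub; have u0 : u.1 = 0 by apply: fst_cle ub.
have uE := fst0E u0; have cpos_c : positive u.2 by apply/cposB_positive; rewrite -uE.
by exists (cu_of cpos_c), u.2.
Qed.

Lemma cu_le_addP X Y W a b r u w : cu_is X a -> cu_is Y b -> cu_is W r ->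
  cpos u -> cpos w -> cle (inj r) (u + w) -> cle u (inj a) -> cle w (inj b) ->
  cu_le W (cu_add X Y).
Proof.
move=> Xa Yb Wr upos wpos rr ua wb; have [p [q [Xp Yq pq]]] := cu_orth2 X Y.
have ppos := cu_is_pos Xp; have qpos := cu_is_pos Yq.
apply/(cu_leP Wr (cu_addP Xp Yq pq)); apply: cle_trans rr _; rewrite injD; apply: cle_add => //.
- exact/cposB_positive.
- exact/cposB_positive.
- exact: cle_trans ua (cu_is_uniq Xa Xp).1.
- exact: cle_trans wb (cu_is_uniq Yb Yq).1.
Qed.

Lemma cuN_axioms : cu_axioms (S := cuN) (@cu_le R B) (@cu_wb R B).
Proof.
have pos X a : cu_is X a -> cpos (inj a) by move=> /cu_is_pos/cposB_positive.
have cutis X a e : cu_is X a -> 0 < e -> exists2 Z, cu_is Z (cutdown a e) & cu_wb Z X.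
  move=> Xa e0; have cp := cutdown_pos (cu_is_pos Xa) (ltW e0); exists (cu_of cp) => //.
  apply/(cu_wbP (cu_of_is cp) Xa); rewrite inj_cutdown ?(ltW e0)//; last exact: cu_is_pos Xa.
  by apply: cwb_cut => //; exact: pos Xa.
have leD X Y Z T : cu_le X Y -> cu_le Z T -> cu_le (cu_add X Z) (cu_add Y T).
  have [p [q [Xp Zq pq]]] := cu_orth2 X Z; have [a [b [Ya Tb ab]]] := cu_orth2 Y T.
  move=> /(cu_leP Xp Ya) h1 /(cu_leP Zq Tb) h2.
  apply/(cu_leP (cu_addP Xp Zq pq) (cu_addP Ya Tb ab)); rewrite !injD.
  by apply: cle_add => //; [exact: pos Xp|exact: pos Zq|exact: pos Ya|exact: pos Tb].
have trans X Y Z : cu_le X Y -> cu_le Y Z -> cu_le X Z.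
  have [a Xa] := cu_repr X; have [b Yb] := cu_repr Y; have [c Zc] := cu_repr Z.
  move=> /(cu_leP Xa Yb) h1 /(cu_leP Yb Zc) h2; apply/(cu_leP Xa Zc); exact: cle_trans h1 h2.
split; rewrite ?/GRing.add /=.
- by move=> X; have [a Xa] := cu_repr X; apply/(cu_leP Xa Xa)/cle_refl/(pos _ _ Xa).
- exact: trans.
- move=> X; have [a Xa] := cu_repr X; apply/(cu_leP cu0_is Xa) => e e0; exists 0.
  by rewrite inj0 !mul0r subr0 unm0 ltW.
- exact: leD.
- move=> X Y; have [a Xa] := cu_repr X; have [b Yb] := cu_repr Y.
  by move=> /(cu_wbP Xa Yb) h; apply/(cu_leP Xa Yb); apply: cwb_cle h; exact: pos Yb.
- move=> X Y Z; have [a Xa] := cu_repr X; have [b Yb] := cu_repr Y; have [c Zc] := cu_repr Z.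
  move=> /(cu_leP Xa Yb) h1 /(cu_wbP Yb Zc) h2; apply/(cu_wbP Xa Zc); exact: cwb_le_trans h1 h2.
- move=> X Y Z; have [a Xa] := cu_repr X; have [b Yb] := cu_repr Y; have [c Zc] := cu_repr Z.
  move=> /(cu_wbP Xa Yb) h1 /(cu_leP Yb Zc) h2; apply/(cu_wbP Xa Zc).
  by apply: cwb_trans_le h1 h2; [exact: pos Yb|exact: pos Zc].
- move=> X; have [a Xa] := cu_repr X; apply/(cu_wbP cu0_is Xa); exists 1 => // e e0; exists 0.
  by rewrite inj0 !mul0r subr0 unm0 ltW.
- move=> X Y; have [a Xa] := cu_repr X; have [b Yb] := cu_repr Y.
  move=> /(cu_wbP Xa Yb)/cwb_interp; move=> /(_ (pos _ _ Yb))[e e0 h].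
  have [Z Zc ZY] := cutis _ _ _ Yb e0; exists Z => //; apply/(cu_wbP Xa Zc).
  by rewrite inj_cutdown ?(ltW e0)//; exact: cu_is_pos Yb.
- move=> X Y Z; have [a Xa] := cu_repr X; have [b Yb] := cu_repr Y; have [c Zc] := cu_repr Z.
  move=> /(cu_wbP Xa Zc)[e e0 h1] /(cu_wbP Yb Zc)[d d0 h2].
  have m0 : 0 < Num.min e d by rewrite lt_min e0.
  have [W Ww WZ] := cutis _ _ _ Zc m0; have cp := cu_is_pos Zc; have c'p := pos _ _ Zc.
  exists W; split => //; [apply/(cu_leP Xa Ww)|apply/(cu_leP Yb Ww)]; rewrite inj_cutdown ?(ltW m0)//.
    by apply: cle_trans h1 _; apply: cut_cle2 => //; rewrite ge_min lexx.
  by apply: cle_trans h2 _; apply: cut_cle2 => //; rewrite ge_min lexx orbT.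
- move=> X Y Z T; have [p [q [Xp Zq pq]]] := cu_orth2 X Z; have [a [b [Ya Tb ab]]] := cu_orth2 Y T.
  move=> /(cu_wbP Xp Ya) h1 /(cu_wbP Zq Tb) h2.
  apply/(cu_wbP (cu_addP Xp Zq pq) (cu_addP Ya Tb ab)); rewrite !injD.
  by apply: cwb_add => //; [exact: pos Xp|exact: pos Zq|exact: pos Ya|exact: pos Tb].
- move=> X Y Z; have [r Xr] := cu_repr X; have [a [b [Ya Zb ab]]] := cu_orth2 Y Z.
  move=> /(cu_wbP Xr (cu_addP Ya Zb ab)); rewrite injD => /(cwb_split (pos _ _ Ya) (pos _ _ Zb) ab).
  move=> [e e0 h]; have [Y' Yc YY] := cutis _ _ _ Ya e0; have [Z' Zc ZZ] := cutis _ _ _ Zb e0.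
  exists Y', Z'; split => //; have e00 := ltW e0.
  have ap := cu_is_pos Ya; have bp := cu_is_pos Zb.
  rewrite -!inj_cutdown// in h.
  have [yp zp] := (pos _ _ Yc, pos _ _ Zc).
  exact: (cu_le_addP Yc Zc Xr yp zp h (cle_refl yp) (cle_refl zp)).
- move=> X Y h; have [a Xa] := cu_repr X; have [b Yb] := cu_repr Y; apply/(cu_leP Xa Yb).
  apply: cle_cut_closed => [|e e0]; first exact: pos Xa.
  have [Z Zc /h] := cutis _ _ _ Xa e0; move=> /(cu_leP Zc Yb); rewrite inj_cutdown ?(ltW e0)//.
  exact: cu_is_pos Xa.
- move=> X' X Z' Z Y; have [a [z [Xa Zz az]]] := cu_orth2 X Z.
  have [b Yb] := cu_repr Y; have [a' Xa'] := cu_repr X'; have [z' Zz'] := cu_repr Z'.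
  move=> /(cu_wbP Xa' Xa)[e1 e10 h1] /(cu_wbP Zz' Zz)[e2 e20 h2].
  move=> /(cu_leP (cu_addP Xa Zz az) Yb); rewrite injD => h.
  have m0 : 0 < Num.min e1 e2 by rewrite lt_min e10.
  have ap := pos _ _ Xa; have zp := pos _ _ Zz; have bp := pos _ _ Yb.
  have [p [c [u [[ppos cpos_c upos pc] [cap pcb ua buc czc]]]]] := cle_O5 ap zp bp az h m0.
  have cb : cle c (inj b).
    by apply: cle_trans pcb; apply: cle_mono => //; [exact: cposD|rewrite addrK].
  have pb : cle p (inj b).
    by apply: cle_trans pcb; apply: cle_mono => //; [exact: cposD|rewrite addrC addKr].
  have [C [k Ck kE]] := cu_of_cle cpos_c cb; have [P [l Pl lE]] := cu_of_cle ppos pb.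
  rewrite -{}kE -{}lE in cpos_c ppos pc cap pcb buc czc *.
  exists C; split.
  + apply: (trans _ (cu_add P C)).
      apply: leD; last by apply/(cu_leP Ck Ck); exact: cle_refl.
      apply/(cu_leP Xa' Pl); apply: cle_trans h1 (cle_trans _ cap).
      by apply: cut_cle2 => //; rewrite ge_min lexx.
    by apply/(cu_leP (cu_addP Pl Ck pc) Yb); rewrite injD.
  + by apply: (cu_le_addP Xa Ck Yb upos cpos_c buc) => //; exact: cle_refl.
  + apply/(cu_leP Zz' Ck); apply: cle_trans h2 (cle_trans _ czc).
    by apply: cut_cle2 => //; rewrite ge_min lexx orbT.
- move=> X' X Y Z; have [b [c [Yb Zc bc]]] := cu_orth2 Y Z.
  have [a Xa] := cu_repr X; have [a' Xa'] := cu_repr X'.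
  move=> /(cu_wbP Xa' Xa)[e e0 h1] /(cu_leP Xa (cu_addP Yb Zc bc)); rewrite injD => h.
  have [u [w [[upos wpos cuw] [ua ub wa wc]]]] :=
    cle_O6 (pos _ _ Xa) (pos _ _ Yb) (pos _ _ Zc) bc h e0.
  have [E [k Ek kE]] := cu_of_cle upos ua; have [F [l Fl lE]] := cu_of_cle wpos wa.
  rewrite -{}kE -{}lE in upos wpos cuw ua ub wa wc *.
  exists E, F; split; [exact/(cu_leP Ek Xa)|exact/(cu_leP Ek Yb)|exact/(cu_leP Fl Xa)|exact/(cu_leP Fl Zc)|].
  by apply: (cu_le_addP Ek Fl Xa' upos wpos (cle_trans h1 cuw)); exact: cle_refl.
- move=> X1' X1 X2' X2 C; have [a1 Xa1] := cu_repr X1; have [a2 Xa2] := cu_repr X2.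
  have [a1' Xa1'] := cu_repr X1'; have [a2' Xa2'] := cu_repr X2'; have [c Cc] := cu_repr C.
  move=> /(cu_wbP Xa1' Xa1)[e1 e10 h1] /(cu_wbP Xa2' Xa2)[e2 e20 h2].
  move=> /(cu_leP Xa1 Cc) l1 /(cu_leP Xa2 Cc) l2.
  have m0 : 0 < Num.min e1 e2 by rewrite lt_min e10.
  have p1 := pos _ _ Xa1; have p2 := pos _ _ Xa2.
  have [u [w [[upos wpos uwc] [ua wb c1 c2]]]] := cle_O7 p1 p2 (pos _ _ Cc) l1 l2 m0.
  have uw := cposD upos wpos.
  have [V [k Vk kE]] := cu_of_cle uw uwc.
  exists V; split.
  + apply/(cu_leP Xa1' Vk); rewrite kE; apply: cle_trans h1 (cle_trans _ c1).
    by apply: cut_cle2 => //; rewrite ge_min lexx.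
  + apply/(cu_leP Xa2' Vk); rewrite kE; apply: cle_trans h2 (cle_trans _ c2).
    by apply: cut_cle2 => //; rewrite ge_min lexx orbT.
  + by apply/(cu_leP Vk Cc); rewrite kE.
  + by apply: (cu_le_addP Xa1 Xa2 Vk upos wpos) => //; rewrite kE; exact: cle_refl.
Qed.

End Orth.
End CuMonoid.

(** * Compact operators *)

Section HilbertBasics.
Variables (R : realType) (H : hilbertSpace R).
Implicit Types (x y z u v w : H) (c : R[i]) (t : R).
Local Notation rn := (@rn R H).

Definition dot x y : R[i] := hdot H x y.

Lemma dotC x y : dot y x = conjc (dot x y).
Proof. by rewrite /dot hermC expr0 mul1r. Qed.
Lemma dotDl x y z : dot (x + y) z = dot x z + dot y z.
Proof. by rewrite /dot linearDl. Qed.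
Lemma dotZl c x z : dot (c *: x) z = c * dot x z.
Proof. by rewrite /dot linearZl_LR. Qed.
Lemma dotDr x y z : dot z (x + y) = dot z x + dot z y.
Proof. by rewrite /dot linearDr. Qed.
Lemma dotZr c x z : dot z (c *: x) = conjc c * dot z x.
Proof. by rewrite dotC dotZl rmorphM /= -dotC. Qed.
Lemma dotNl x z : dot (- x) z = - dot x z.
Proof. by rewrite -scaleN1r dotZl mulN1r. Qed.
Lemma dotNr x z : dot z (- x) = - dot z x.
Proof. by rewrite dotC dotNl rmorphN /= -dotC. Qed.
Lemma dot0l z : dot 0 z = 0.
Proof. by rewrite -(scale0r (0 : H)) dotZl mul0r. Qed.
Lemma dot0r z : dot z 0 = 0.
Proof. by rewrite dotC dot0l -{1}[0]/(0%:C) conjc_real. Qed.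
Lemma dotE x : dot x x = (rn x ^+ 2)%:C.
Proof. by rewrite /dot hdot_norm rnE rmorphXn. Qed.
Lemma dot_suml (I : Type) (r : seq I) (F : I -> H) z :
  dot (\sum_(i <- r) F i) z = \sum_(i <- r) dot (F i) z.
Proof. by apply: (big_morph (fun x => dot x z)) => [x y|]; [exact: dotDl|exact: dot0l]. Qed.
Lemma dot_sumr (I : Type) (r : seq I) (F : I -> H) z :
  dot z (\sum_(i <- r) F i) = \sum_(i <- r) dot z (F i).
Proof. by apply: (big_morph (dot z)) => [x y|]; [exact: dotDr|exact: dot0r]. Qed.

Lemma dot_inj x y : (forall z, dot x z = dot y z) -> x = y.
Proof.
move=> h; apply/eqP; rewrite -subr_eq0; apply/eqP/rn0_eq0/eqP; rewrite -sqrf_eq0.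
apply/eqP/(@complexI R); rewrite -dotE dotDl dotNl h subrr//.
Qed.

Lemma rn_pyth x y : dot x y = 0 -> rn (x + y) ^+ 2 = rn x ^+ 2 + rn y ^+ 2.
Proof.
move=> xy; apply: (@complexI R); rewrite -dotE dotDl !dotDr xy (dotC x y) xy.
by rewrite -[0]/(0%:C) conjc_real addr0 add0r !dotE rmorphD.
Qed.

Lemma rn_sq_le x (t : R) : 0 <= t -> (rn x ^+ 2 <= t ^+ 2) = (rn x <= t).
Proof. by move=> t0; rewrite ler_sqr ?nnegrE ?rn_ge0. Qed.

Lemma cauchy_schwarz x y : normc (dot x y) <= rn x * rn y.
Proof.
have [y0|y0] := eqVneq (rn y) 0.
  by rewrite (rn0_eq0 y0) dot0r normc0 rn0 mulr0.
have yp : 0 < rn y by rewrite lt_def y0 rn_ge0.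
pose c := dot x y / (rn y ^+ 2)%:C.
have cy : dot (x - c *: y) (c *: y) = 0.
  rewrite dotZr dotDl dotNl dotZl dotE /c divfK ?subrr ?mulr0//.
  by rewrite eq_complex /= eqxx andbT sqrf_eq0.
have := rn_pyth cy; rewrite subrK => E.
have : rn (c *: y) <= rn x by rewrite -rn_sq_le ?rn_ge0// E lerDr sqr_ge0.
rewrite rnZ /c normcM normcV normc_real ger0_norm ?sqr_ge0// expr2 invfM.
by rewrite mulrA divfK// ler_pdivrMr.
Qed.

Lemma rn_cauchy_le x (t : R) : 0 <= t -> normc (dot x x) <= t * rn x -> rn x <= t.
Proof.
move=> t0; rewrite dotE normc_real ger0_norm ?sqr_ge0// expr2.
have [->//|x0] := eqVneq (rn x) 0.
by rewrite ler_pM2r// lt_def x0 rn_ge0.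
Qed.

Definition proj (s : seq H) x := \sum_(v <- s) dot x v *: v.
(** The consequence of orthonormality that the construction uses: [proj s] is the orthogonal
    projection onto the span of [s]. It extends along [rcons]. *)
Definition orthn (s : seq H) := forall x v, v \in s -> dot (x - proj s x) v = 0.

Lemma proj_rcons s u x : proj (rcons s u) x = proj s x + dot x u *: u.
Proof. by rewrite /proj -cats1 big_cat big_seq1. Qed.

Lemma dotC0 x y : dot x y = 0 -> dot y x = 0.
Proof. by move=> h; rewrite dotC h -{1}[0]/(0%:C) conjc_real. Qed.

Lemma dot_proj0 s u x : (forall v, v \in s -> dot u v = 0) -> dot (proj s x) u = 0.
Proof.
move=> us; rewrite /proj dot_suml big_seq big1// => w ws.
by rewrite dotZl (dotC0 (us w ws)) mulr0.
Qed.

Lemma orthn_rcons s u : orthn s -> dot u u = 1 -> (forall v, v \in s -> dot u v = 0) ->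
  orthn (rcons s u).
Proof.
move=> os u1 us x v; rewrite mem_rcons inE proj_rcons opprD addrA dotDl dotNl dotZl => /orP[/eqP ->|vs].
  by rewrite u1 mulr1 dotDl dotNl dot_proj0// subr0 subrr.
by rewrite us// mulr0 subr0 os.
Qed.

Definition onb (e : nat -> H) := (forall i j, dot (e i) (e j) = (i == j)%:R) /\
  forall x d, 0 < d -> exists N, forall n, (N <= n)%N ->
    rn (x - \sum_(i < n) dot x (e i) *: e i) <= d.

(** A Gram-Schmidt step that never stops: if [d] already lies in the span of [s], infinite dimension
    provides another vector to orthonormalize, so the basis is indexed by all natural numbers. *)
Lemma onb_step s d : hilb_infinite_dim H -> orthn s -> exists u,
  [/\ dot u u = 1, forall v, v \in s -> dot u v = 0 & proj (rcons s u) d = d].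
Proof.
move=> Hinf os.
have nz x : x != proj s x -> exists2 u, dot u u = 1 & x - proj s x = (rn (x - proj s x))%:C *: u.
  rewrite -subr_eq0; set r := x - _ => r0; have rp : rn r != 0.
    by apply: contra r0 => /eqP/rn0_eq0 ->.
  exists ((rn r)^-1%:C *: r); last by rewrite scalerA -rmorphM /= divff// scale1r.
  rewrite dotZl dotZr dotE conjc_real -!rmorphM /=; congr (_%:C).
  by rewrite mulrA expr2 mulrACA mulVf// mul1r.
have scal x u (t : R) : t != 0 -> x - proj s x = t%:C *: u -> forall v, v \in s -> dot u v = 0.
  move=> t0 xu v vs; have := os x v vs; rewrite xu dotZl => /eqP.
  by rewrite mulf_eq0 eq_complex /= eqxx andbT (negbTE t0) => /eqP.
have [ds|] := eqVneq d (proj s d); last first.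
  move=> /[dup] dn /nz[u u1 du]; have r0 : rn (d - proj s d) != 0.
    by apply: contra dn => /eqP/rn0_eq0/eqP; rewrite subr_eq0.
  have us := scal _ _ _ r0 du; exists u; split => //.
  rewrite proj_rcons; move: (rn _) du {r0} => t du.
  have -> : dot d u = t%:C.
    by rewrite -(subrK (proj s d) d) dotDl dot_proj0// addr0 du dotZl u1 mulr1.
  by rewrite -du addrC subrK.
have [h hh] := Hinf (size s) (fun i => tnth (in_tuple s) i).
have hn : h != proj s h.
  apply/eqP => E; apply: (hh (fun i => dot h (tnth (in_tuple s) i))).
  by rewrite {1}E /proj big_tnth.
have [u u1 hu] := nz _ hn; have r0 : rn (h - proj s h) != 0.
  by apply: contra hn => /eqP/rn0_eq0/eqP; rewrite subr_eq0.
have us := scal _ _ _ r0 hu; exists u; split => //.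
by rewrite proj_rcons -ds {2}ds dot_proj0// scale0r addr0.
Qed.

Lemma proj_le s x y : orthn s -> proj s y = y -> rn (x - proj s x) <= rn (x - y).
Proof.
move=> os yy; have h : dot (x - proj s x) (proj s x - y) = 0.
  rewrite -yy dotDr dotNr !dot_sumr !big_seq !big1 ?subr0// => v vs.
    by rewrite dotZr os// mulr0.
  by rewrite dotZr os// mulr0.
have := rn_pyth h; rewrite addrA subrK => E.
by rewrite -rn_sq_le ?rn_ge0// E lerDl sqr_ge0.
Qed.

Lemma onb_exists : hilb_separable H -> hilb_infinite_dim H -> exists e, onb e.
Proof.
move=> [D [cD dD]] Hinf.
(* The enumeration comes from an injection of [D] into the natural numbers; an index outside its
   range is sent to 0. *)
have [d hd] : exists d : nat -> H, forall x, D x -> exists n, d n = x.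
  have /countable_injP[f finj] := cD.
  have ex n : exists y, forall x, D x -> f x = n -> y = x.
    have [[x [Dx fx]]|no] := pselect (exists x, D x /\ f x = n).
      by exists x => y Dy fy; apply: finj; rewrite ?inE// fx fy.
    by exists 0 => x Dx fx; case: no; exists x.
  by exists (fun n => sval (cid (ex n))) => x Dx; exists (f x); case: cid => /= y; exact.
have stepP (s : seq H) : exists u, orthn s ->
    [/\ dot u u = 1, forall v, v \in s -> dot u v = 0 & proj (rcons s u) (d (size s)) = d (size s)].
  have [os|no] := pselect (orthn s); last by exists 0.
  by have [u hu] := onb_step (d (size s)) Hinf os; exists u.
pose F s := sval (cid (stepP s)).
pose s := fix s n := if n is n'.+1 then rcons (s n') (F (s n')) else [::].
pose e n := F (s n).
have FP n : orthn (s n) -> [/\ dot (e n) (e n) = 1, forall v, v \in s n -> dot (e n) v = 0 &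
    proj (s n.+1) (d n) = d n].
  have sz : size (s n) = n by elim: n => //= n ih; rewrite size_rcons ih.
  rewrite /e [s n.+1]/= /F; case: (cid (stepP (s n))) => u /= hu /hu; by rewrite sz.
have os n : orthn (s n).
  elim: n => [x v|n ih] //=; have [h1 h2 _] := FP n ih; exact: orthn_rcons.
have se n i : (i < n)%N -> e i \in s n.
  elim: n => // n ih; rewrite ltnS leq_eqVlt mem_rcons inE => /orP[/eqP ->|/ih ->].
    by rewrite eqxx.
  by rewrite orbT.
have pE n x : proj (s n) x = \sum_(i < n) dot x (e i) *: e i.
  elim: n => [|n ih]; first by rewrite big_ord0 /proj big_nil.
  by rewrite big_ord_recr /= proj_rcons ih.
have dd n j : (j < n)%N -> proj (s n) (d j) = d j.
  elim: n => // n ih; rewrite ltnS leq_eqVlt => /orP[/eqP ->|jn].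
    by have [] := FP n (os n).
  have [_ h2 _] := FP n (os n).
  by rewrite [s _]/= proj_rcons ih// -{2}(ih jn) dot_proj0// scale0r addr0.
exists e; split.
  have lt i j : (i < j)%N -> dot (e j) (e i) = 0.
    by move=> ij; have [_ + _] := FP j (os j); apply; exact: se.
  move=> i j; case: (ltngtP i j) => [ij|ji|->].
  - by rewrite dotC lt// -[0]/(0%:C) conjc_real.
  - exact: lt.
  - by have [] := FP j (os j).
move=> x t t0.
have [||y [yx Dy]] := dD (ball x t%:C).
- by exists x; apply: ballxx; rewrite ltcR.
- by apply: ball_open; rewrite ltcR.
have [j jy] := hd y Dy; exists j.+1 => n jn; rewrite -pE.
apply: (@le_trans _ _ (rn (x - y))).
  by apply: proj_le => //; rewrite -jy; exact: dd.
by move: yx; rewrite -ball_normE /= rnE ltcR => /ltW.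
Qed.

Definition tb (S : set H) := forall d : R, 0 < d -> exists s : seq H,
  forall x, S x -> exists2 y, y \in s & rn (x - y) <= d.

Lemma compact_tb S : compact S -> tb S.
Proof.
rewrite compact_cover => cS d d0.
have [|x Sx|s _ hs] := cS H S (fun x => ball x d%:C).
- by move=> x _; apply: ball_open; rewrite ltcR.
- by exists x => //; apply: ballxx; rewrite ltcR.
exists (finmap.enum_fset s) => x /hs[y ys xy]; exists y => //.
by move: xy; rewrite -ball_normE /= rn_distC rnE ltcR => /ltW.
Qed.

(** An ultrafilter containing a finite union of balls contains one of them. Hence every ultrafilter
    on the closure is Cauchy and converges by completeness. *)
Lemma tb_closure_compact S : tb S -> compact (closure S).
Proof.
move=> tS; rewrite compact_ultra => F UF FS.
have FF : ProperFilter F by exact: ultra_proper.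
have Fl : cvg F.
  apply/cauchy_cvgP/cauchy_exP => e e0.
  have er : e = (complex.Re e)%:C by rewrite RRe_real// gtr0_real.
  have e1 : 0 < complex.Re e by rewrite -ltcR -er.
  have [s hs] := tS _ (divr_gt0 e1 (ltr0n R 3)).
  have : F (\bigcup_(y in [set` s]) ball y e).
    apply: filterS FS => x cx.
    have [|z [Sz]] := cx (ball x (complex.Re e / 3)%:C).
      by apply: nbhsx_ballx; rewrite ltcR divr_gt0.
    rewrite -ball_normE /= rnE ltcR => xz; have [y ys zy] := hs _ Sz; exists y => //.
    rewrite /= er rnE ltcR rn_distC; apply: le_lt_trans (rn_tri z _ _) _.
    by move: (rn (x - z)) (rn (z - y)) xz zy => *; lra.
  elim: s {hs} => [|y s ih] h.
    have : F set0 by apply: filterS h => x [y].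
    by move=> /filter_not_empty.
  have [Fy|Fn] := in_ultra_setVsetC (ball y e) UF; first by exists y.
  apply: ih; apply: filterS (filterI Fn h) => x [xy [z /=]].
  by rewrite inE => /orP[/eqP ->//|zs xz]; exists z.
exists (lim F); split => //; apply: (@closed_cvg _ _ F _ id (closure S)) => //; exact: closed_closure.
Qed.

Lemma tb_sub S T : S `<=` T -> tb T -> tb S.
Proof. by move=> ST tT d /tT[s hs]; exists s => x /ST/hs. Qed.

Lemma tb_lip (f : H -> H) (c : R) S : (forall x y, rn (f x - f y) <= c * rn (x - y)) ->
  tb S -> tb (f @` S).
Proof.
move=> fc tS d d0; have c0 : 0 < Num.max c 1 by rewrite lt_max ltr01 orbT.
have [s hs] := tS _ (divr_gt0 d0 c0); exists (map f s) => _ [x /hs[y ys xy] <-].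
exists (f y); first exact: map_f.
apply: le_trans (fc _ _) _; apply: (@le_trans _ _ (Num.max c 1 * rn (x - y))).
  by apply: ler_wpM2r; rewrite ?rn_ge0// le_max lexx.
by rewrite mulrC -ler_pdivlMr.
Qed.

Lemma tb_add S T : tb S -> tb T -> tb [set x + y | x in S & y in T].
Proof.
move=> tS tT d d0; have d2 : 0 < d / 2 by rewrite divr_gt0.
have [s hs] := tS _ d2; have [t ht] := tT _ d2.
exists [seq x + y | x <- s, y <- t] => _ [x /hs[x' xs xx] [y /ht[y' yt yy] <-]].
exists (x' + y'); first exact: allpairs_f.
rewrite opprD addrACA [leRHS]splitr; apply: le_trans (rnD _ _) _; exact: lerD.
Qed.

Lemma tb_approx S : (forall d : R, 0 < d -> exists2 T, tb T &
  forall x, S x -> exists2 y, T y & rn (x - y) <= d) -> tb S.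
Proof.
move=> h d d0; have d2 : 0 < d / 2 by rewrite divr_gt0.
have [T tT hT] := h _ d2; have [s hs] := tT _ d2; exists s => x /hT[y /hs[z zs yz] xy].
by exists z => //; apply: le_trans (rn_tri y _ _) _; rewrite [leRHS]splitr; exact: lerD.
Qed.

Lemma tb_line (c : R) v : tb [set z *: v | z in [set z : R[i] | normc z <= c]].
Proof.
have seg (w : H) : tb [set t%:C *: w | t in `[-c, c]%classic].
  move=> d d0; have w1 : 0 < rn w + 1 by rewrite ltr_wpDl ?rn_ge0.
  have : compact (`[-c, c] : set R) by exact: segment_compact.
  rewrite compact_cover => /(_ R (`[-c, c]%classic) (fun t => ball t (d / (rn w + 1)))).
  case=> [t _|t tc|s _ hs]; first by apply: ball_open; exact: divr_gt0.
    by exists t => //; apply: ballxx; exact: divr_gt0.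
  exists [seq t%:C *: w | t <- finmap.enum_fset s] => _ [t /hs[u us tu] <-].
  exists (u%:C *: w); first exact: map_f.
  rewrite -scalerBl -rmorphB /= rnZ normc_real.
  move: tu; rewrite -ball_normE /= distrC => /ltW tu.
  apply: (@le_trans _ _ (`|t - u| * (rn w + 1))); first by apply: ler_wpM2l; rewrite ?lerDl.
  by rewrite -ler_pdivlMr.
apply: tb_sub (tb_add (seg v) (seg ('i%C *: v))) => _ [z /= zc <-].
have [h1 [h2 _]] := normc_parts z.
exists ((complex.Re z)%:C *: v).
  by exists (complex.Re z) => //=; rewrite in_itv /= -ler_norml (le_trans h1).
exists ((complex.Im z)%:C *: ('i%C *: v)).
  by exists (complex.Im z) => //=; rewrite in_itv /= -ler_norml (le_trans h2).
by rewrite scalerA -scalerDl; congr (_ *: _); rewrite [RHS]complexE mulrC.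
Qed.
End HilbertBasics.

(** * Bounded operators, compact operators and adjoints *)

Section Operators.
Variables (R : realType) (H : hilbertSpace R).
Implicit Types (x y z u v w : H) (c : R[i]) (t d : R) (f g k l : H -> H).
Local Notation rn := (@rn R H).
Local Notation dot := (@dot R H).

Definition bop k t := forall x, rn (k x) <= t * rn x.

Lemma lin0 k : linear k -> k 0 = 0.
Proof.
by move=> h; have := h (-1) 0 0; rewrite scaler0 addr0 scaleN1r addNr.
Qed.
Lemma linD k x y : linear k -> k (x + y) = k x + k y.
Proof. by move=> h; rewrite -{1}(scale1r x) h scale1r. Qed.
Lemma linZ k c x : linear k -> k (c *: x) = c *: k x.
Proof. by move=> h; rewrite -[c *: x]addr0 h lin0// addr0. Qed.
Lemma linN k x : linear k -> k (- x) = - k x.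
Proof. by move=> h; rewrite -scaleN1r linZ// scaleN1r. Qed.
Lemma linB k x y : linear k -> k (x - y) = k x - k y.
Proof. by move=> h; rewrite linD// linN. Qed.
Lemma lin_sum k (I : Type) (r : seq I) (F : I -> H) : linear k ->
  k (\sum_(i <- r) F i) = \sum_(i <- r) k (F i).
Proof. by move=> h; apply: (big_morph k) => [x y|]; [exact: linD|exact: lin0]. Qed.
Lemma lin_comp k l : linear k -> linear l -> linear (k \o l).
Proof. by move=> hk hl c x y /=; rewrite hl hk. Qed.

Lemma norm_le1 x : (`|x| <= 1) = (rn x <= 1).
Proof. by rewrite rnE lecR. Qed.

Lemma compact_opP k : compact_op k <-> linear k /\ tb (k @` [set h | rn h <= 1]).
Proof.
have -> : [set h | rn h <= 1] = [set h : H | `|h| <= 1].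
  by apply/funext => h /=; rewrite norm_le1.
split=> -[lk h]; split => //; last exact: tb_closure_compact.
by apply: tb_sub (compact_tb h); exact: subset_closure.
Qed.

Lemma unit_ball x : exists t, exists2 u, 0 <= t /\ rn u <= 1 & x = t%:C *: u /\ t = rn x.
Proof.
have [x0|x0] := eqVneq (rn x) 0.
  by exists 0, 0; rewrite ?rn0 // scaler0 (rn0_eq0 x0) rn0.
exists (rn x), ((rn x)^-1%:C *: x); split; rewrite ?rn_ge0//.
  by rewrite rnZ normc_real ger0_norm ?invr_ge0 ?rn_ge0// mulVf.
by rewrite scalerA -rmorphM /= divff// scale1r.
Qed.

Lemma bop_ball k t : linear k -> (forall x, rn x <= 1 -> rn (k x) <= t) -> bop k t.
Proof.
move=> lk h x; have [s [u [s0 u1] [-> <-]]] := unit_ball x.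
by rewrite linZ// rnZ normc_real ger0_norm// mulrC; apply: ler_wpM2r => //; exact: h.
Qed.

Lemma compact_bop k : compact_op k -> exists2 t, 0 <= t & bop k t.
Proof.
move=> /compact_opP[lk tk]; have [s hs] := tk _ ltr01.
exists (\sum_(y <- s) rn y + 1).
  by apply: addr_ge0 => //; apply: sumr_ge0 => y _; exact: rn_ge0.
apply: bop_ball => // x x1; have [|y ys xy] := hs (k x); first by exists x.
rewrite -[k x](subrK y) addrC; apply: le_trans (rnD _ _) _; apply: lerD => //.
rewrite (big_rem y)//= lerDl; apply: sumr_ge0 => z _; exact: rn_ge0.
Qed.

Lemma compact_compl f k t : linear f -> bop f t -> compact_op k -> compact_op (f \o k).
Proof.
move=> lf bf /compact_opP[lk tk]; apply/compact_opP; split; first exact: lin_comp.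
rewrite -[X in tb X]image_comp; apply: (@tb_lip R H f t) => // x y; by rewrite -linB.
Qed.

Lemma compact_add k l : compact_op k -> compact_op l -> compact_op (fun x => k x + l x).
Proof.
move=> /compact_opP[lk tk] /compact_opP[ll tl]; apply/compact_opP; split.
  by move=> c x y; rewrite lk ll scalerDr addrACA.
apply: tb_sub (tb_add tk tl) => _ [x /= x1 <-].
by exists (k x); [exists x|exists (l x) => //; exists x].
Qed.

Lemma lin_scale c : linear (fun x : H => c *: x).
Proof. by move=> z x y; rewrite scalerDr !scalerA mulrC. Qed.

Lemma compact_scale c k : compact_op k -> compact_op (fun x => c *: k x).
Proof.
move=> h; apply: (@compact_compl (fun x => c *: x) k (normc c)) => //; first exact: lin_scale.
by move=> x; rewrite rnZ.
Qed.

Lemma compact_sub k l : compact_op k -> compact_op l -> compact_op (fun x => k x - l x).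
Proof.
move=> hk hl; have := compact_add hk (compact_scale (-1) hl).
by congr compact_op; apply/funext => x; rewrite scaleN1r.
Qed.

Lemma compact_approx k : linear k -> (forall d, 0 < d -> exists2 l, compact_op l &
  bop (fun x => k x - l x) d) -> compact_op k.
Proof.
move=> lk h; apply/compact_opP; split => //; apply: tb_approx => d d0.
have [l /compact_opP[ll tl] kl] := h _ d0; exists (l @` [set h | rn h <= 1]) => //.
move=> _ [x /= x1 <-]; exists (l x); first by exists x.
by apply: le_trans (kl x) _; rewrite ler_piMr// ltW.
Qed.

Definition rk1 u v x := dot x v *: u.

Lemma rk1_lin u v : linear (rk1 u v).
Proof. by move=> c x y; rewrite /rk1 dotDl dotZl scalerDl scalerA. Qed.

Lemma compact_rk1 u v : compact_op (rk1 u v).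
Proof.
apply/compact_opP; split; first exact: rk1_lin.
apply: tb_sub (@tb_line R H (rn v) u) => _ [x /= x1 <-]; exists (dot x v) => //=.
apply: le_trans (cauchy_schwarz _ _) _; rewrite ler_piMl ?rn_ge0//.
Qed.

Lemma compact_zero : compact_op (fun=> 0 : H).
Proof.
have := compact_rk1 0 0; congr compact_op; apply/funext => x; by rewrite /rk1 scaler0.
Qed.

Lemma compact_sum n (F : nat -> H -> H) : (forall i, compact_op (F i)) ->
  compact_op (fun x => \sum_(i < n) F i x).
Proof.
move=> h; elim: n => [|n ih].
  by have := compact_zero; congr compact_op; apply/funext => x; rewrite big_ord0.
have := compact_add ih (h n); congr compact_op; apply/funext => x.
by rewrite big_ord_recr.
Qed.

Lemma adjoint_sym k l : adjoint_op k l -> adjoint_op l k.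
Proof. by move=> h x y; rewrite -/(dot _ _) -/(dot _ _) dotC -[dot y _]h -dotC. Qed.

Lemma adjoint_lin k l : adjoint_op k l -> linear l.
Proof.
move=> h c x y; apply: dot_inj => z; have h' := adjoint_sym h.
by rewrite dotDl dotZl [LHS]h' -/(dot _ _) dotDl dotZl; congr (_ * _ + _); exact/esym/h'.
Qed.

Lemma adjoint_bop k l t : adjoint_op k l -> 0 <= t -> bop k t -> bop l t.
Proof.
move=> kl t0 bk x; apply: rn_cauchy_le; first by rewrite mulr_ge0 ?rn_ge0.
rewrite -[dot _ _]kl; apply: le_trans (cauchy_schwarz _ _) _.
by rewrite mulrAC; apply: ler_wpM2r; rewrite ?rn_ge0.
Qed.

Lemma adjoint_rk1 u v : adjoint_op (rk1 u v) (rk1 v u).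
Proof. by move=> x y; rewrite -/(dot _ _) -/(dot _ _) /rk1 dotZl dotZr -dotC mulrC. Qed.

Section Onb.
Variables (e : nat -> H) (oe : onb e).

Definition pj n x := \sum_(i < n) dot x (e i) *: e i.

Lemma pjE n x : pj n x = \sum_(i < n) dot x (e i) *: e i. Proof. by []. Qed.

Lemma ee i j : dot (e i) (e j) = (i == j)%:R. Proof. exact: oe.1. Qed.

Lemma pjS n x : pj n.+1 x = pj n x + dot x (e n) *: e n.
Proof. by rewrite /pj big_ord_recr. Qed.

Lemma pj_lin n : linear (pj n).
Proof.
move=> c x y; rewrite /pj scaler_sumr -big_split /=; apply: eq_bigr => i _.
by rewrite dotDl dotZl scalerDl scalerA.
Qed.

Lemma pj_adj n : adjoint_op (pj n) (pj n).
Proof.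
move=> x y; rewrite -/(dot _ _) -/(dot _ _) /pj dot_suml dot_sumr; apply: eq_bigr => i _.
by rewrite dotZl dotZr -dotC mulrC.
Qed.

Lemma pjA n x y : dot (pj n x) y = dot x (pj n y). Proof. exact: pj_adj. Qed.

Lemma dot_pj n x i : dot (pj n x) (e i) = if (i < n)%N then dot x (e i) else 0.
Proof.
elim: n => [|n ih]; first by rewrite /pj big_ord0 dot0l.
rewrite pjS dotDl ih dotZl ee [in RHS]ltnS [in RHS]leq_eqVlt [in RHS]eq_sym.
case: eqP => [->|_]; first by rewrite ltnn mulr1 add0r.
by rewrite mulr0 addr0.
Qed.

Lemma onb_inj x y : (forall i, dot x (e i) = dot y (e i)) -> x = y.
Proof.
move=> h; apply/eqP; rewrite -subr_eq0; apply/eqP/rn0_eq0/le_anti; rewrite rn_ge0 andbT.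
apply/ler_addgt0Pl => d d0; have [N /(_ N (leqnn _))] := oe.2 (x - y) _ d0.
rewrite addr0 big1 ?subr0// => i _; by rewrite dotDl dotNl h subrr scale0r.
Qed.

Lemma pj_cpj n x : pj n (x - pj n x) = 0.
Proof.
apply: onb_inj => i; rewrite dot_pj dotDl dotNl dot_pj dot0l.
by case: (i < n)%N; rewrite ?subrr.
Qed.

Lemma pj_split n x : rn x ^+ 2 = rn (pj n x) ^+ 2 + rn (x - pj n x) ^+ 2.
Proof.
have h : dot (pj n x) (x - pj n x) = 0.
  by rewrite pjA pj_cpj dot0r.
by rewrite -rn_pyth// addrC subrK.
Qed.

Lemma pj_bop n : bop (pj n) 1.
Proof. by move=> x; rewrite mul1r -rn_sq_le ?rn_ge0// (pj_split n x) lerDl sqr_ge0. Qed.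

Lemma cpj_bop n : bop (fun x => x - pj n x) 1.
Proof. by move=> x; rewrite mul1r -rn_sq_le ?rn_ge0// [leRHS](pj_split n x) lerDr sqr_ge0. Qed.

Lemma cpj_lin n : linear (fun x => x - pj n x).
Proof. by move=> c x y; rewrite pj_lin scalerBr opprD addrACA. Qed.

Lemma compact_pj n : compact_op (pj n).
Proof. by apply: (@compact_sum n (fun i => rk1 (e i) (e i))) => i; exact: compact_rk1. Qed.

Lemma cpjS n x : rn (x - pj n x) ^+ 2 = rn (x - pj n.+1 x) ^+ 2 + normc (dot x (e n)) ^+ 2.
Proof.
have h : dot (x - pj n.+1 x) (dot x (e n) *: e n) = 0.
  by rewrite dotZr dotDl dotNl dot_pj ltnS leqnn subrr mulr0.
have := rn_pyth h; rewrite pjS opprD addrA subrK => ->; congr (_ + _).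
have e1 : rn (e n) ^+ 2 = 1 by apply: (@complexI R); rewrite -dotE ee eqxx.
by rewrite rnZ exprMn e1 mulr1.
Qed.

Lemma cpj_anti m n x : (m <= n)%N -> rn (x - pj n x) <= rn (x - pj m x).
Proof.
move=> /subnK <-; elim: (n - m)%N => // j ih; apply: le_trans ih.
by rewrite addSn -rn_sq_le ?rn_ge0// [leRHS]cpjS lerDl sqr_ge0.
Qed.

(** One projection nearly fixes every point of a finite net for the image of the unit ball, and
    [1 - P_n] is a contraction, so the distance to the net does not grow. *)
Lemma compact_tail k d : compact_op k -> 0 < d ->
  exists N, forall n, (N <= n)%N -> bop (fun x => k x - pj n (k x)) d.
Proof.
move=> /compact_opP[lk tk] d0; have d2 : 0 < d / 2 by rewrite divr_gt0.
have [s hs] := tk _ d2.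
have [N hN] : exists N, forall y, y \in s -> rn (y - pj N y) <= d / 2.
  elim: s {hs} => [|y s [N hN]]; first by exists 0%N.
  have [N' hN'] := oe.2 y _ d2; exists (maxn N N') => z.
  rewrite inE => /orP[/eqP ->|/hN zs]; first by apply: hN'; exact: leq_maxr.
  by apply: le_trans (cpj_anti _ _) zs; exact: leq_maxl.
exists N => n Nn; apply: bop_ball.
  by have := lin_comp (cpj_lin n) lk.
move=> x x1; apply: le_trans (cpj_anti _ Nn) _.
have [|y ys xy] := hs (k x); first by exists x.
have -> : k x - pj N (k x) = (k x - y - pj N (k x - y)) + (y - pj N y).
  by rewrite (linB _ _ (pj_lin N)) opprB addrACA subrK (addrAC (pj N y)) subrr add0r.
apply: le_trans (rnD _ _) _; rewrite [leRHS]splitr; apply: lerD; last exact: hN.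
by apply: le_trans (cpj_bop N _) _; rewrite mul1r.
Qed.

(** By Pythagoras the squared norms increase, and their increments are the squared distances. *)
Lemma rn_mono_cvg (s : nat -> H) t : (forall m n, (m <= n)%N -> dot (s m) (s n - s m) = 0) ->
  (forall n, rn (s n) <= t) ->
  exists l : H, forall d, 0 < d -> exists N, forall n, (N <= n)%N -> rn (s n - l) <= d.
Proof.
move=> orth st.
have py m n : (m <= n)%N -> rn (s n) ^+ 2 = rn (s m) ^+ 2 + rn (s n - s m) ^+ 2.
  by move=> /orth/rn_pyth <-; rewrite addrC subrK.
have cv : cvgn (fun n => rn (s n) ^+ 2).
  apply: nondecreasing_is_cvgn.
    by move=> m n mn; rewrite (py _ _ mn) lerDl sqr_ge0.
  by exists (t ^+ 2) => _ [n _ <-]; rewrite rn_sq_le// (le_trans _ (st 0%N))// rn_ge0.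
apply: rn_complete => d d0; have d2 : 0 < (d / 2) ^+ 2 by rewrite exprn_gt0// divr_gt0.
have /cauchy_cvgP/cauchy_ballP/(_ _ d2)[[P Q] /= [[N1 _ hP] [N2 _ hQ]] PQ] := cv.
pose N := maxn N1 N2.
have tail n : (N <= n)%N -> rn (s n - s N) <= d / 2.
  move=> Nn; rewrite -rn_sq_le ?divr_ge0 ?(ltW d0)//.
  have := PQ (rn (s N) ^+ 2, rn (s n) ^+ 2); rewrite /= -ball_normE /= (py _ _ Nn).
  rewrite opprD addNKr normrN ger0_norm ?sqr_ge0// => h; apply/ltW/h; split.
    by apply: hP; exact: leq_maxl.
  by rewrite -py//; apply: hQ; exact: leq_trans (leq_maxr _ _) Nn.
exists N => m n /tail hm /tail hn; rewrite rn_distC in hn.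
by apply: le_trans (rn_tri (s N) _ _) _; rewrite [leRHS]splitr; exact: lerD.
Qed.

Lemma dot_closed (s : nat -> H) (l : H) y c :
  (forall d, 0 < d -> exists N, forall n, (N <= n)%N -> rn (s n - l) <= d) ->
  (exists N, forall n, (N <= n)%N -> dot (s n) y = c) -> dot l y = c.
Proof.
move=> sl [N1 h1]; apply/eqP; rewrite -subr_eq0; apply/eqP/eq0_normc/le_anti.
rewrite normc_ge0 andbT; apply/ler_addgt0Pl => d d0; rewrite addr0.
have y1 : 0 < rn y + 1 by rewrite ltr_wpDl ?rn_ge0.
have [N2 h2] := sl _ (divr_gt0 d0 y1).
rewrite -(h1 (maxn N1 N2)) ?leq_maxl// -dotNl -dotDl.
apply: le_trans (cauchy_schwarz _ _) _; rewrite rn_distC.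
have := h2 (maxn N1 N2) (leq_maxr _ _); rewrite ler_pdivlMr//; apply: le_trans.
by apply: ler_wpM2l; rewrite ?rn_ge0// lerDl.
Qed.

(** Riesz representation in coordinates: [s y n] is what [P_n] of the adjoint at [y] has to be. Its
    squared norm is [dot y (k (s y n))], hence it is bounded by [t * rn y] uniformly in [n], and
    successive differences are orthogonal. *)
Lemma adjoint_exists k t : linear k -> 0 <= t -> bop k t -> exists l, adjoint_op k l.
Proof.
move=> lk t0 bk.
pose s y n := \sum_(i < n) dot y (k (e i)) *: e i.
have sE y n x : dot (s y n) x = dot y (k (pj n x)).
  rewrite /s /pj dot_suml lin_sum// dot_sumr; apply: eq_bigr => i _.
  by rewrite linZ// dotZl dotZr -dotC mulrC.
have pjs y m n : (m <= n)%N -> pj m (s y n) = s y m.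
  move=> mn; have se n' i : dot (s y n') (e i) = if (i < n')%N then dot y (k (e i)) else 0.
    rewrite sE; have -> : pj n' (e i) = if (i < n')%N then e i else 0.
      by apply: onb_inj => j; rewrite dot_pj ee; case: (ltnP i n') => h;
        rewrite ?dot0l ?ee; have [ij|] := eqVneq i j; rewrite -?ij ?h ?(leq_gtF h) //; case: ifP.
    by case: ifP => // _; rewrite lin0// dot0r.
  apply: onb_inj => i; rewrite dot_pj !se; case: ltnP => // im.
  by rewrite (leq_trans im mn).
have cv y : exists l : H, forall d, 0 < d -> exists N, forall n, (N <= n)%N -> rn (s y n - l) <= d.
  apply: (@rn_mono_cvg _ (t * rn y)).
    move=> m n mn; by rewrite -(pjs y m n mn) pjA pj_cpj dot0r.
  move=> n; apply: rn_cauchy_le; first by rewrite mulr_ge0 ?rn_ge0.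
  rewrite sE; apply: le_trans (cauchy_schwarz _ _) _; rewrite mulrC mulrAC.
  apply: ler_wpM2r; first exact: rn_ge0.
  by apply: le_trans (bk _) _; apply: ler_wpM2l => //; have := pj_bop n (s y n); rewrite mul1r.
pose l y := sval (cid (cv y)).
exists l; apply: adjoint_sym => y x; rewrite -/(dot _ _) -/(dot _ _).
have hl := svalP (cid (cv y)); rewrite -/(l y) in hl.
apply/eqP; rewrite -subr_eq0; apply/eqP/eq0_normc/le_anti.
rewrite normc_ge0 andbT; apply/ler_addgt0Pl => d d0; rewrite addr0.
have d2 : 0 < d / 2 by rewrite divr_gt0.
have x1 : 0 < rn x + 1 by rewrite ltr_wpDl ?rn_ge0.
have y1 : 0 < rn y * t + 1 by rewrite ltr_wpDl// mulr_ge0 ?rn_ge0.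
have [N1 h1] := hl _ (divr_gt0 d2 x1); have [N2 h2] := oe.2 x _ (divr_gt0 d2 y1).
pose n := maxn N1 N2.
have -> : dot (l y) x - dot y (k x) = dot (l y - s y n) x - dot y (k (x - pj n x)).
  rewrite dotDl dotNl sE (linB _ _ lk) dotDr dotNr opprB addrA; congr (_ - _).
  by rewrite subrK.
apply: le_trans (le_normcD _ _) _; rewrite normcN [leRHS]splitr; apply: lerD.
  apply: le_trans (cauchy_schwarz _ _) _; rewrite rn_distC.
  have := h1 n (leq_maxl _ _); rewrite ler_pdivlMr//; apply: le_trans.
  by apply: ler_wpM2l; rewrite ?rn_ge0// lerDl.
apply: le_trans (cauchy_schwarz _ _) _.
have := h2 n (leq_maxr _ _); rewrite ler_pdivlMr//; apply: le_trans.
apply: (@le_trans _ _ (rn y * (t * rn (x - pj n x)))).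
  by apply: ler_wpM2l; rewrite ?rn_ge0.
by rewrite mulrA mulrC; apply: ler_wpM2l; rewrite ?rn_ge0// lerDl.
Qed.

(* If [k] is compact then [k (1 - P_n)] is small, and taking adjoints [l] is a
   norm limit of finite rank operators. *)
Lemma compact_adjoint k : compact_op k -> exists2 l, compact_op l & adjoint_op k l.
Proof.
move=> ck; have [t t0 bk] := compact_bop ck; have lk := ck.1.
have [l kl] := adjoint_exists lk t0 bk; exists l => //.
have ll := adjoint_lin kl; apply: compact_approx => // d d0.
have [N hN] := compact_tail ck d0; exists (l \o pj N).
  apply: (@compact_compl l (pj N) t) => //; [exact: adjoint_bop kl t0 bk|exact: compact_pj].
apply: (@adjoint_bop (fun x => k x - pj N (k x))); [|exact: ltW|exact: hN].
move=> x y; rewrite -/(dot _ _) -/(dot _ _) dotDl dotNl dotDr dotNr; congr (_ - _).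
  exact: kl.
by rewrite [LHS]pj_adj; exact: kl.
Qed.

End Onb.
End Operators.

(** * Domination of the tails of a compact operator by one compact operator *)

Section TailFactor.
Variables (R : realType) (H : hilbertSpace R).
Variables (e : nat -> H) (oe : onb e) (k : H -> H) (ck : compact_op k).
Implicit Types (x y : H) (d t : R).
Local Notation rn := (@rn R H).
Local Notation dot := (@dot R H).
Local Notation pj := (@pj R H e).

Let tl n x := rn (k x - pj n (k x)).

Lemma sq_diff_le (C a b K : R) : 0 <= C -> 0 <= b -> b <= a -> C * a <= K ->
  C * (a ^+ 2 - b ^+ 2) <= 2 * (a - b) * K.
Proof.
move=> C0 b0 ba CK; rewrite subr_sqr mulrCA (mulrC 2) -mulrA; apply: ler_wpM2l; first lra.
by have := ler_wpM2l C0 ba; lra.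
Qed.

Lemma conjcRM (t : R) (z : R[i]) : conjc (t%:C * z) = t%:C * conjc z.
Proof. by rewrite rmorphM /= oppr0. Qed.

(** The term [1 / (n + 1)] added to the norm of the tail keeps the rate strictly positive even if
    some tail vanishes. *)
Lemma tail_rate : exists r : nat -> R, [/\ forall n, 0 < r n, forall n, r n.+1 <= r n,
  forall d, 0 < d -> exists N, forall n, (N <= n)%N -> r n <= d &
  forall n, bop (fun x => k x - pj n (k x)) (r n)].
Proof.
have [t t0 bk] := compact_bop ck.
pose S n := [set tl n x | x in [set x | rn x <= 1]].
have S0 n : S n !=set0 by exists (tl n 0), 0 => //=; rewrite rn0.
have hs n : has_sup (S n).
  split => //; exists t => _ [x /= x1 <-]; apply: le_trans (cpj_bop oe n _) _.
  by rewrite mul1r; apply: le_trans (bk x) _; rewrite ler_piMr.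
have ub n x : rn x <= 1 -> tl n x <= sup (S n).
  by move=> x1; apply: sup_upper_bound => //; exists x.
have sle n d : (forall x, rn x <= 1 -> tl n x <= d) -> sup (S n) <= d.
  by move=> h; apply: ge_sup => // _ [x x1 <-]; exact: h.
have s0 n : 0 <= sup (S n) by apply: le_trans (rn_ge0 _) (ub n 0 _); rewrite rn0.
exists (fun n => sup (S n) + n.+1%:R^-1); split.
- by move=> n; rewrite ltr_wpDl// invr_gt0.
- move=> n; apply: lerD; last by rewrite lef_pV2 ?posrE// ler_nat.
  by apply: sle => x /(ub n); apply: le_trans; exact: cpj_anti.
- move=> d d0; have d2 : 0 < d / 2 by rewrite divr_gt0.
  have [N hN] := compact_tail oe ck d2; have [N' hN'] := invS_small d2.
  exists (maxn N N') => n; rewrite geq_max => /andP[Nn /hN' tn]; rewrite [leRHS]splitr; apply: lerD.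
    by apply: sle => x x1; apply: le_trans (hN n Nn x) _; rewrite ler_piMr// ltW.
  exact: tn.
- move=> n; apply: bop_ball; first by have := lin_comp (cpj_lin e n) ck.1; exact.
  by move=> x /(ub n) h; apply: le_trans h _; rewrite lerDl invr_ge0.
Qed.

Variable r : nat -> R.
Hypotheses (r0 : forall n, 0 < r n) (rS : forall n, r n.+1 <= r n)
  (rcv : forall d, 0 < d -> exists N, forall n, (N <= n)%N -> r n <= d)
  (rb : forall n, bop (fun x => k x - pj n (k x)) (r n)).

(* The sums converge since [(t_i^2 - t_(i+1)^2) / t_i <= 2 (t_i - t_(i+1))], which
   telescopes, where [t_i] is the norm of [(1 - P_i) k x]. *)
Lemma weighted_op (c : nat -> R) : (forall i, 0 <= c i) -> (forall i, c i ^+ 2 * r i <= 1) ->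
  exists2 W, compact_op W & forall x i, dot (W x) (e i) = (c i)%:C * dot (k x) (e i).
Proof.
move=> c0 cr.
pose w n x := \sum_(i < n) ((c i)%:C * dot (k x) (e i)) *: e i.
have wc n x i : dot (w n x) (e i) = if (i < n)%N then (c i)%:C * dot (k x) (e i) else 0.
  elim: n => [|n ih]; first by rewrite /w big_ord0 dot0l.
  rewrite /w big_ord_recr /= -/(w n x) dotDl ih dotZl (ee oe) [in RHS]ltnS [in RHS]leq_eqVlt [in RHS]eq_sym.
  case: eqP => [->|_]; first by rewrite ltnn mulr1 add0r.
  by rewrite mulr0 addr0.
have incr x m j : rn (w (m + j)%N x - w m x) ^+ 2 <= 2 * (tl m x - tl (m + j)%N x) * rn x.
  elim: j => [|j ih]; first by rewrite addn0 !subrr rn0 expr0n /= mulr0 mul0r.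
  rewrite addnS; set n := (m + j)%N in ih *.
  have -> : w n.+1 x - w m x = (w n x - w m x) + ((c n)%:C * dot (k x) (e n)) *: e n.
    by rewrite /w big_ord_recr /= addrAC.
  rewrite rn_pyth; last first.
    by rewrite dotZr dotDl dotNl !wc ltnn ltnNge leq_addr subrr mulr0.
  have -> : rn (((c n)%:C * dot (k x) (e n)) *: e n) ^+ 2 = c n ^+ 2 * (tl n x ^+ 2 - tl n.+1 x ^+ 2).
    have e1 : rn (e n) ^+ 2 = 1 by apply: (@complexI R); rewrite -dotE (ee oe) eqxx.
    rewrite rnZ exprMn e1 mulr1 normcM normc_real exprMn real_normK ?num_real//; congr (_ * _).
    by rewrite /tl (cpjS oe n) addrC addKr.
  have h1 := rb n x; rewrite -/(tl n x) in h1; have h2 : tl n.+1 x <= tl n x by exact: cpj_anti.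
  have h3 := cr n; have h4 := r0 n; have h5 : 0 <= tl n.+1 x by exact: rn_ge0.
  have h6 := rn_ge0 x; have h7 := sqr_ge0 (c n).
  apply: (@le_trans _ _ (2 * (tl m x - tl n x) * rn x + 2 * (tl n x - tl n.+1 x) * rn x)).
    apply: lerD => //.
    have h8 : c n ^+ 2 * tl n x <= rn x.
      apply: (@le_trans _ _ (c n ^+ 2 * (r n * rn x))); first exact: ler_wpM2l.
      by rewrite mulrA ler_piMl.
    exact: sq_diff_le.
  by lra.
have tail x m n : (m <= n)%N -> rn (w n x - w m x) ^+ 2 <= 2 * r m * rn x ^+ 2.
  move=> mn; rewrite -(subnKC mn); apply: le_trans (incr _ _ _) _.
  have h1 := rb m x; rewrite -/(tl m x) in h1.
  have h2 : 0 <= tl (m + (n - m))%N x by exact: rn_ge0.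
  rewrite expr2 mulrA; apply: ler_wpM2r; first exact: rn_ge0.
  by rewrite -mulrA ler_pM2l//; lra.
have small d : 0 < d -> exists N, forall x m n, (N <= m)%N -> (N <= n)%N ->
    rn (w m x - w n x) <= d * rn x.
  move=> d0; have [|N hN] := rcv (d := (d / 2) ^+ 2 / 2); first by rewrite divr_gt0// exprn_gt0// divr_gt0.
  have hN' x n : (N <= n)%N -> rn (w n x - w N x) <= d / 2 * rn x.
    move=> Nn; rewrite -rn_sq_le ?mulr_ge0 ?rn_ge0 ?divr_ge0 ?(ltW d0)//.
    apply: le_trans (tail _ _ _ Nn) _; rewrite exprMn; apply: ler_wpM2r; first exact: sqr_ge0.
    by have := hN N (leqnn _); lra.
  exists N => x m n /(hN' x) hm /(hN' x) hn; rewrite rn_distC in hn.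
  by apply: le_trans (rn_tri (w N x) _ _) _; move: hm hn (rn_ge0 x) => *; lra.
have cv x : exists l : H, forall d, 0 < d -> exists N, forall n, (N <= n)%N -> rn (w n x - l) <= d.
  apply: rn_complete => d d0; have x1 : 0 < rn x + 1 by rewrite ltr_wpDl ?rn_ge0.
  have [N hN] := small _ (divr_gt0 d0 x1); exists N => m n Nm Nn; apply: le_trans (hN x _ _ Nm Nn) _.
  by rewrite mulrAC ler_pdivrMr// ler_pM2l// lerDl.
pose W x := sval (cid (cv x)).
have WP x := svalP (cid (cv x)).
have We x i : dot (W x) (e i) = (c i)%:C * dot (k x) (e i).
  by apply: (dot_closed (WP x)); exists i.+1 => n hn; rewrite wc hn.
have linW : linear W.
  move=> z x y; apply: (onb_inj oe) => i.
  rewrite dotDl dotZl !We ck.1 dotDl dotZl mulrDr mulrCA//.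
exists W => //; apply: compact_approx => // d d0.
have [N hN] := small _ d0; exists (w N).
  have [t t0 bk] := compact_bop ck.
  apply: (@compact_sum R H N (fun i x => ((c i)%:C * dot (k x) (e i)) *: e i)) => i.
  have := compact_scale (c i)%:C (compact_compl (rk1_lin (e i) (e i)) (_ : bop _ 1) ck).
  have b1 : bop (rk1 (e i) (e i)) 1.
    move=> x; have e1 : rn (e i) = 1.
      have : rn (e i) ^+ 2 = 1 by apply: (@complexI R); rewrite -dotE (ee oe) eqxx.
      by move=> /eqP; rewrite sqrf_eq1 => /orP[/eqP|/eqP h] //; have := rn_ge0 (e i); rewrite h; lra.
    by rewrite /rk1 rnZ e1 mulr1 mul1r; have := cauchy_schwarz x (e i); rewrite e1 mulr1.
  by move=> /(_ b1); congr compact_op; apply/funext => x; rewrite /rk1 /= scalerA.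
move=> x; apply/ler_addgt0Pl => s s0; have [N1 hN1] := WP x _ s0.
pose n := maxn N N1; apply: le_trans (rn_tri (w n x) _ _) _; apply: lerD.
  by rewrite rn_distC; apply: hN1; exact: leq_maxr.
by apply: hN => //; exact: leq_maxl.
Qed.

(** Parseval's identity for a finite combination of inner products, so that an identity between
    several operators can be checked coefficient by coefficient. *)
Lemma parseval (u v : nat -> H) (s : nat -> R) m :
  (forall i, \sum_(j < m) (s j)%:C * (dot (u j) (e i) * conjc (dot (v j) (e i))) = 0) ->
  \sum_(j < m) (s j)%:C * dot (u j) (v j) = 0.
Proof.
move=> h; apply/eq0_normc/le_anti; rewrite normc_ge0 andbT; apply/ler_addgt0Pl => d d0.
pose K := \sum_(j < m) `|s j| * rn (v j) + 1.
have K0 : 0 < K by rewrite ltr_wpDl// sumr_ge0// => j _; rewrite mulr_ge0 ?rn_ge0.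
have dK := divr_gt0 d0 K0.
have [N hN] : exists N, forall j : 'I_m, rn (u j - pj N (u j)) <= d / K.
  have [f hf] : exists f : nat -> nat, forall j n, (f j <= n)%N -> rn (u j - pj n (u j)) <= d / K.
    exists (fun j => sval (cid (oe.2 (u j) _ dK))) => j; exact: svalP (cid (oe.2 (u j) _ dK)).
  exists (\max_(j < m) f j)%N => j; apply: hf; exact: leq_bigmax.
have E : \sum_(j < m) (s j)%:C * dot (pj N (u j)) (v j) = 0.
  under eq_bigr => j _ do rewrite pjE dot_suml mulr_sumr.
  rewrite exchange_big /= big1 // => i _; rewrite -[RHS](h i); apply: eq_bigr => j _.
  by rewrite dotZl [dot (e i) _]dotC.
rewrite (_ : \sum_(j < m) _ = \sum_(j < m) ((s j)%:C * dot (u j) (v j) -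
  (s j)%:C * dot (pj N (u j)) (v j))) ?addr0; last by rewrite sumrB E subr0.
apply: (@le_trans _ _ (\sum_(j < m) (`|s j| * rn (v j)) * (d / K))); last first.
  by rewrite -mulr_suml mulrA ler_pdivrMr// mulrC; apply: ler_wpM2l; rewrite ?(ltW d0)// lerDl.
have nsum n (F : 'I_n -> R[i]) : normc (\sum_i F i) <= \sum_i normc (F i).
  by apply: (big_ind2 (fun a b => normc a <= b)) => // [|a b a' b' h1 h2];
    [rewrite normc0|apply: le_trans (le_normcD _ _) _; exact: lerD].
apply: le_trans (nsum _ _) _; apply: ler_sum => j _.
rewrite -mulrBr normcM normc_real -mulrA; apply: ler_wpM2l => //.
rewrite -dotNl -dotDl mulrC; apply: le_trans (cauchy_schwarz _ _) _.
by apply: ler_wpM2r; rewrite ?rn_ge0.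
Qed.

(** [q] weights the coefficients of [k x] by the roots of [1 / r i]. Since [r] decreases, the
    weights [p i] that remain after subtracting [1 / r n] for [i >= n] are non-negative, so the
    difference is again of the form [W^* W] with [W] compact. An identity between compact operators
    is required because positivity has to be carried into the stabilization through [tens]. *)
Lemma tail_factor : exists2 q, compact_op q & forall n, exists2 W, compact_op W &
  forall x y, dot (W x) (W y) + (r n)^-1%:C * dot (k x - pj n (k x)) (k y - pj n (k y)) =
    dot (q x) (q y).
Proof.
have rV i : 0 <= (r i)^-1 by rewrite invr_ge0 ltW.
have [|i|q cq hq] := @weighted_op (fun i => Num.sqrt (r i)^-1).
- by move=> i; exact: sqrtr_ge0.
- by rewrite sqr_sqrtr// mulVf// gt_eqF.
exists q => // n.
have ranti m i : (m <= i)%N -> r i <= r m.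
  by move=> /subnK <-; elim: (i - m)%N => // j ih; apply: le_trans ih; rewrite addSn.
pose p i : R := (r i)^-1 - (if (n <= i)%N then (r n)^-1 else 0).
have p0 i : 0 <= p i.
  rewrite /p; case: ifP => ni; last by rewrite subr0.
  by rewrite subr_ge0 lef_pV2 ?posrE//; exact: ranti.
have pr i : p i * r i <= 1.
  have -> : p i * r i = 1 - (if (n <= i)%N then (r n)^-1 else 0) * r i.
    by rewrite mulrBl mulVf// gt_eqF.
  by rewrite lerBlDr lerDl; apply: mulr_ge0; [case: ifP|exact: ltW].
have [|i|W cW hW] := @weighted_op (fun i => Num.sqrt (p i)).
- by move=> i; exact: sqrtr_ge0.
- by rewrite sqr_sqrtr.
exists W => // x y.
(* The claimed identity, moved to one side, is a combination of three inner products with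
   coefficients 1, [1 / r n] and -1. *)
pose u (j : nat) z := if j == 0%N then W z else if j == 1%N then k z - pj n (k z) else q z.
pose s (j : nat) : R := if j == 0%N then 1 else if j == 1%N then (r n)^-1 else -1.
have := @parseval (u^~ x) (u^~ y) s 3; rewrite !big_ord_recl big_ord0 /u /s /= => h.
apply/eqP; rewrite -subr_eq0; apply/eqP; rewrite -[RHS]h.
  by rewrite mul1r addr0 rmorphN /= mulN1r addrA.
move=> i; rewrite !big_ord_recl big_ord0 /= !hW !hq !conjcRM addr0.
rewrite !dotDl !dotNl !(dot_pj oe) rmorphB /=.
have sq (t : R) z w : 0 <= t -> (Num.sqrt t)%:C * z * ((Num.sqrt t)%:C * w) = t%:C * (z * w).
  by move=> t0; rewrite mulrACA -rmorphM /= -expr2 sqr_sqrtr.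
rewrite !sq//; set z := _ * conjc _; rewrite /p; case: ltnP => ni.
  by rewrite !subrr !subr0 mul0r mulr0 add0r mul1r rmorphN /= mulN1r subrr.
have -> : conjc (0 : R[i]) = 0 by rewrite -{1}[0]/(0%:C) conjc_real.
rewrite !subr0 -/z rmorphN /= mul1r mulN1r rmorphB /= mulrBl addrA subrK subrr//.
Qed.
End TailFactor.

(** * Stabilization *)

Section Stab.
Variables (R : realType) (A : cstarAlgType R) (H : hilbertSpace R) (AK : stabilization A H).
Variables (e : nat -> H) (oe : onb e).
Implicit Types (a b : A) (X Y Z : AK) (k l q : H -> H) (d : R).
Local Notation rk := (@rn R AK).
Local Notation inj := (@inj R AK).
Local Notation nm := (@unm R (unitz AK)).
Local Notation dot := (@dot R H).
Local Notation pj := (@pj R H e).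
Local Notation tens := (@tens R A H AK).

Lemma tens0l k : compact_op k -> tens 0 k = 0.
Proof. by move=> ck; have := tens_linl AK ck (-1) 0 0; rewrite scaler0 addr0 scaleN1r addNr. Qed.
Lemma tensDl k a b : compact_op k -> tens (a + b) k = tens a k + tens b k.
Proof. by move=> ck; have := tens_linl AK ck 1 a b; rewrite !scale1r. Qed.
Lemma tensZl k (z : R[i]) a : compact_op k -> tens (z *: a) k = z *: tens a k.
Proof. by move=> ck; have := tens_linl AK ck z a 0; rewrite tens0l// !addr0. Qed.
Lemma tensNl k a : compact_op k -> tens (- a) k = - tens a k.
Proof. by move=> ck; rewrite -scaleN1r tensZl// scaleN1r. Qed.
Lemma tens0r a : tens a (fun=> 0) = 0.
Proof.
rewrite -[RHS](addNr (tens a (fun=> 0))) -scaleN1r -tens_linr; try exact: compact_zero.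
by congr (tens a _); apply/funext => x; rewrite scaler0 addr0.
Qed.
Lemma tensDr a k l : compact_op k -> compact_op l -> tens a (fun x => k x + l x) = tens a k + tens a l.
Proof.
move=> ck cl; have := tens_linr AK a 1 ck cl; rewrite scale1r => <-.
by congr (tens a _); apply/funext => x; rewrite scale1r.
Qed.
Lemma tensZr a (z : R[i]) k : compact_op k -> tens a (fun x => z *: k x) = z *: tens a k.
Proof.
move=> ck; have := tens_linr AK a z ck (compact_zero H); rewrite tens0r addr0 => <-.
by congr (tens a _); apply/funext => x; rewrite addr0.
Qed.
Lemma tensBr a k l : compact_op k -> compact_op l -> tens a (fun x => k x - l x) = tens a k - tens a l.
Proof.
move=> ck cl; rewrite -[- tens a l]scaleN1r -tensZr// -tensDr//; last exact: compact_scale.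
by congr (tens a _); apply/funext => x; rewrite scaleN1r.
Qed.

Lemma compact_comp k l : compact_op k -> compact_op l -> compact_op (k \o l).
Proof. by move=> ck cl; have [t _ bk] := compact_bop ck; exact: compact_compl ck.1 bk cl. Qed.

Lemma tens_star_mul a k k' l b : compact_op k -> compact_op k' -> adjoint_op k k' -> compact_op l ->
  cstar (tens a k) ** tens b l = tens (cstar a ** b) (k' \o l).
Proof. by move=> ck ck' kk' cl; rewrite (tens_star AK a ck ck' kk') tensM. Qed.

Lemma tens_tail a k d : compact_op k -> 0 < d -> exists N, forall n, (N <= n)%N ->
  rk (tens a k - tens a (pj n \o k)) <= d.
Proof.
move=> ck d0; have [r [r0 rS rcv rb]] := tail_rate oe ck.
have [q cq hq] := tail_factor oe ck r0 rS rcv rb.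
pose K := rk (tens a q) ^+ 2 + 1; have K0 : 0 < K by rewrite ltr_wpDl// sqr_ge0.
have d2 : 0 < d ^+ 2 / K by rewrite divr_gt0// exprn_gt0.
have [N hN] := rcv _ d2; exists N => n Nn; have [W cW hW] := hq n.
have cpk : compact_op (pj n \o k) by apply: compact_comp => //; exact: compact_pj.
rewrite -tensBr//; set kn := fun x => _ : H; have ckn : compact_op kn by exact: compact_sub.
have [q' cq' qq'] := compact_adjoint oe cq; have [W' cW' WW'] := compact_adjoint oe cW.
have [l cl kl] := compact_adjoint oe ckn.
have E : cstar (tens a q) ** tens a q = cstar (tens a W) ** tens a W +
    (r n)^-1%:C *: (cstar (tens a kn) ** tens a kn).
  rewrite (tens_star_mul _ _ cq cq' qq' cq) (tens_star_mul _ _ cW cW' WW' cW).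
  rewrite (tens_star_mul _ _ ckn cl kl ckn) -tensZr -?tensDr; try exact: compact_comp.
    congr (tens _ _); apply/funext => x; apply: dot_inj => z.
    rewrite dotDl dotZl !/(comp _ _ _) [LHS](adjoint_sym qq') -[hdot _ _ _]hW; congr (_ + _ * _).
      exact/esym/(adjoint_sym WW').
    exact/esym/(adjoint_sym kl).
  by apply: compact_scale; exact: compact_comp.

have h : nm (sc _ (r n)^-1 * (ust (inj (tens a kn)) * inj (tens a kn))) <=
    nm (ust (inj (tens a q)) * inj (tens a q)).
  apply: unm_mono; first by apply: cposZ; [rewrite invr_ge0 ltW|exact: cpos_star].
  rewrite -!inj_star -!injM E injD injZ -scE addrK injM inj_star; exact: cpos_star.
have rp := r0 n.
rewrite unm_scM !unm_star !unm_inj gtr0_norm ?invr_gt0// ler_pdivrMl// in h.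
have d00 := ltW d0.
suff : rk (tens a kn) ^+ 2 <= d ^+ 2 by rewrite ler_sqr ?nnegrE ?rn_ge0.
apply: le_trans h _; apply: (@le_trans _ _ (d ^+ 2 / K * K)); last by rewrite divfK// gt_eqF.
by apply: ler_pM => //; [exact: ltW|exact: sqr_ge0|exact: hN|rewrite lerDl].
Qed.

Lemma tens_tail' a k d : compact_op k -> 0 < d -> exists N, forall n, (N <= n)%N ->
  rk (tens a k - tens a (k \o pj n)) <= d.
Proof.
move=> ck d0; have [k' ck' kk'] := compact_adjoint oe ck.
have [N hN] := tens_tail (cstar a) ck' d0; exists N => n /hN.
have cp := compact_pj e n; have adj : adjoint_op (pj n \o k') (k \o pj n).
  by move=> x y; rewrite [LHS]pj_adj; exact: (adjoint_sym kk').
rewrite -(tens_star AK _ ck ck' kk') -[tens (cstar a) _]cstarK.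
rewrite (tens_star AK _ _ _ adj) ?cstarK; try exact: compact_comp.
rewrite -unm_inj injB !inj_star -ustB unm_ust -injB unm_inj//.
Qed.

Definition mu i j : H -> H := rk1 (e i) (e j).
Lemma muE i j x : mu i j x = dot x (e j) *: e i. Proof. by []. Qed.
Lemma compact_mu i j : compact_op (mu i j). Proof. exact: compact_rk1. Qed.
Lemma mu_adj i j : adjoint_op (mu i j) (mu j i). Proof. exact: adjoint_rk1. Qed.
Lemma mu_comp i j i' j' : mu i j \o mu i' j' = fun x => (j == i')%:R *: mu i j' x.
Proof.
apply/funext => x; rewrite /mu /rk1 /= dotZl (ee oe) scalerA mulrC; congr (_ *: _).
by rewrite eq_sym.
Qed.
Hint Resolve compact_mu : core.

Definition mt (s : seq (A * nat * nat)) : AK := \sum_(t <- s) tens t.1.1 (mu t.1.2 t.2).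
Definition mcl X := forall d, 0 < d -> exists s, rk (X - mt s) <= d.

Lemma mt_cat s1 s2 : mt (s1 ++ s2) = mt s1 + mt s2. Proof. exact: big_cat. Qed.

Lemma mclD X Y : mcl X -> mcl Y -> mcl (X + Y).
Proof.
move=> hX hY d d0; have [s1 h1] := hX _ (nm_half d0); have [s2 h2] := hY _ (nm_half d0).
exists (s1 ++ s2); rewrite mt_cat opprD addrACA [leRHS]splitr.
by apply: le_trans (rnD _ _) _; exact: lerD.
Qed.

Lemma mcl_closed X : (forall d, 0 < d -> exists2 Y, mcl Y & rk (X - Y) <= d) -> mcl X.
Proof.
move=> h d d0; have [Y hY XY] := h _ (nm_half d0); have [s hs] := hY _ (nm_half d0).
by exists s; apply: le_trans (rn_tri Y _ _) _; rewrite [leRHS]splitr; exact: lerD.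
Qed.

Lemma mcl0 : mcl 0.
Proof. by move=> d d0; exists [::]; rewrite /mt big_nil subrr rn0 ltW. Qed.

Lemma mcl_mu a (z : R[i]) i j : mcl (tens a (fun x => z *: mu i j x)).
Proof.
move=> d d0; exists [:: (z *: a, i, j)]; rewrite /mt big_seq1 /= tensZl// tensZr//.
by rewrite subrr rn0 ltW.
Qed.

Lemma mcl_sum a n (F : nat -> H -> H) : (forall i, compact_op (F i)) ->
  (forall i, mcl (tens a (F i))) -> mcl (tens a (fun x => \sum_(i < n) F i x)).
Proof.
move=> cF hF; elim: n => [|n ih].
  by rewrite (_ : (fun x => _) = fun=> 0) ?tens0r; [exact: mcl0|apply/funext => x; rewrite big_ord0].
rewrite (_ : (fun x => _) = fun x => \sum_(i < n) F i x + F n x); last first.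
  by apply/funext => x; rewrite big_ord_recr.
by rewrite tensDr//; [exact: mclD|exact: compact_sum].
Qed.

Lemma mcl_tens a k : compact_op k -> mcl (tens a k).
Proof.
move=> ck; apply: mcl_closed => d d0; have [N /(_ N (leqnn _)) hN] := tens_tail a ck d0.
have cpk : compact_op (pj N \o k) by apply: compact_comp => //; exact: compact_pj.
exists (tens a (pj N \o k)) => //; apply: mcl_closed => d' d'0.
have [M /(_ M (leqnn _)) hM] := tens_tail' a cpk d'0.
exists (tens a ((pj N \o k) \o pj M)) => //.
have -> : (pj N \o k) \o pj M = fun x => \sum_(j < M) \sum_(i < N) dot (k (e j)) (e i) *: mu i j x.
  apply/funext => x /=; rewrite [X in k X]pjE (lin_sum _ _ ck.1) (lin_sum _ _ (pj_lin e N)).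
  apply: eq_bigr => j _; rewrite (linZ _ _ ck.1) (linZ _ _ (pj_lin e N)) pjE scaler_sumr.
  by apply: eq_bigr => i _; rewrite /mu /rk1 !scalerA mulrC.
apply: (@mcl_sum a M (fun j x => \sum_(i < N) dot (k (e j)) (e i) *: mu i j x)) => j.
  by apply: (@compact_sum R H N (fun i x => dot (k (e j)) (e i) *: mu i j x)) => i; exact: compact_scale.
apply: (@mcl_sum a N (fun i x => dot (k (e j)) (e i) *: mu i j x)) => i; last exact: mcl_mu.
exact: compact_scale.
Qed.

Lemma mt_dense X : mcl X.
Proof.
apply: mcl_closed => d d0.
have [||Y [XY [n [a [k [ck YE]]]]]] := @tens_dense _ _ _ AK (ball X d%:C).
- by exists X; apply: ballxx; rewrite ltcR.
- by apply: ball_open; rewrite ltcR.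
exists Y.
  by rewrite YE; apply: (big_ind mcl) => [|Y' Z|i _]; [exact: mcl0|exact: mclD|exact: mcl_tens].
by move: XY; rewrite -ball_normE /= rnE ltcR => /ltW.
Qed.

Lemma mu_star_mul a b i j i' j' : cstar (tens a (mu i j)) ** tens b (mu i' j') =
  (i == i')%:R *: tens (cstar a ** b) (mu j j').
Proof. by rewrite (tens_star_mul _ _ _ _ (@mu_adj i j))// mu_comp tensZr. Qed.

(** On matrices, left multiplication by the isometry that sends [e i] to [e (f i)]. *)
Definition reix (f : nat -> nat) (s : seq (A * nat * nat)) := [seq (t.1.1, f t.1.2, t.2) | t <- s].

Lemma cmul_suml (I : Type) (r : seq I) (F : I -> AK) Y : (\sum_(i <- r) F i) ** Y = \sum_(i <- r) F i ** Y.
Proof. by apply: (big_morph (fun x => x ** Y)) => [x y|]; [exact: cmulDl|exact: cmul0l]. Qed.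
Lemma cmul_sumr (I : Type) (r : seq I) (F : I -> AK) Y : Y ** (\sum_(i <- r) F i) = \sum_(i <- r) Y ** F i.
Proof. by apply: (big_morph (cmul Y)) => [x y|]; [exact: cmulDr|exact: cmul0r]. Qed.
Lemma cstar_sum (I : Type) (r : seq I) (F : I -> AK) : cstar (\sum_(i <- r) F i) = \sum_(i <- r) cstar (F i).
Proof. by apply: (big_morph cstar) => [x y|]; [exact: cstarD|exact: cstar0]. Qed.

Lemma reix_star_mul f g s s' (P : nat -> nat -> bool) : (forall i j, (f i == g j) = P i j) ->
  cstar (mt (reix f s)) ** mt (reix g s') =
  \sum_(t <- s) \sum_(t' <- s') (P t.1.2 t'.1.2)%:R *: tens (cstar t.1.1 ** t'.1.1) (mu t.2 t'.2).
Proof.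
move=> fg; rewrite /mt !big_map cstar_sum cmul_suml; apply: eq_bigr => t _.
by rewrite cmul_sumr; apply: eq_bigr => t' _; rewrite mu_star_mul /= fg.
Qed.

Lemma reix_iso f s s' : injective f ->
  cstar (mt (reix f s)) ** mt (reix f s') = cstar (mt s) ** mt s'.
Proof.
move=> fi; rewrite (reix_star_mul _ _ (inj_eq fi)).
have reid u : reix id u = u by rewrite /reix -[RHS]map_id; apply: eq_map => -[[? ?] ?].
by rewrite -{2}(reid s) -{2}(reid s') (@reix_star_mul id id s s' eq_op).
Qed.

Lemma reix_orth f g s s' : (forall i j, f i != g j) -> cstar (mt (reix f s)) ** mt (reix g s') = 0.
Proof.
move=> fg; rewrite (@reix_star_mul _ _ _ _ (fun _ _ => false)).
  by rewrite big1 // => t _; rewrite big1 // => t' _; rewrite scale0r.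
by move=> i j; exact/negbTE.
Qed.

Definition mneg (s : seq (A * nat * nat)) := [seq (- t.1.1, t.1.2, t.2) | t <- s].

Lemma mt_neg s : mt (mneg s) = - mt s.
Proof. by rewrite /mt big_map -sumrN; apply: eq_bigr => t _; rewrite tensNl. Qed.

Lemma reix_dist f s s' : injective f -> rk (mt (reix f s) - mt (reix f s')) = rk (mt s - mt s').
Proof.
move=> fi; have E u : rk (mt (reix f u)) = rk (mt u).
  by apply/eqP; rewrite -(@eqrXn2 _ 2) ?rn_ge0// -!rn_star reix_iso.
have -> : mt (reix f s) - mt (reix f s') = mt (reix f (s ++ mneg s')).
  rewrite /reix map_cat mt_cat -mt_neg; congr (_ + mt _).
  by rewrite /mneg -!map_comp.
by rewrite E mt_cat mt_neg.
Qed.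

(** Row shifts preserve distances, so the shifted approximants of [X] are Cauchy. The same [s]
    approximates [X] and, after the shift, [Y]; this is what lets identities between matrices pass
    to the limit. *)
Lemma reix_lim f X : injective f -> exists Y, forall d, 0 < d ->
  exists s, rk (X - mt s) <= d /\ rk (Y - mt (reix f s)) <= d.
Proof.
move=> fi; have H0 n : 0 < n.+1%:R^-1 :> R by rewrite invr_gt0.
pose s n := sval (cid (mt_dense X (H0 n))).
have sP n : rk (X - mt (s n)) <= n.+1%:R^-1 := svalP (cid (mt_dense X (H0 n))).
have small d : 0 < d -> exists N, forall n, (N <= n)%N -> rk (X - mt (s n)) <= d.
  by move=> /invS_small[N hN]; exists N => n /hN; exact: le_trans (sP n).
have [Y hY] : exists Y : AK, forall d, 0 < d -> exists N, forall n, (N <= n)%N ->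
    rk (mt (reix f (s n)) - Y) <= d.
  apply: rn_complete => d d0; have [N hN] := small _ (nm_half d0).
  exists N => m n /hN hm /hN hn; rewrite reix_dist//; rewrite rn_distC in hm.
  by apply: le_trans (rn_tri X _ _) _; rewrite [leRHS]splitr; exact: lerD.
exists Y => d d0; have [N1 h1] := small _ d0; have [N2 h2] := hY _ d0.
exists (s (maxn N1 N2)); split; first by apply: h1; exact: leq_maxl.
by rewrite rn_distC; apply: h2; exact: leq_maxr.
Qed.

Lemma starmul_cont X Y d : 0 < d -> exists2 t, 0 < t & forall X' Y',
  rk (X - X') <= t -> rk (Y - Y') <= t -> rk (cstar X ** Y - cstar X' ** Y') <= d.
Proof.
move=> d0; pose K := rk X + rk Y + 1.
have X0 := rn_ge0 X; have Y0 := rn_ge0 Y; have K0 : 0 < K by rewrite /K; lra.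
exists (Num.min 1 (d / K)); first by rewrite lt_min ltr01 divr_gt0.
move=> X' Y'; rewrite !le_min => /andP[x1 xd] /andP[y1 yd].
have st Z : rk (cstar Z) = rk Z by rewrite -!unm_inj inj_star unm_ust.
have -> : cstar X ** Y - cstar X' ** Y' = cstar (X - X') ** Y + cstar X' ** (Y - Y').
  apply: (@inj_inj _ AK); rewrite !(injB, injD, injM, inj_star) ustB mulrBl mulrBr.
  by rewrite addrA subrK.
apply: le_trans (rnD _ _) _; apply: le_trans (lerD (rnM _ _) (rnM _ _)) _; rewrite !st.
have X'1 : rk X' <= rk X + 1.
  have -> : X' = X - (X - X') by rewrite subKr.
  by apply: le_trans (rnD _ _) _; rewrite rnN lerD2l.
apply: (@le_trans _ _ (d / K * rk Y + (rk X + 1) * (d / K))).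
  by apply: lerD; [exact: ler_wpM2r|apply: ler_pM; rewrite ?rn_ge0].
by rewrite mulrC -mulrDl (_ : rk Y + (rk X + 1) = K) ?(mulrC K) ?divfK ?gt_eqF// /K addrA (addrC (rk Y)).
Qed.

(** Rows are moved to the even and to the odd positions. The relations hold for matrices and extend
    by continuity of [cstar X ** Y]. *)
Lemma orth_isometries : exists S1 S2 : AK -> AK,
  [/\ forall X Y, cstar (S1 X) ** S1 Y = cstar X ** Y,
      forall X Y, cstar (S2 X) ** S2 Y = cstar X ** Y &
      forall X Y, cstar (S1 X) ** S2 Y = 0].
Proof.
pose f0 i := (i * 2)%N; pose f1 i := (i * 2 + 1)%N.
have fi0 : injective f0 by rewrite /f0 => i j; lia.
have fi1 : injective f1 by rewrite /f1 => i j; lia.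
pose S f fi X := sval (cid (reix_lim (f := f) X fi)).
have SP f fi X : forall d, 0 < d -> exists s, rk (X - mt s) <= d /\ rk (S f fi X - mt (reix f s)) <= d.
  exact: svalP (cid (reix_lim X fi)).
have close X Y : (forall d, 0 < d -> rk (X - Y) <= d) -> X = Y.
  move=> h; apply: (@inj_inj _ AK); apply: unm_le_eps => d /h; by rewrite -injB unm_inj.
have iso f fi X Y : cstar (S f fi X) ** S f fi Y = cstar X ** Y.
  apply: close => d d0; have [t1 t10 h1] := starmul_cont (S f fi X) (S f fi Y) (nm_half d0).
  have [t2 t20 h2] := starmul_cont X Y (nm_half d0).
  have t0 : 0 < Num.min t1 t2 by rewrite lt_min t10.
  have [s [sX sS]] := SP f fi X _ t0; have [s' [sY sS']] := SP f fi Y _ t0.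
  move: sX sS sY sS'; rewrite !le_min => /andP[_ a2] /andP[b1 _] /andP[_ a2'] /andP[b1' _].
  apply: le_trans (rn_tri (cstar (mt s) ** mt s') _ _) _; rewrite [leRHS]splitr; apply: lerD.
    by rewrite -(reix_iso s s' fi); exact: h1.
  by rewrite rn_distC; exact: h2.
exists (S f0 fi0), (S f1 fi1); split => // X Y; apply: close => d d0.
have [t t0 h] := starmul_cont (S f0 fi0 X) (S f1 fi1 Y) d0.
have [s [_ sX]] := SP f0 fi0 X _ t0; have [s' [_ sY]] := SP f1 fi1 Y _ t0.
rewrite -(@reix_orth f0 f1 s s'); first exact: h.
by move=> i j; rewrite /f0 /f1; lia.
Qed.
End Stab.

(** * Injective homomorphisms are isometric with closed range *)

Section Hom.
Variables (R : realType) (A B : cstarAlgType R) (f : A -> B).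
Hypotheses (fD : forall a b, f (a + b) = f a + f b) (fZ : forall (z : R[i]) a, f (z *: a) = z *: f a)
  (fM : forall a b, f (a ** b) = f a ** f b) (fstar : forall a, f (cstar a) = cstar (f a))
  (finj : injective f).
Implicit Types (a b : A) (u v : unitz A) (d t : R).

Definition uhom u : unitz B := (u.1, f u.2).

Lemma uhomD u v : uhom (u + v) = uhom u + uhom v.
Proof. by rewrite /uhom; congr pair; rewrite /= fD. Qed.
Lemma uhomZ (z : R[i]) u : uhom (z *: u) = z *: uhom u.
Proof. by rewrite /uhom; congr pair; rewrite /= fZ. Qed.
Lemma uhomN u : uhom (- u) = - uhom u.
Proof. by rewrite -scaleN1r uhomZ scaleN1r. Qed.
Lemma uhomB u v : uhom (u - v) = uhom u - uhom v.
Proof. by rewrite uhomD uhomN. Qed.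
Lemma uhomM u v : uhom (u * v) = uhom u * uhom v.
Proof. by rewrite /uhom; congr pair; rewrite /= !fD !fZ fM. Qed.
Lemma uhom_star u : uhom (ust u) = ust (uhom u).
Proof. by rewrite /uhom; congr pair; rewrite /= fstar. Qed.
Lemma uhom1 : uhom 1 = 1.
Proof.
have f0 : f 0 = 0 by apply: (addrI (f 0)); rewrite -fD !addr0.
by rewrite /uhom; congr pair; rewrite /= f0.
Qed.
Lemma uhom_sc t : uhom (sc _ t) = sc _ t.
Proof. by rewrite /sc uhomZ uhom1. Qed.
Lemma uhom_inj a : uhom (inj a) = inj (f a). Proof. by []. Qed.
Lemma uhom_eq0 u : uhom u = 0 -> u = 0.
Proof.
have f0 : f 0 = 0 by apply: (addrI (f 0)); rewrite -fD !addr0.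
by case: u => z a [/= -> h]; congr pair; apply: finj; rewrite f0 h.
Qed.

Lemma uhom_cpos u : cpos u -> cpos (uhom u).
Proof.
by move=> /cposP[y [ysa <- _ _]]; rewrite uhomM; apply: cpos_sq; rewrite /sa -uhom_star ysa.
Qed.

Lemma uhom_le u : unm (uhom u) <= unm u.
Proof.
have h : unm (uhom (ust u * u)) <= unm (ust u * u).
  have p := cpos_star u; apply: cpos_le_sc; rewrite ?unm_ge0//; first exact: uhom_cpos.
  by rewrite -uhom_sc -uhomB; apply/uhom_cpos/cpos_sc_sub => //; exact: cpos_sa.
by rewrite uhomM uhom_star !unm_star ler_sqr ?nnegrE ?unm_ge0 in h.
Qed.

Lemma uhom_ev u (p : {poly R}) : uhom (ev u p) = ev (uhom u) p.
Proof.
elim/poly_ind: p => [|p c ih]; last by rewrite !evD !evM !evC !evX uhomD uhomM ih uhom_sc.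
by rewrite -[0 : {poly R}]/(0%:P) !evC uhom_sc.
Qed.

Lemma uhom_fc u (g : R -> R) : cpos u -> llip g -> uhom (fc g u) = fc g (uhom u).
Proof.
move=> upos hg; apply/esym/fc_is; first exact: uhom_cpos.
move=> d d0; have [p hp pd] := fcP upos hg d0; exists p.
  by move=> s /andP[s0 su]; apply: hp; rewrite s0 (le_trans su)// uhom_le.
by rewrite -uhom_ev -uhomB; apply: le_trans (uhom_le _) pd.
Qed.

Lemma uhom_cut d u : cpos u -> uhom (cut d u) = cut d (uhom u).
Proof. by move=> upos; apply: uhom_fc => //; exact: cut_llip. Qed.

(** Cutting a positive [v] at the norm [s] of its image gives an element that is mapped to 0. By
    injectivity the cut-down itself is 0, which means that [v] has norm at most [s]. *)
Lemma uhom_isom u : unm (uhom u) = unm u.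
Proof.
suff h v : cpos v -> unm v <= unm (uhom v).
  apply/le_anti; rewrite uhom_le /=; have := h _ (cpos_star u).
  by rewrite uhomM uhom_star !unm_star ler_sqr ?nnegrE ?unm_ge0.
move=> vpos; set s := unm (uhom v); have s0 : 0 <= s by exact: unm_ge0.
have : cut s v = 0.
  apply: uhom_eq0; rewrite uhom_cut//; have vp := uhom_cpos vpos.
  rewrite -sc0 -(fcC vp); apply: eq_fc => //; [exact: cut_llip|exact: llipC|].
  by move=> t /andP[_ ts]; rewrite /cutf; apply/max_idPr; rewrite subr_le0.
by move=> c0; have := cut_dist s0 vpos; rewrite c0 sub0r unmN.
Qed.

Lemma hom_isom a : rn (f a) = rn a.
Proof. by rewrite -!unm_inj -uhom_inj uhom_isom. Qed.

Lemma hom_closed (X : B) : (forall d, 0 < d -> exists a, rn (X - f a) <= d) -> exists a, X = f a.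
Proof.
move=> h; have H0 n : 0 < n.+1%:R^-1 :> R by rewrite invr_gt0.
pose s n := sval (cid (h _ (H0 n))).
have sP n : rn (X - f (s n)) <= n.+1%:R^-1 := svalP (cid (h _ (H0 n))).
have fB a b : f (a - b) = f a - f b by rewrite fD -scaleN1r fZ scaleN1r.
have small d : 0 < d -> exists N, forall n, (N <= n)%N -> rn (X - f (s n)) <= d.
  by move=> /invS_small[N hN]; exists N => n /hN; exact: le_trans (sP n).
have [a ha] : exists a : A, forall d, 0 < d -> exists N, forall n, (N <= n)%N -> rn (s n - a) <= d.
  apply: rn_complete => d d0; have [N hN] := small _ (nm_half d0).
  exists N => m n /hN hm /hN hn; rewrite -hom_isom fB; rewrite rn_distC in hm.
  by apply: le_trans (rn_tri X _ _) _; rewrite [leRHS]splitr; exact: lerD.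
exists a; apply: (@inj_inj _ B); apply: unm_le_eps => d d0; rewrite -injB unm_inj.
have [N1 h1] := small _ (nm_half d0); have [N2 h2] := ha _ (nm_half d0).
apply: le_trans (rn_tri (f (s (maxn N1 N2))) _ _) _; rewrite [leRHS]splitr; apply: lerD.
  by apply: h1; exact: leq_maxl.
by rewrite -fB hom_isom; apply: h2; exact: leq_maxr.
Qed.
End Hom.

(** * The corner embedding of [A] into its stabilization *)

Section Iota.
Variables (R : realType) (A : cstarAlgType R) (H : hilbertSpace R) (AK : stabilization A H).
Variables (e : nat -> H) (oe : onb e).
Implicit Types (a b p q : A) (X Y Z : AK) (d : R).
Local Notation rk := (@rn R AK).
Local Notation tens := (@tens R A H AK).
Local Notation mu := (@mu R H e).
Hint Resolve compact_mu : core.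

Definition iota a : AK := tens a (mu 0%N 0%N).

Lemma iotaE a : iota a = tens a (mu 0%N 0%N). Proof. by []. Qed.
Lemma iotaD a b : iota (a + b) = iota a + iota b. Proof. exact: tensDl. Qed.
Lemma iotaZ (z : R[i]) a : iota (z *: a) = z *: iota a. Proof. exact: tensZl. Qed.
Lemma iotaM a b : iota (a ** b) = iota a ** iota b.
Proof. by rewrite /iota tensM// (mu_comp oe) eqxx tensZr// scale1r. Qed.
Lemma iota_star a : iota (cstar a) = cstar (iota a).
Proof. by rewrite /iota (tens_star AK _ _ _ (mu_adj _ _ _)). Qed.
Lemma iota_inj : injective iota.
Proof.
move=> a b ab; apply/eqP; rewrite -subr_eq0; apply/eqP.
apply: (@tens_inj _ _ _ AK 1 (fun=> a - b) (fun=> mu 0%N 0%N) _ _ _ ord0) => //.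
  move=> c /(_ (e 0%N)); rewrite big_ord1 muE (ee oe) eqxx scale1r => h i.
  have := congr1 (fun x => dot x (e 0%N)) h; rewrite dotZl (ee oe) eqxx mulr1 dot0l.
  by rewrite (ord1 i).
by rewrite big_ord1 -/(iota _) -[a - b]/(a + - b) iotaD -scaleN1r iotaZ scaleN1r ab subrr.
Qed.

Definition ui := uhom iota.

Lemma iota_isom a : rk (iota a) = rn a.
Proof. exact: hom_isom iotaD iotaZ iotaM iota_star iota_inj a. Qed.

(** On matrices the two factors keep only the entry at position (0, 0). Density of the matrices and
    closedness of the range of [iota] do the rest. *)
Lemma iota_her p q X : exists a, iota p ** X ** iota q = iota a.
Proof.
apply: (hom_closed iotaD iotaZ iotaM iota_star iota_inj) => d d0.
pose K := rn p * rn q + 1; have K0 : 0 < K by rewrite ltr_wpDl// mulr_ge0 ?rn_ge0.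
have [s hs] := mt_dense oe X (divr_gt0 d0 K0).
have [a ha] : exists a, iota p ** mt AK e s ** iota q = iota a.
  elim: s {hs} => [|t s [a ha]].
    by exists 0; rewrite /mt big_nil cmul0r cmul0l -(scale0r (0 : A)) iotaZ scale0r.
  exists ((t.1.2 == 0%N)%:R *: ((t.2 == 0%N)%:R *: (p ** t.1.1 ** q)) + a).
  rewrite /mt big_cons -/(mt AK e s) cmulDr cmulDl ha iotaD !iotaZ; congr (_ + _).
  rewrite /iota tensM// (mu_comp oe) tensZr// cmulZl tensM// (mu_comp oe) tensZr//.
  by rewrite eq_sym.
exists a; rewrite -ha.
have -> : iota p ** X ** iota q - iota p ** mt AK e s ** iota q =
    iota p ** (X - mt AK e s) ** iota q.
  by apply: (@inj_inj _ AK); rewrite !(injB, injM) mulrBr mulrBl.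
apply: le_trans (rnM _ _) _; apply: le_trans (ler_wpM2r (rn_ge0 _) (rnM _ _)) _.
rewrite !iota_isom mulrAC; apply: (@le_trans _ _ (K * (d / K))); last by rewrite mulrC divfK// gt_eqF.
by apply: ler_pM; rewrite ?mulr_ge0 ?rn_ge0// lerDl.
Qed.

Lemma iota_pos a : positive a -> positive (iota a).
Proof. by move=> [x ->]; exists (iota x); rewrite iotaM iota_star. Qed.

Lemma iota_cut d a : 0 <= d -> positive a -> cut d (inj (iota a)) = inj (iota (cutdown a d)).
Proof.
move=> d0 apos; have ap : cpos (inj a) by exact/cposB_positive.
have := uhom_cut iotaD iotaZ iotaM iota_star d ap.
by rewrite -(inj_cutdown apos d0) !uhom_inj => ->.
Qed.

(** The approximating [v] and [w] live in the unitization. For [c = v w^*] the scalar part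
    contributes a multiple of [p ** p], and the remaining part is covered by [iota_her]. *)
Lemma iota_rcl p X Y : positive p -> rcl (inj (iota p)) (inj X) -> rcl (inj (iota p)) (inj Y) ->
  exists a, X ** cstar Y = iota a.
Proof.
move=> ppos hX hY; apply: (hom_closed iotaD iotaZ iotaM iota_star iota_inj) => d d0.
have X0 := rn_ge0 X; have Y0 := rn_ge0 Y.
have st Z : rk (cstar Z) = rk Z by rewrite -!unm_inj inj_star unm_ust.
have [t t0 ht] := starmul_cont (cstar X) (cstar Y) d0.
have [v hv] := hX _ t0; have [w hw] := hY _ t0.
have [a ha] : exists a, inj (iota p) * v * ust w * inj (iota p) = inj (iota a).
  set c := v * ust w; have [a ha] := iota_her p p c.2.
  exists (c.1 *: (p ** p) + a); rewrite iotaD injD -ha iotaZ injZ iotaM !injM.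
  rewrite -!mulrA -/c [v * _]mulrA -/c mulrA.
  have {1}-> : c = c.1 *: 1 + inj c.2.
    rewrite [LHS]surjective_pairing; congr pair; rewrite /= ?addr0 ?scaler0 ?add0r//.
    by rewrite /GRing.scale /= mulr1.
  by rewrite mulrDl mulrDr -scalerAl mul1r -scalerAr mulrA.
have psa : ust (inj (iota p)) = inj (iota p) by apply/cpos_sa/cposB_positive/iota_pos.
have V0 : (inj (iota p) * v).1 = 0 by rewrite fstM mul0r.
have W0 : (inj (iota p) * w).1 = 0 by rewrite fstM mul0r.
pose V := (inj (iota p) * v).2; pose W := (inj (iota p) * w).2.
have VE : inj V = inj (iota p) * v by rewrite -fst0E.
have WE : inj W = inj (iota p) * w by rewrite -fst0E.
exists a; have := ht (cstar V) (cstar W).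
have -> : cstar (cstar V) ** cstar W = iota a.
  by apply: (@inj_inj _ AK); rewrite cstarK injM inj_star VE WE ustM psa mulrA ha.
rewrite cstarK; apply; rewrite -unm_inj injB !inj_star -ustB unm_ust unm_distC ?VE ?WE//.
Qed.
End Iota.

(** * The Global Glimm Property and divisibility *)

Section StarLemmas.
Variables (R : realType) (U : ucstarType R).
Implicit Types (u v : U) (e : R).

Lemma star_add_le u v : cle (ust (u + v) * (u + v)) (ust u * u + ust v * v).
Proof.
apply: (@cle_monoZ _ _ 2) => //; [exact: cpos_star|by apply: cposD; exact: cpos_star|].
have -> : sc U 2 * (ust u * u + ust v * v) - ust (u + v) * (u + v) = ust (u - v) * (u - v).
  rewrite sc2 ustD ustB !mulrDl !mulrDr !mulrN !mulNr opprK.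
  set p := ust u * u; set q := ust v * v; set s := ust u * v; set t := ust v * u.
  by rewrite (addrC t) (addrACA p s) opprD addrA addrK opprD (addrC (- t)) addrACA.
exact: cpos_star.
Qed.

Lemma fc_intertw u (f : R -> R) : llip f -> u * fc f (ust u * u) = fc f (u * ust u) * u.
Proof.
move=> hf; have ap := cpos_star u; have bp := cpos_star' u.
have evI p : u * ev (ust u * u) p = ev (u * ust u) p * u.
  elim/poly_ind: p => [|p c ih].
    by rewrite -[0 : {poly R}]/(0%:P) !evC sc_comm.
  by rewrite !evD !evM !evC !evX mulrDr mulrDl sc_comm; congr (_ + _); rewrite mulrA ih !mulrA.
have nn : unm (u * ust u) = unm (ust u * u) by rewrite unm_star -{1}[u]ustK unm_star unm_ust.
apply: unm_le_eps => e e0; have u0 := unm_ge0 u.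
have K0 : 0 < 2 * unm u + 2 by rewrite ltr_wpDl// mulr_ge0.
have d0 := divr_gt0 e0 K0; set d := e / _ in d0.
have [p hp] := llip_approx hf (unm (ust u * u)) d0.
have h1 : unm (fc f (ust u * u) - ev (ust u * u) p) <= d.
  by rewrite unm_distC; apply: is_fc_norm (is_fc_ev _ p) (fcP ap hf) _ => // s /hp.
have h2 : unm (ev (u * ust u) p - fc f (u * ust u)) <= d.
  by apply: is_fc_norm (is_fc_ev _ p) (fcP bp hf) _ => // s; rewrite nn => /hp.
apply: le_trans (unm_tri (u * ev (ust u * u) p) _ _) _.
rewrite -mulrBr evI -mulrBl; apply: le_trans (lerD (unmM _ _) (unmM _ _)) _.
apply: (@le_trans _ _ (unm u * d + d * unm u)).
  by apply: lerD; [exact: ler_wpM2l|exact: ler_wpM2r].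
apply: (@le_trans _ _ (d * (2 * unm u + 2))); first by lra.
by rewrite /d divfK// gt_eqF.
Qed.
End StarLemmas.

Lemma fst_rcl (R : realType) (A : cstarAlgType R) (v u : unitz A) : v.1 = 0 -> rcl v u -> u.1 = 0.
Proof.
move=> v0 h; apply: eq0_normc; apply/le_anti; rewrite normc_ge0 andbT.
apply/ler_addgt0Pl => d /h[w hw]; rewrite addr0; apply: le_trans hw; apply: le_trans (fst_nm _).
by rewrite fstD fstM v0 mul0r add0r -[(- u).1]/(- u.1) normcN.
Qed.

(** * Approximation of elements of the closed ideal generated by [r] *)

Section IdealGen.
Variables (R : realType) (A : cstarAlgType R) (r : A).
Implicit Types (x y : A) (s : seq (unitz A * unitz A)).

Definition bimod s : unitz A := \sum_(p <- s) p.1 * inj r * p.2.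

(** The limits of finite sums of terms [u r v] form a closed ideal that contains [r]. *)
Lemma ideal_gen_bimod x : ideal_gen r x -> forall d : R, 0 < d -> exists s, unm (inj x - bimod s) <= d.
Proof.
have bcat s1 s2 : bimod (s1 ++ s2) = bimod s1 + bimod s2 by exact: big_cat.
have bmul u v s : u * bimod s * v = bimod [seq (u * p.1, p.2 * v) | p <- s].
  by rewrite /bimod big_map mulr_sumr mulr_suml; apply: eq_bigr => p _; rewrite !mulrA.
apply: (_ : ideal_gen r `<=` [set x | forall d : R, 0 < d -> exists s, unm (inj x - bimod s) <= d]).
have mulP u v z : (forall d : R, 0 < d -> exists s, unm (inj z - bimod s) <= d) ->
    forall y, inj y = u * inj z * v -> forall d : R, 0 < d -> exists s, unm (inj y - bimod s) <= d.
  move=> h y yE d d0; have K0 : 0 < unm u * unm v + 1 by rewrite ltr_wpDl// mulr_ge0 ?unm_ge0.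
  have [s hs] := h _ (divr_gt0 d0 K0); exists [seq (u * p.1, p.2 * v) | p <- s].
  rewrite -bmul yE -mulrBl -mulrBr; apply: le_trans (unmM3 _ _ _) _.
  rewrite mulrAC; apply: (@le_trans _ _ ((unm u * unm v + 1) * (d / (unm u * unm v + 1)))).
    by apply: ler_pM; rewrite ?mulr_ge0 ?unm_ge0// lerDl.
  by rewrite mulrC divfK// gt_eqF.
apply: bigcap_inf; split; last first.
  by move=> d d0; exists [:: (1, 1)]; rewrite /bimod big_seq1 mul1r mulr1 subrr unm0 ltW.
split.
- move=> y /closureP hy d d0; have [z hz zy] := hy _ (nm_half d0).
  have [s hs] := hz _ (nm_half d0); exists s; apply: le_trans (unm_tri (inj z) _ _) _.
  by rewrite [leRHS]splitr; apply: lerD => //; rewrite -injB unm_inj rn_distC.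
- by move=> d d0; exists [::]; rewrite /bimod big_nil inj0 subrr unm0 ltW.
- move=> y z hy hz d d0; have [s hs] := hy _ (nm_half d0); have [s' hs'] := hz _ (nm_half d0).
  exists (s ++ s'); rewrite bcat injD opprD addrACA [leRHS]splitr.
  by apply: le_trans (unmD _ _) _; exact: lerD.
- move=> z y hy; apply: (mulP (z *: 1) 1 y hy); rewrite mulr1 injZ -scalerAl mul1r//.
- move=> y z hy; split.
    by apply: (mulP 1 (inj z) y hy); rewrite injM mul1r.
  by apply: (mulP (inj z) 1 y hy); rewrite injM mulr1.
Qed.
End IdealGen.

(** * From the Global Glimm Property to 2-divisibility *)

Section Glimm.
Variables (R : realType) (A : cstarAlgType R) (H : hilbertSpace R) (AK : stabilization A H).
Variables (e : nat -> H) (oe : onb e) (S1 S2 : AK -> AK).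
Hypotheses (S1E : forall X Y, cstar (S1 X) ** S1 Y = cstar X ** Y)
  (S2E : forall X Y, cstar (S2 X) ** S2 Y = cstar X ** Y)
  (S12 : forall X Y, cstar (S1 X) ** S2 Y = 0).
Implicit Types (a b p q : A) (X Y Z : AK) (x y z : Cu AK) (d : R).
Local Notation iota := (iota AK e).
Local Notation S := (cuN S1E S2E S12).
Local Notation ax := (cuN_axioms S1E S2E S12).
Local Notation le := (@cu_le R AK).
Local Notation wb := (@cu_wb R AK).
Local Notation injK := (@inj R AK).
Let iD := @iotaD R A H AK e.
Let iZ := @iotaZ R A H AK e.
Let iM := @iotaM R A H AK e oe.
Let iS := @iota_star R A H AK e.
Let iI := @iota_inj R A H AK e oe.
Local Notation ui := (uhom iota).

Lemma ui_cle (u v : unitz A) : cle u v -> cle (ui u) (ui v).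
Proof.
move=> h d /h[w hw]; exists (ui w).
rewrite -(uhom_star iS) -!(uhomM iD iZ iM) -(uhomB iD iZ).
exact: le_trans (uhom_le iD iZ iM iS _) hw.
Qed.

Lemma iota_positiveE a : positive (iota a) -> positive a.
Proof.
move=> /cposB_positive[sp [t ht]]; apply/cposB_positive; split.
  apply/eqP; rewrite -subr_eq0; apply/eqP; apply: (uhom_eq0 iD iI).
  by rewrite (uhomB iD iZ) (uhom_star iS) uhom_inj sp subrr.
by exists t; rewrite -(uhom_isom iD iZ iM iS iI) (uhomB iD iZ) (uhom_sc iD iZ) uhom_inj.
Qed.

Lemma cu_of_star X : exists x, cu_is x (cstar X ** X).
Proof. by apply: cu_ofP; exists X. Qed.

Lemma cu_is_swap x X : cu_is x (cstar X ** X) <-> cu_is x (X ** cstar X).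
Proof.
have h1 : positive (X ** cstar X) by exists (cstar X); rewrite cstarK.
have h2 : positive (cstar X ** X) by exists X.
by split=> h; apply: (cu_is_ceq h) => //; split; rewrite !injM !inj_star;
  [exact: cle_starC|exact: cle_starC'|exact: cle_starC'|exact: cle_starC].
Qed.

Lemma cle_leP x y X Y : cu_is x X -> cu_is y Y -> cle (injK X) (injK Y) -> le x y.
Proof. by move=> hx hy h; apply/(cu_leP hx hy). Qed.

Lemma cuD_star_le x y z X Y : cu_is z (cstar (X + Y) ** (X + Y)) -> cu_is x (cstar X ** X) ->
  cu_is y (cstar Y ** Y) -> le z (cu_add x y).
Proof.
move=> zP xP yP; apply: (cu_le_addP S1E S2E S12 xP yP zP).
- exact/cposB_positive/(cu_is_pos xP).
- exact/cposB_positive/(cu_is_pos yP).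
- by rewrite !injM !inj_star injD; exact: star_add_le.
- exact/cle_refl/cposB_positive/(cu_is_pos xP).
- exact/cle_refl/cposB_positive/(cu_is_pos yP).
Qed.

(* [y] is dominated by [iota a], so representatives of elements way below [y]
   can be moved into the range of [iota], where the Global Glimm Property applies. *)
Lemma ggp_2her a x : global_glimm A -> cu_is x (iota a) -> positive a ->
  cu_2her (S := S) le wb x.
Proof.
move=> ggp xP apos y y' yx y'y.
have iap := iota_pos AK oe apos; have ia : cpos (injK (iota a)) by exact/cposB_positive.
have [b yb] := cu_repr y; have bp : cpos (injK b) by exact/cposB_positive/(cu_is_pos yb).
have [b' y'b] := cu_repr y'.
have ba : cle (injK b) (injK (iota a)) by apply/(cu_leP yb xP).
have [t t0 ht] := cwb_interp bp (proj1 (cu_wbP y'b yb) y'y).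
have [u hu uE] := cle_exact bp ia ba t0.
have u0 : u.1 = 0 by exact: fst_rcl hu.
pose X := u.2; have XE : injK X = u by rewrite -fst0E.
rewrite -XE in hu uE.
have [c cE] := iota_rcl oe apos hu hu.
have cpos_c : positive c.
  by apply: iota_positiveE; rewrite -cE; exists (cstar X); rewrite cstarK.
have [z zX] := cu_of_star X.
have zc : cu_is z (iota c) by rewrite -cE; apply/cu_is_swap.
have zy : le z y.
  by apply: (cle_leP zX yb); rewrite injM inj_star uE; apply: cut_cle => //; exact: ltW.
have y'z : wb y' z by apply/(cu_wbP y'b zX); rewrite injM inj_star uE.
have icp : cpos (injK (iota c)) by exact/cposB_positive/(cu_is_pos zc).
have [d d0 hd] := proj1 (cu_wbP y'b zc) y'z; have d2 := nm_half d0; have d20 := ltW d2.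
have [r [rher rr rid]] := ggp c (d / 2) cpos_c d2.
have cc : cpos (inj c) by exact/cposB_positive.
have rc : rcl (inj c) (inj r).
  by move=> s /(proj1 (hereditaryP _ _) rher)[v hv]; exists (inj (v ** c));
    rewrite -injM -injB unm_inj cmulA.
have rc' : rcl (inj c) (ust (inj r)).
  move=> s /(proj1 (hereditaryP _ _) rher)[v hv]; exists (inj (cstar v ** c)).
  by rewrite -unm_ust ustB ustK -injM -inj_star -injB unm_inj !cstarM cstarK (cstar_pos cpos_c).
pose rho := iota r.
have [f fP] := cu_of_star rho; have fP' := proj1 (cu_is_swap f rho) fP.
(* [r^2 = 0] makes [rho^* rho] and [rho rho^*] orthogonal. Both represent [f] and lie in the
   hereditary subalgebra of [iota c], so two copies of [f] fit below [z]. *)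
have orth : injK (cstar rho ** rho) * injK (rho ** cstar rho) = 0.
  by rewrite -injM -iS -!iM -cmulA (cmulA r r) rr cmul0l cmul0r -(scale0r (0 : A)) iZ scale0r.
exists f.
suff [k hk] : exists k, le y' (cu_muln k f).
  exists k; split; last by have <- := @cuN_muln _ _ _ _ S1E S2E S12 k f.
  apply: (cu_trans ax _ zy); rewrite mulr2n.
  apply: (cle_leP (cu_addP fP fP' orth) zc).
  have -> : injK (cstar rho ** rho + rho ** cstar rho) =
      ui (ust (inj r) * inj r + inj r * ust (inj r)).
    by rewrite (uhomD iD) !(uhomM iD iZ iM) (uhom_star iS) injD !injM inj_star.
  rewrite -[injK (iota c)]/(ui (inj c)); apply/ui_cle/rcl_pos_cle => //.
    by apply: cposD; [exact: cpos_star|exact: cpos_star'].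
  by apply: rclD; exact: rclMr.
set c' := cutdown c (d / 2) in rid.
have c'p : positive c' by exact: cutdown_pos.
have ic'p : cpos (injK (iota c')) by exact/cposB_positive/iota_pos.
have [g gP] := cu_of_star (iota c').
have y'g : wb y' g.
  apply/(cu_wbP y'b gP).
  have ->: cstar (iota c') ** iota c' = iota c' ** iota c' by rewrite -iS (cstar_pos c'p).
  have h1 : cpos (injK (iota c') * injK (iota c')) by apply: cpos_sq; exact: cpos_sa.
  have cE' : cut (d / 2) (injK (iota c')) = cut d (injK (iota c)).
    by rewrite -(iota_cut AK oe d20 cpos_c) (cut_cut icp d20 d20) -splitr.
  have h2 : cwb (injK b') (injK (iota c')) by exists (d / 2); rewrite ?cE'.
  by rewrite injM; exact: (cwb_trans_le ic'p h1 h2 (cle_sq' ic'p)).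
have [t' t'0 ht'] := proj1 (cu_wbP y'b gP) y'g.
have [s' s'0 hs'] := starmul_cont (iota c') (iota c') (nm_half t'0).
(* The cut-down [c'] is approximated by a finite sum of terms [u r v], each of which is Cuntz below
   [rho]; the number of terms becomes the multiple [k]. *)
have [s hs] := ideal_gen_bimod rid s'0.
pose W := iota (bimod r s).2.
have b0 : (bimod r s).1 = 0.
  by rewrite /bimod; apply: (big_ind (fun u : unitz A => u.1 = 0)) => // [u' v' h1 h2|i _];
    [rewrite fstD h1 h2 addr0|rewrite !fstM mulr0 mul0r].
have WE : injK W = ui (bimod r s) by rewrite (fst0E b0).
have close : rn (cstar (iota c') ** iota c' - cstar W ** W) <= t' / 2.
  have hW : rn (iota c' - W) <= s'.
    rewrite -unm_inj injB WE -uhom_inj -(uhomB iD iZ).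
    exact: le_trans (uhom_le iD iZ iM iS _) hs.
  exact: hs'.
have [w wP] := cu_of_star W.
have y'w : le y' w.
  apply: (cle_leP y'b wP); apply: cle_trans ht' _.
  apply: (kr (d := t' / 2)) => //.
  - exact/cposB_positive/(cu_is_pos gP).
  - exact/cposB_positive/(cu_is_pos wP).
  - by rewrite -injB unm_inj.
  - by rewrite divr_ge0// ltW.
  - by rewrite ltr_pdivrMr// ltr_pMr// ltr1n.
suff [k hk] : exists k, le w (cu_muln k f) by exists k; exact: (cu_trans ax y'w hk).
have {y'w close hs}main : forall s Z z, injK Z = ui (bimod r s) -> cu_is z (cstar Z ** Z) ->
    exists k, le z (cu_muln k f); last exact: main WE wP.
elim=> [|[u1 u2] s1 ih] Z z' ZE zP.
  exists 0%N; apply: (cle_leP zP (cu0_is _)).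
  have -> : Z = 0.
    apply: (@inj_inj _ AK); rewrite ZE /bimod big_nil inj0.
    by have := uhomZ iZ 0 0; rewrite !scale0r.
  by rewrite cmul0r; apply: cle_refl; exact: cpos0.
have bs0 : (bimod r s1).1 = 0.
  by rewrite /bimod; apply: (big_ind (fun u : unitz A => u.1 = 0)) => // [u' v' h1 h2|i _];
    [rewrite fstD h1 h2 addr0|rewrite !fstM mulr0 mul0r].
have [z1 z1P] := cu_of_star (iota (bimod r s1).2).
have E1 : injK (iota (bimod r s1).2) = ui (bimod r s1) by rewrite {2}(fst0E bs0).
have [k hk] := ih _ _ E1 z1P.
have v0 : (u1 * inj r * u2).1 = 0 by rewrite !fstM mulr0 mul0r.
have [z2 z2P] := cu_of_star (iota (u1 * inj r * u2).2).
have E2 : injK (iota (u1 * inj r * u2).2) = ui u1 * injK rho * ui u2.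
  by rewrite -uhom_inj -(fst0E v0) !(uhomM iD iZ iM).
exists k.+1; apply: (cu_trans ax (y := cu_add z2 z1)).
  apply: (cuD_star_le _ z2P z1P).
  have -> // : iota (u1 * inj r * u2).2 + iota (bimod r s1).2 = Z.
  apply: (@inj_inj _ AK); rewrite injD E1 E2 ZE /bimod big_cons (uhomD iD).
  by rewrite !(uhomM iD iZ iM).
apply: (cu_leD ax) => //; apply: (cle_leP z2P fP).
rewrite !injM !inj_star E2; set v := ui u1 * injK rho.
rewrite ustM -mulrA [ust v * _]mulrA mulrA; apply: cle_trans (cle_conj' _ _) _.
apply: cle_trans (cle_starC _) _; rewrite /v ustM.
rewrite -mulrA [injK rho * _]mulrA mulrA; apply: cle_trans (cle_conj _ _) _.
exact: cle_starC'.
Qed.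

Lemma ggp_2div : global_glimm A -> cu_2div (S := S) le wb.
Proof.
move=> ggp; apply: (cu_2her_2div ax) => x' x x'x.
have [c xc] := cu_repr2 x; have [b' x'b] := cu_repr x'.
have [t t0 ht] := proj1 (cu_wbP x'b xc) x'x.
have [s' s'0 hs'] := starmul_cont c c (nm_half t0).
have [s hs] := mt_dense oe c s'0.
have [z zP] := cu_of_star (mt AK e s); exists z.
  apply: (cle_leP x'b zP); apply: cle_trans ht _; apply: (kr (d := t / 2)) => //.
  - exact/cposB_positive/(cu_is_pos xc).
  - exact/cposB_positive/(cu_is_pos zP).
  - by rewrite -injB unm_inj; exact: hs'.
  - by rewrite divr_ge0// ltW.
  - by rewrite ltr_pdivrMr// ltr_pMr// ltr1n.
have sub z1 z2 : le z1 z2 -> cu_2her (S := S) le wb z2 -> cu_2her (S := S) le wb z1.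
  by move=> z12 h y y' yz; apply: h; exact: (cu_trans ax yz z12).
elim: s z {hs} zP => [|[[a i] j] s ih] z zP.
  move=> y y' yz y'y; exists (cu0 AK), 0%N; split; first by rewrite mul0rn; exact: (cu_ge0 ax).
  apply: (cu_trans ax (cu_wbW ax y'y)); apply: (cu_trans ax yz).
  apply: (cle_leP zP (cu0_is _)); rewrite /mt big_nil cmul0r; apply: cle_refl; exact: cpos0.
have [z1 z1P] := cu_of_star (mt AK e s).
have [z2 z2P] := cu_of_star (tens AK a (mu e i j)).
apply: (sub _ (cu_add z2 z1)).
  by apply: (cuD_star_le _ z2P z1P); rewrite /mt big_cons in zP.
apply: (cu_2herD ax); last exact: ih.
have pos : positive (a ** cstar a) by exists (cstar a); rewrite cstarK.
apply: (ggp_2her ggp _ pos).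
(* The class of an elementary tensor with a matrix unit does not depend on the row [i], so the row
   may be moved to 0; exchanging [x^* x] with [x x^*] then lands in the range of [iota]. *)
have -> : iota (a ** cstar a) = tens AK a (mu e 0%N j) ** cstar (tens AK a (mu e 0%N j)).
  rewrite (tens_star AK _ _ _ (mu_adj _ _ _)); try exact: compact_mu.
  by rewrite tensM ?(mu_comp oe) ?eqxx ?tensZr ?scale1r//; exact: compact_mu.
by apply/cu_is_swap; rewrite (mu_star_mul AK oe) eqxx -(eqxx i) -(mu_star_mul AK oe).
Qed.
End Glimm.

(** * The ideal of the stabilization induced by a closed ideal of [A] *)

Section IdealK.
Variables (R : realType) (A : cstarAlgType R) (H : hilbertSpace R) (AK : stabilization A H).
Variables (e : nat -> H) (oe : onb e) (I : set A) (idI : closed_ideal I).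
Implicit Types (a b p q : A) (X Y Z : AK) (d : R).
Local Notation iota := (iota AK e).
Local Notation rk := (@rn R AK).
Local Notation tens := (@tens R A H AK).
Local Notation mu := (@mu R H e).
Hint Resolve compact_mu : core.

Definition iota_ideal X := exists2 c, I c & X = iota c.

Lemma iota_ideal_closed X : (forall d, 0 < d -> exists2 Y, iota_ideal Y & rk (X - Y) <= d) -> iota_ideal X.
Proof.
move=> h; have [clI _ _ _ _] := idI.
have [a Xa] : exists a, X = iota a.
  apply: (hom_closed (iotaD AK e) (iotaZ AK e) (iotaM AK oe) (iota_star AK e) (iota_inj oe)) => d /h[_ [c _ ->]].
  by exists c.
exists a => //; apply: clI; apply/closureP => d /h[_ [c Ic ->]] Xc; exists c => //.
rewrite rn_distC -(iota_isom AK oe); apply: le_trans Xc.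
by rewrite Xa -[a - c]/(a + - c) iotaD -[- c]scaleN1r iotaZ scaleN1r.
Qed.

(** The ideal of the stabilization whose matrix entries lie in [I], described through compressions
    to the corner. *)
Definition idK X := forall b b' i j, iota_ideal (tens b (mu 0%N i) ** X ** tens b' (mu j 0%N)).

Lemma rkM3 X Y Z : rk (X ** Y ** Z) <= rk X * rk Z * rk Y.
Proof. by apply: le_trans (rnM _ _) _; rewrite mulrAC; apply: ler_wpM2r; rewrite ?rn_ge0// rnM. Qed.

Lemma mul3B X Y Y' Z : X ** Y ** Z - X ** Y' ** Z = X ** (Y - Y') ** Z.
Proof. by apply: (@inj_inj _ AK); rewrite !(injB, injM) mulrBr mulrBl. Qed.

Lemma idK_closed X : (forall d, 0 < d -> exists2 Y, idK Y & rk (X - Y) <= d) -> idK X.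
Proof.
move=> h b b' i j; apply: iota_ideal_closed => d d0.
set u := tens b _; set v := tens b' _.
have K0 : 0 < rk u * rk v + 1 by rewrite ltr_wpDl// mulr_ge0 ?rn_ge0.
have [Y JY XY] := h _ (divr_gt0 d0 K0); exists (u ** Y ** v); first exact: JY.
rewrite mul3B; apply: le_trans (rkM3 _ _ _) _.
apply: (@le_trans _ _ ((rk u * rk v + 1) * (d / (rk u * rk v + 1)))).
  by apply: ler_pM; rewrite ?mulr_ge0 ?rn_ge0// lerDl.
by rewrite mulrC divfK// gt_eqF.
Qed.

Lemma iota_idealD X Y : iota_ideal X -> iota_ideal Y -> iota_ideal (X + Y).
Proof.
by have [_ _ ID _ _] := idI; move=> [a Ia ->] [b Ib ->]; exists (a + b); [exact: ID|rewrite iotaD].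
Qed.
Lemma iota_ideal0 : iota_ideal 0.
Proof. by have [_ I0 _ _ _] := idI; exists 0; rewrite // -(scale0r (0 : A)) iotaZ scale0r. Qed.
Lemma iota_idealZ (z : R[i]) X : iota_ideal X -> iota_ideal (z *: X).
Proof. by have [_ _ _ IZ _] := idI; move=> [a Ia ->]; exists (z *: a); [exact: IZ|rewrite iotaZ]. Qed.

Lemma idKD X Y : idK X -> idK Y -> idK (X + Y).
Proof. by move=> hX hY b b' i j; rewrite cmulDr cmulDl; exact: iota_idealD. Qed.
Lemma idK0 : idK 0.
Proof. by move=> b b' i j; rewrite cmul0r cmul0l; exact: iota_ideal0. Qed.

Lemma idKMr X Z : idK X -> idK (X ** Z).
Proof.
move=> JX; apply: idK_closed => d d0; have K0 : 0 < rk X + 1 by rewrite ltr_wpDl ?rn_ge0.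
have [s hs] := mt_dense oe Z (divr_gt0 d0 K0); exists (X ** mt AK e s).
  elim: s {hs} => [|[[a k] l] s ih]; first by rewrite /mt big_nil cmul0r; exact: idK0.
  rewrite /mt big_cons cmulDr; apply: idKD => // b b' i j /=.
  rewrite -!cmulA tensM// (mu_comp oe) tensZr// !cmulZr; apply: iota_idealZ.
  by rewrite cmulA; exact: JX.
have -> : X ** Z - X ** mt AK e s = X ** (Z - mt AK e s).
  by apply: (@inj_inj _ AK); rewrite !(injB, injM) mulrBr.
apply: le_trans (rnM _ _) _; apply: (@le_trans _ _ ((rk X + 1) * (d / (rk X + 1)))).
  by apply: ler_pM; rewrite ?rn_ge0// lerDl.
by rewrite mulrC divfK// gt_eqF.
Qed.

Lemma idKMl X Z : idK X -> idK (Z ** X).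
Proof.
move=> JX; apply: idK_closed => d d0; have K0 : 0 < rk X + 1 by rewrite ltr_wpDl ?rn_ge0.
have [s hs] := mt_dense oe Z (divr_gt0 d0 K0); exists (mt AK e s ** X).
  elim: s {hs} => [|[[a k] l] s ih]; first by rewrite /mt big_nil cmul0l; exact: idK0.
  rewrite /mt big_cons cmulDl; apply: idKD => // b b' i j /=.
  rewrite (cmulA (tens b _)) tensM// (mu_comp oe) tensZr// !cmulZl; apply: iota_idealZ.
  exact: JX.
have -> : Z ** X - mt AK e s ** X = (Z - mt AK e s) ** X.
  by apply: (@inj_inj _ AK); rewrite !(injB, injM) mulrBl.
apply: le_trans (rnM _ _) _; apply: (@le_trans _ _ ((d / (rk X + 1)) * (rk X + 1))).
  by apply: ler_pM; rewrite ?rn_ge0// lerDl.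
by rewrite divfK// gt_eqF.
Qed.

Lemma idK_iota q : I q -> idK (iota q).
Proof.
move=> Iq b b' i j; have [_ _ _ IZ IM] := idI.
rewrite iotaE tensM// (mu_comp oe) tensZr// cmulZl tensM// (mu_comp oe) tensZr//.
apply: iota_idealZ; apply: iota_idealZ; exists (b ** q ** b') => //.
exact: (IM _ b' (IM q b Iq).2).1.
Qed.

Lemma idK_le X Y : positive Y -> idK Y -> cle (inj X) (inj Y) -> idK X.
Proof.
move=> Ypos JY /(cuntz_leP _ Ypos)[v /rn_cvgP h]; apply: idK_closed => d /h[N hN].
exists (v N ** Y ** cstar (v N)); first by apply: idKMr; exact: idKMl.
by rewrite rn_distC; exact: hN.
Qed.

(** [p] is the limit of [g n ** p ** g n] for an approximate unit [g n] taken in [A], and these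
    elements are among the compressions that [idK] tests. *)
Lemma idK_iotaE p : positive p -> idK (iota p) -> I p.
Proof.
move=> ppos Jp; have [clI _ _ _ _] := idI; have [g [gs _ gc]] := auf_conv ppos.
have Ig n : I (g n ** p ** g n).
  have [c Ic] := Jp (g n) (g n) 0%N 0%N; rewrite -/(iota _) -!(iotaM AK oe).
  by move=> /(iota_inj oe) ->.
apply: clI; apply/closureP => d d0; move/rn_cvgP: gc => /(_ _ d0)[N /(_ N (leqnn _)) hN].
by exists (g N ** p ** g N).
Qed.
End IdealK.

(** * From 2-divisibility to the Global Glimm Property *)

Section Converse.
Variables (R : realType) (A : cstarAlgType R) (H : hilbertSpace R) (AK : stabilization A H).
Variables (e : nat -> H) (oe : onb e) (S1 S2 : AK -> AK).
Hypotheses (S1E : forall X Y, cstar (S1 X) ** S1 Y = cstar X ** Y)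
  (S2E : forall X Y, cstar (S2 X) ** S2 Y = cstar X ** Y)
  (S12 : forall X Y, cstar (S1 X) ** S2 Y = 0).
Implicit Types (a b p q : A) (X Y Z : AK) (x y z : Cu AK) (d : R).
Local Notation iota := (iota AK e).
Local Notation S := (cuN S1E S2E S12).
Local Notation ax := (cuN_axioms S1E S2E S12).
Local Notation le := (@cu_le R AK).
Local Notation wb := (@cu_wb R AK).
Local Notation injK := (@inj R AK).

Lemma idK_muln (I : set A) w X k y Y : closed_ideal I -> cu_is w X -> idK e I X ->
  le y (cu_muln k w) -> cu_is y Y -> idK e I Y.
Proof.
move=> idI wX JX.
elim: k y Y => [|k ih] y Y /= yk yY.
  have := proj1 (cu_leP yY (cu0_is AK)) yk; apply: idK_le => //; first exact: positive0.
  exact: idK0.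
have [p [q [wp kq pq]]] := cu_orth2 S1E S2E S12 w (cu_muln k w).
have := proj1 (cu_leP yY (cu_addP wp kq pq)) yk; apply: (idK_le oe idI).
  exact: cu_is_pos (cu_addP wp kq pq).
apply: idKD => //.
  by apply: (idK_le oe idI (cu_is_pos wX) JX); exact: (cu_is_uniq wp wX).1.
by apply: (ih (cu_muln k w)) => //; exact: (cu_refl ax).
Qed.

(* With [b_i = u_i u_i^*] and [s] cutting [b_1 + b_2] down into the hereditary subalgebra of [a],
   the element [n = s u_1 u_2^* s^*] is square-zero and [n n^*] dominates [(b_1 - d)_+]. *)
Lemma two_div_ggp : cu_2div (S := S) le wb -> global_glimm A.
Proof.
move=> div2 a t apos t0; have t2 := nm_half t0; have t20 := ltW t2; have t00 := ltW t0.
have iap := iota_pos AK oe apos; have ia : cpos (injK (iota a)) by exact/cposB_positive.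
have pos2 : positive (iota (cutdown a (t / 2))).
  by apply: (iota_pos AK oe); exact: cutdown_pos.
have pos1 : positive (iota (cutdown a t)) by apply: (iota_pos AK oe); exact: cutdown_pos.
have [x xP] := cu_ofP iap; have [x' xP'] := cu_ofP pos2; have [x'' xP''] := cu_ofP pos1.
have x'x : wb x' x.
  by apply/(cu_wbP xP' xP); rewrite -(iota_cut AK oe t20 apos); exact: cwb_cut.
have x''x' : wb x'' x'.
  have p2 : cpos (injK (iota (cutdown a (t / 2)))) by exact/cposB_positive.
  apply/(cu_wbP xP'' xP').
  have -> : injK (iota (cutdown a t)) = cut (t / 2) (injK (iota (cutdown a (t / 2)))).
    by rewrite -(iota_cut AK oe t20 apos) (cut_cut ia t20 t20) -splitr (iota_cut AK oe t00 apos).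
  exact: cwb_cut.
have [w [k [wx x'w]]] := div2 _ _ x'x.
have [w' w'w x''w'] := cu_splitMn ax (cu_wb_le ax x''x' x'w).
have [z wz] := cu_repr2 w.
set u1 := injK (S1 z); set u2 := injK (S2 z).
have E1 : ust u1 * u1 = injK (cstar z ** z) by rewrite -inj_star -injM S1E.
have E2 : ust u2 * u2 = injK (cstar z ** z) by rewrite -inj_star -injM S2E.
have E12 : ust u1 * u2 = 0 by rewrite -inj_star -injM S12.
have E21 : ust u2 * u1 = 0 by rewrite -[LHS]ustK ustM ustK E12 ust0.
pose X1 := S1 z ** cstar (S1 z); pose X2 := S2 z ** cstar (S2 z).
have wX1 : cu_is w X1 by exact: (cu_is_mulstar wz (S1E _ _)).
have wX2 : cu_is w X2 by exact: (cu_is_mulstar wz (S2E _ _)).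
have XO : injK X1 * injK X2 = 0 by apply: orth_Tr.
set b1 := u1 * ust u1; set b2 := u2 * ust u2.
have X1E : injK X1 = b1 by rewrite injM inj_star.
have X2E : injK X2 = b2 by rewrite injM inj_star.
rewrite X1E X2E in XO.
have b1p : cpos b1 by exact: cpos_star'.
have b2p : cpos b2 by exact: cpos_star'.
have bx : cle (b1 + b2) (injK (iota a)).
  rewrite -X1E -X2E -injD; apply/(cu_leP _ xP); last exact: wx.
  by rewrite mulr2n; apply: (cu_addP wX1 wX2); rewrite X1E X2E.
have [y'' w'y] := cu_repr w'.
have [d d0 hd] := proj1 (cu_wbP w'y wX1) w'w; rewrite X1E in hd; have d00 := ltW d0.
have [s hs sE] := cle_exact (cposD b1p b2p) ia bx d0.
rewrite (cut_orthD b1p b2p XO d00) in sE.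
have s0 : s.1 = 0 by exact: fst_rcl hs.
set c1 := cut d b1 in sE hd; set c2 := cut d b2 in sE.
have c1p : cpos c1 by exact: cut_pos.
have c2p : cpos c2 by exact: cut_pos.
have c1u2 : c1 * u2 = 0.
  have -> : c1 = ust (ust c1) by rewrite ustK.
  apply: (@rcl_orth_star _ _ b1 u2); [|by rewrite (cpos_sa c1p); exact: cut_rcl|exact: rcl_refl].
  by rewrite (cpos_sa b1p) /b1 -mulrA E12 mulr0.
have c2u1 : c2 * u1 = 0.
  have -> : c2 = ust (ust c2) by rewrite ustK.
  apply: (@rcl_orth_star _ _ b2 u1); [|by rewrite (cpos_sa c2p); exact: cut_rcl|exact: rcl_refl].
  by rewrite (cpos_sa b2p) /b2 -mulrA E21 mulr0.
have u1c2 : ust u1 * c2 = 0 by rewrite -[LHS]ustK ustM ustK (cpos_sa c2p) c2u1 ust0.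
have u2c1 : ust u2 * c1 = 0 by rewrite -[LHS]ustK ustM ustK (cpos_sa c1p) c1u2 ust0.
pose n := s * u1 * ust u2 * ust s.
have nn0 : n * n = 0.
  have -> : n * n = s * u1 * ust u2 * (ust s * s) * (u1 * ust u2 * ust s) by rewrite /n !mulrA.
  rewrite sE mulrDr mulrDl -[s * u1 * ust u2 * c1]mulrA u2c1 mulr0 mul0r add0r.
  by rewrite -!mulrA [c2 * (u1 * _)]mulrA c2u1 mul0r !mulr0.
have [r rE] : exists r, s * u1 * ust u2 * ust s = injK (iota r).
  have v0 : (s * u1 * ust u2).1 = 0 by rewrite !fstM s0 !mul0r.
  have hv : rcl (injK (iota a)) (s * u1 * ust u2) by apply: rclMr; exact: rclMr.
  have hv' := hv; rewrite (fst0E v0) in hv'; have hs' := hs; rewrite (fst0E s0) in hs'.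
  have [r rE] := iota_rcl oe apos hv' hs'; exists r.
  by rewrite -rE injM inj_star -!fst0E.
have nr : n = injK (iota r) by [].
have ncl : rcl (injK (iota a)) n by do 3! apply: rclMr.
have ncl' : rcl (injK (iota a)) (ust n).
  by rewrite /n !ustM !ustK !mulrA; do 3! apply: rclMr.
exists r; split.
- apply/hereditaryP => d' d'0; have d'2 := nm_half d'0.
  have [t1 t10 h1] := auf_approx ia ncl d'2; have [t3 t30 h3] := auf_approx ia ncl' d'2.
  have ap : cpos (inj a) by exact/cposB_positive.
  pose G i := fc (auf i) (inj a).
  have GE i : 0 < i -> G i = inj a * fc (resf i) (inj a).
    by move=> i0; rewrite /G fcM ?fc_id//; [exact: llip_id|exact: resf_llip].
  have GE' i : 0 < i -> G i = fc (resf i) (inj a) * inj a.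
    by move=> i0; rewrite GE// fc_comm//; exact: resf_llip.
  (* Approximate units from both sides nearly fix [r]. Each has the form [a (a + t)^-1], so the
     product [G t1 * inj r * G t3] is [a v a], with [v] in [A] because its middle factor is. *)
  pose v := fc (resf t1) (inj a) * inj r * fc (resf t3) (inj a).
  have v0 : v.1 = 0 by rewrite !fstM mulr0 mul0r.
  exists v.2; rewrite -unm_inj injB !injM -fst0E//.
  have -> : inj a * v * inj a = G t1 * inj r * G t3 by rewrite GE// GE'// /v !mulrA.
  have iD := @iotaD R A H AK e; have iZ := @iotaZ R A H AK e.
  have iM := @iotaM R A H AK e oe; have iS := @iota_star R A H AK e.
  rewrite -(uhom_isom iD iZ iM iS (iota_inj oe)) (uhomB iD iZ) !(uhomM iD iZ iM).
  rewrite !(uhom_fc iD iZ iM iS ap); try exact: auf_llip.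
  rewrite -[uhom iota (inj r)]/(injK (iota r)) -nr -[uhom iota (inj a)]/(injK (iota a)).
  set g1 := fc (auf t1) _ in h1 *; set g3 := fc (auf t3) _ in h3 *.
  apply: le_trans (unm_tri (n * g3) _ _) _; rewrite [leRHS]splitr -mulrBl; apply: lerD.
    apply: le_trans (unmM _ _) _; rewrite -[leRHS]mulr1; apply: ler_pM; rewrite ?unm_ge0//.
    apply: fc_norm => //; first exact: auf_llip.
    by move=> i /andP[i0 _]; have /andP[l1 l2] := auf_bnd t30 i0; rewrite ger0_norm.
  have g3s : ust g3 = g3 by apply: fc_sa => //; exact: auf_llip.
  by rewrite -unm_ust ustB ustM g3s.
- apply: (iota_inj oe); apply: (@inj_inj _ AK); rewrite (iotaM AK oe) injM -nr nn0.
  by rewrite -(scale0r (0 : A)) iotaZ scale0r.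
(* Membership is tested in an arbitrary closed ideal [I] of [A] containing [r]. The induced ideal of
   the stabilization contains [n n^*], hence everything below a multiple of its class, in particular
   the cut-down of [iota a]. *)
apply: (_ : forall I, closed_ideal I /\ I r -> I (cutdown a t)) => // I [idI Ir].
have [clI I0 ID IZ IM] := idI.
apply: (idK_iotaE (AK := AK) oe idI); first exact: cutdown_pos.
have NP : positive (iota r ** cstar (iota r)) by exists (cstar (iota r)); rewrite cstarK.
have [f fP] := cu_ofP NP.
have JN : idK e I (iota r ** cstar (iota r)) by apply: idKMr => //; exact: idK_iota.
apply: (idK_muln idI fP JN (k := k) _ xP''); rewrite (@cuN_muln _ _ _ _ S1E S2E S12).
apply: (cu_trans ax x''w'); apply: (cu_leMn ax); apply/(cu_leP w'y fP); apply: cle_trans hd _.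
rewrite injM inj_star -nr.
have [k1 [k1sa k1k k1pos k1com]] := cposP c1p; have [k2 [k2sa k2k k2pos _]] := cposP c2p.
pose K := fc (fun i => i * cutf d i) b1.
have hK : llip (fun i => i * cutf d i) by apply: llipM; [exact: llip_id|exact: cut_llip].
have KE : K = b1 * c1 by rewrite /K fcM ?fc_id//; [exact: llip_id|exact: cut_llip].
have Kp : cpos K.
  by apply: fc_pos => // i /andP[i0 _]; rewrite mulr_ge0// le_max lexx orbT.
have KE' : K = c1 * b1 by rewrite KE -fc_comm//; exact: cut_llip.
(* On the support of [c1] the element [b1] is at least [d], so [d c1 <= b1 c1 = K]. *)
have c1K : cle c1 K.
  apply: (@cle_monoZ _ _ d^-1) => //; first by rewrite invr_gt0.
  apply: (@cpos_scale_inv _ _ d) => //; rewrite mulrBr mulrA -scM divff ?gt_eqF// sc1 mul1r.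
  rewrite -(fcC b1p) -fcM; [|exact: b1p|exact: llipC|exact: cut_llip].
  apply: fc_mono => //; first by apply: llipM; [exact: llipC|exact: cut_llip].
  move=> i /andP[i0 _]; rewrite /cutf; case: (leP (i - d) 0) => id; first by rewrite !mulr0.
  by apply: ler_wpM2r; [exact: ltW|lra].
apply: cle_trans c1K _; apply: cle_trans (cle_sq' Kp) _.
(* [n n^* = P P^*], [P^* P = Q Q^*] and [Q^* Q = K K]: two exchanges of [x^* x] with [x x^*] lead
   from [K K] to [n n^*]. *)
pose P := s * u1 * ust u2 * k2; pose Q := k2 * u2 * ust u1 * k1.
have nP : n * ust n = P * ust P.
  rewrite /n /P !ustM !ustK k2sa !mulrA -[_ * ust s * s]mulrA sE mulrDr.
  rewrite -[s * u1 * ust u2 * c1]mulrA u2c1 mulr0 add0r -k2k !mulrA//.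
rewrite nP; apply: cle_trans (cle_starC _).
have -> : ust P * P = Q * ust Q.
  rewrite /P /Q !ustM !ustK k2sa k1sa !mulrA -[_ * ust s * s]mulrA sE mulrDr.
  rewrite -[_ * ust u1 * c2]mulrA u1c2 mulr0 addr0 -k1k !mulrA//.
apply: cle_trans (cle_starC _).
have -> : ust Q * Q = k1 * (b1 * c1 * b1) * k1.
  have I1 : u2 * cut d (ust u2 * u2) = c2 * u2 by apply: fc_intertw; exact: cut_llip.
  have I2 : u1 * cut d (ust u1 * u1) = c1 * u1 by apply: fc_intertw; exact: cut_llip.
  have -> : ust Q * Q = k1 * (u1 * (ust u2 * (k2 * k2 * u2)) * ust u1) * k1.
    by rewrite /Q !ustM !ustK k2sa k1sa !mulrA.
  have -> : ust u2 * (k2 * k2 * u2) = ust u1 * u1 * cut d (ust u1 * u1).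
    by rewrite k2k -I1 mulrA E2 E1.
  have -> : u1 * (ust u1 * u1 * cut d (ust u1 * u1)) = b1 * c1 * u1.
    by rewrite -mulrA I2 /b1 !mulrA.
  by rewrite /b1 !mulrA.
have k1b1 : b1 * k1 = k1 * b1 by apply/k1com; rewrite -KE KE'.
have -> : k1 * (b1 * c1 * b1) * k1 = K * K.
  have -> : k1 * (b1 * c1 * b1) * k1 = (k1 * b1) * c1 * (b1 * k1) by rewrite !mulrA.
  have -> : K * K = (b1 * k1) * c1 * (k1 * b1) by rewrite {1}KE KE' -k1k !mulrA.
  by rewrite k1b1.
by apply: cle_refl; apply: cpos_sq; exact: cpos_sa.
Qed.
End Converse.

(** * The properties of [A] as properties of the abstract semigroup *)

Section Translation.
Variables (R : realType) (A : cstarAlgType R) (H : hilbertSpace R) (AK : stabilization A H).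
Variables (S1 S2 : AK -> AK).
Hypotheses (S1E : forall X Y, cstar (S1 X) ** S1 Y = cstar X ** Y)
  (S2E : forall X Y, cstar (S2 X) ** S2 Y = cstar X ** Y)
  (S12 : forall X Y, cstar (S1 X) ** S2 Y = 0).
Local Notation S := (cuN S1E S2E S12).
Local Notation le := (@cu_le R AK).
Local Notation wb := (@cu_wb R AK).

Lemma mulnE n (x : S) : cu_muln n x = x *+ n. Proof. exact: cuN_muln. Qed.

Lemma lesE (x y : S) : cu_les x y <-> cu_ls (S := S) le x y.
Proof. by split=> -[k h]; exists k; move: h; rewrite !mulnE. Qed.

Lemma has_comparisonE n : has_comparison AK n <-> cu_scomp (S := S) le n.
Proof. by split=> h x y xy; apply: h => j; apply/lesE. Qed.

Lemma almost_unperforatedE : almost_unperforated AK <-> cu_unperf (S := S) le.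
Proof.
have E (y : 'I_1 -> S) : cu_sum y = y ord0 by rewrite cuN_sum big_ord1.
split=> [h x y xy|h x y xy].
  by have := h x (fun=> y); rewrite E; apply => j; exact/lesE.
by rewrite E; apply: h; exact/lesE.
Qed.

Lemma almost_divisibleE : almost_divisible AK <-> cu_divisible (S := S) le wb.
Proof.
by split=> h x' x /h{}h N; have [y] := h N; exists y; rewrite -?mulnE// -?mulnE//; rewrite !mulnE.
Qed.
End Translation.

Theorem theorem5p6 (R : realType) (A : cstarAlgType R)
    (H : hilbertSpace R) (Hsep : hilb_separable H) (Hinf : hilb_infinite_dim H)
    (AK : stabilization A H) (m M : nat)
    (Hcomp : has_comparison AK m)
    (Hdiv : forall N : nat, (1 <= N)%N ->
      forall x' x : Cu AK, cu_wb x' x ->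
      exists y : Cu AK,
        cu_wb x' (cu_muln N y) /\ cu_wb (cu_muln N y) (cu_muln M x)) :
  (global_glimm A <->
   exists L : nat, forall x' x : Cu AK, cu_wb x' x ->
     exists y0 y1 : Cu AK,
       [/\ cu_le (cu_add y0 y1) x,
           cu_wb x' (cu_muln L y0) & cu_wb x' (cu_muln L y1)]) /\
  (global_glimm A <-> pure AK).
Proof.
have [e oe] := onb_exists Hsep Hinf; have [S1 [S2 [S1E S2E S12]]] := orth_isometries AK oe.
pose S := cuN S1E S2E S12; pose ax := cuN_axioms S1E S2E S12.
have mE n (x : S) : cu_muln n x = x *+ n := mulnE n x.
have comp := proj1 (has_comparisonE S1E S2E S12 m) Hcomp.
have div N : (1 <= N)%N -> forall x' x : S, cu_wb x' x ->
    exists y : S, cu_wb x' (y *+ N) /\ cu_wb (y *+ N) (x *+ M).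
  by move=> N1 x' x /(Hdiv _ N1)[y [h1 h2]]; exists y; rewrite -!mE.
have gl_2div : global_glimm A -> cu_2div (S := S) (@cu_le R AK) (@cu_wb R AK).
  exact: (@ggp_2div R A H AK e oe S1 S2 S1E S2E S12).
have two_gl : cu_2div (S := S) (@cu_le R AK) (@cu_wb R AK) -> global_glimm A.
  exact: (@two_div_ggp R A H AK e oe S1 S2 S1E S2E S12).
have parts_pure L : cu_2parts (S := S) (@cu_le R AK) (@cu_wb R AK) L -> pure AK.
  move=> p2; split.
    apply/(almost_unperforatedE S1E S2E S12); exact: (cu_parts_unperf ax comp div p2).
  apply/(almost_divisibleE S1E S2E S12); exact: (cu_parts_divisible ax comp div p2).
have pure_gl : pure AK -> global_glimm A.
  by move=> [_ /(almost_divisibleE S1E S2E S12) /cu_divisible_2div/two_gl].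
have gl_parts : global_glimm A -> exists L, cu_2parts (S := S) (@cu_le R AK) (@cu_wb R AK) L.
  by move=> /gl_2div/(cu_2div_2parts ax comp div).
have partsE L : cu_2parts (S := S) (@cu_le R AK) (@cu_wb R AK) L <->
    forall x' x : Cu AK, cu_wb x' x -> exists y0 y1 : Cu AK,
      [/\ cu_le (cu_add y0 y1) x, cu_wb x' (cu_muln L y0) & cu_wb x' (cu_muln L y1)].
  by split=> h x' x /h[y0 [y1 [h1 h2 h3]]]; exists y0, y1; split => //; move: h2 h3; rewrite !mE.
split; split.
- by move=> /gl_parts[L /partsE]; exists L.
- by move=> [L /partsE/parts_pure/pure_gl].
- by move=> /gl_parts[L /parts_pure].
- exact: pure_gl.
Qed.
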